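(* Let $\Delta=\{(s,t): 0\le s\le t<\infty\}$. (1) Let $(k_{s,t})_{(s,t)\in\Delta}$ be a family of transition kernels of a branching process on $[0,\infty]$. For $(s,t)\in\Delta$ let $v_{s,t}$ be the Laplace exponent of $k_{s,t}$, i.e. the (unique) Bernstein function with $$\int_{[0,\infty)} e^{-\theta y}\,k_{s,t}(x,\mathrm{d}y)=e^{-x v_{s,t}(\theta)}\qquad\text{for all }x,\theta\in(0,\infty),$$ extended holomorphically to $\mathbb{H}=\{\zeta\in\mathbb{C}:\operatorname{Re}\zeta>0\}$. Then $(v_{s,t})_{(s,t)\in\Delta}$ is a topological reverse evolution family in $\mathbb{H}$ contained in $\mathcal{BF}$. (2) Conversely, given a topological reverse evolution family $(v_{s,t})_{(s,t)\in\Delta}$ in $\mathbb{H}$ contained in $\mathcal{BF}$, there exists a unique family of transition kernels $(k_{s,t})_{(s,t)\in\Delta}$ of a branching process on $[0,\infty]$ such that $\int_{[0,\infty)} e^{-\theta y}\,k_{s,t}(x,\mathrm{d}y)=e^{-x v_{s,t}(\theta)}$ for all $(s,t)\in\Delta$ and $x,\theta\in(0,\infty)$.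
   Context: A transition kernel on a Polish space $S$ is a map $k:S\times\mathcal{B}(S)\to[0,1]$ with $k(x,\cdot)$ a Borel probability measure for each $x$ and $x\mapsto k(x,B)$ Borel measurable for each Borel $B$. Composition: $(k\star l)(x,B)=\int_S l(y,B)\,k(x,\mathrm{d}y)$. A family of transition kernels $(k_{s,t})_{(s,t)\in\Delta}$ on $[0,\infty]$ (a compact space) is called a family of transition kernels of a branching process if: (K1) $k_{s,s}(x,\cdot)=\delta_x$ for all $s\ge0$, $x\in[0,\infty]$; (K2) $k_{s,t}\star k_{t,u}=k_{s,u}$ for $0\le s\le t\le u$; (K3) the map $\Delta\times[0,\infty)\ni(s,t,x)\mapsto k_{s,t}(x,\cdot)$ is weakly continuous into probability measures on $[0,\infty]$; (K4) $k_{s,t}(x,\cdot)\ast k_{s,t}(y,\cdot)=k_{s,t}(x+y,\cdot)$ for $(s,t)\in\Delta$, $x,y\in[0,\infty)$ ($\ast$ = convolution); (K5) $k_{s,t}(0,\cdot)=\delta_0$; (K6) $k_{s,t}(\infty,\cdot)=\delta_\infty$. A Bernstein function is a $C^\infty$ function $f:(0,\infty)\to\mathbb{R}$ with $f\ge0$ and $(-1)^{n-1}f^{(n)}\ge0$ for all $n\in\mathbb{N}$; equivalently $f(\theta)=\alpha+\beta\theta+\int_{(0,\infty)}(1-e^{-\theta x})\tau(\mathrm{d}x)$ with $\alpha,\beta\ge0$ and $\tau$ a nonnegative Borel measure with $\int\min\{1,x\}\tau(\mathrm{d}x)<\infty$. Each Bernstein function extends holomorphically to $\mathbb{H}$ via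 this formula; $\mathcal{BF}$ denotes the set of Bernstein functions not identically zero, regarded as holomorphic self-maps of $\mathbb{H}$. For a simply connected domain $D\subsetneq\mathbb{C}$, ${\sf Hol}(D,D)$ carries the topology of locally uniform convergence. A topological reverse evolution family in $D$ is a family $(v_{s,t})_{(s,t)\in\Delta}\subset{\sf Hol}(D,D)$ with $v_{s,s}={\rm id}_D$ for all $s\ge0$, $v_{s,u}=v_{s,t}\circ v_{t,u}$ for $0\le s\le t\le u$, and $\Delta\ni(s,t)\mapsto v_{s,t}\in{\sf Hol}(D,D)$ continuous. It is contained in a set $\mathfrak U$ if all $v_{s,t}\in\mathfrak U$. *)

(* Defs.v *)
From HB Require Import structures.
From mathcomp Require Import all_boot all_order all_algebra.
From mathcomp Require Import all_classical all_reals all_analysis.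
From mathcomp Require Import measurable_realfun.
From mathcomp Require Import complex.
Import numFieldNormedType.Exports.
Import Order.TTheory GRing.Theory Num.Theory.

Set Implicit Arguments.
Unset Strict Implicit.
Unset Printing Implicit Defensive.

Local Open Scope classical_set_scope.
Local Open Scope ring_scope.

Section Defs.
Variable R : realType.

(** The state space [0,+oo] is the subset of \bar R of nonnegative
    extended reals; measures on it are probability measures on \bar R
    (Borel sigma-algebra) concentrated on [0,+oo]. *)
Definition Sp : set (\bar R) := [set y | (0 <= y)%E].

Definition Delta (s t : R) : Prop := 0 <= s /\ s <= t.

Definition is_kernel (k : \bar R -> probability (\bar R) R) : Prop :=
  (forall x, Sp x -> k x (~` Sp) = 0%E) /\
  (forall B : set (\bar R), measurable B -> measurable_fun Sp (fun x => k x B)).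

Definition kcomp (k l : \bar R -> probability (\bar R) R) (x : \bar R)
    (B : set (\bar R)) : \bar R :=
  (\int[k x]_(y in Sp) l y B)%E.

Definition conv (mu nu : probability (\bar R) R) (B : set (\bar R)) : \bar R :=
  (\int[mu]_a nu [set b | B (a + b)%E])%E.

Definition BP_kernel_family (k : R -> R -> \bar R -> probability (\bar R) R)
  : Prop :=
  (forall s t, Delta s t -> is_kernel (k s t)) /\
  (forall s x, 0 <= s -> Sp x ->
     forall B, measurable B -> k s s x B = \d_x B) /\
  (forall s t u, 0 <= s -> s <= t -> t <= u ->
     forall x, Sp x -> forall B, measurable B ->
       kcomp (k s t) (k t u) x B = k s u x B) /\
  (forall f : \bar R -> R, {within Sp, continuous f} ->
     {within [set p : R * R * R | Delta p.1.1 p.1.2 /\ 0 <= p.2],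
        continuous (fun p => Rintegral (k p.1.1 p.1.2 (p.2)%:E) Sp
                                       (fun y => f y))}) /\
  (forall s t x y, Delta s t -> 0 <= x -> 0 <= y ->
     forall B, measurable B ->
       conv (k s t x%:E) (k s t y%:E) B = k s t (x + y)%:E B) /\
  (forall s t, Delta s t -> forall B, measurable B ->
     k s t 0%E B = \d_(0%E) B) /\
  (forall s t, Delta s t -> forall B, measurable B ->
     k s t (+oo)%E B = \d_(+oo%E) B).

Definition Hp : set R[i] := [set z | 0 < complex.Re z].

Definition holomorphic_on_H (g : R[i] -> R[i]) : Prop :=
  forall z, Hp z -> derivable (g : R[i]^o -> R[i]^o) z 1.

Definition Hol_HH (g : R[i] -> R[i]) : Prop :=
  holomorphic_on_H g /\ (forall z, Hp z -> Hp (g z)).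

Definition Bernstein (f : R -> R) : Prop :=
  (forall (n : nat) (x : R), 0 < x -> derivable (derive1n n f) x 1) /\
  (forall x : R, 0 < x -> 0 <= f x) /\
  (forall (n : nat) (x : R), 0 < x -> 0 <= (-1) ^+ n * derive1n n.+1 f x).

(** BF: (holomorphic extensions to H of) Bernstein functions that are not
    identically zero, as elements of Hol(H,H).  Since H is connected, the
    holomorphic extension of f is the unique holomorphic function on H
    agreeing with f on (0,oo). *)
Definition inBF (g : R[i] -> R[i]) : Prop :=
  Hol_HH g /\
  exists f : R -> R, Bernstein f /\ (exists x, 0 < x /\ f x != 0) /\
    (forall x : R, 0 < x -> g (x%:C)%C = ((f x)%:C)%C).

(** Topological reverse evolution family in H (parametrized by Delta);
    Hol(H,H) carries the topology of locally uniform convergence on H. *)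
Definition top_rev_evol_family_H (v : R -> R -> R[i] -> R[i]) : Prop :=
  (forall s t, Delta s t -> Hol_HH (v s t)) /\
  (forall s, 0 <= s -> forall z, Hp z -> v s s z = z) /\
  (forall s t u, 0 <= s -> s <= t -> t <= u ->
     forall z, Hp z -> v s u z = v s t (v t u z)) /\
  (forall s0 t0, Delta s0 t0 ->
     forall K : set R[i]^o, compact K -> K `<=` Hp ->
     forall eps : R, 0 < eps -> exists2 delta : R, 0 < delta &
       forall s t, Delta s t -> `|s - s0| < delta -> `|t - t0| < delta ->
         forall z, K z -> `|v s t z - v s0 t0 z| < (eps%:C)%C).

Definition laplace_rel (kst : \bar R -> probability (\bar R) R)
    (g : R[i] -> R[i]) : Prop :=
  forall x theta : R, 0 < x -> 0 < theta ->
    complex.Im (g (theta%:C)%C) = 0 /\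
    (\int[kst x%:E]_(y in [set y : \bar R | (0 <= y)%E /\ (y < +oo)%E])
        (expR (- theta * fine y))%:E
      = (expR (- x * complex.Re (g (theta%:C)%C)))%:E)%E.

End Defs.

(* Main.v *)
Require Import Defs.
From HB Require Import structures.
From mathcomp Require Import all_boot all_order all_algebra.
From mathcomp Require Import all_classical all_reals all_analysis.
From mathcomp Require Import measurable_realfun.
From mathcomp Require Import complex.
From mathcomp Require Import giry.
From mathcomp Require Import ring lra.
Import numFieldNormedType.Exports.
Import Order.TTheory GRing.Theory Num.Theory.
Set Implicit Arguments.
Unset Strict Implicit.
Unset Printing Implicit Defensive.
Local Open Scope classical_set_scope.
Local Open Scope ring_scope.

(** A measure on [0,+oo] is determined by its Laplace transform: in the
    coordinate exp(-y) continuous functions are uniform limits of polynomials.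

    (1) By the identity theorem exp(-x v_{s,t}) is the complex Laplace transform of
    k_{s,t}(x, .) on the whole half-plane.  Hence v_{s,t} is the limit of
    (1 - exp(-x v_{s,t})) / x as x -> 0, uniformly in (s,t), which transfers the weak
    continuity of the kernels to v; the alternating signs of the finite differences of
    Laplace transforms pass to the same limit and give the Bernstein property.
    If v_{s,t} vanished, then at the first time t0 where v_{s,t0} = 0 the factorisation
    v_{s,t0} = v_{s,a} o v_{a,t0} with a < t0 close to t0 would be contradictory, since
    v_{a,t0} is close to the identity.

    (2) exp(-x v_{s,t}) is completely monotone, so by the Bernstein-Widder theorem it is
    a Laplace transform; the axioms are identities and limits between Laplace
    transforms.  The representing measure is an ultrafilter limit of the step functions
    of Hausdorff's moment problem.

    The identity theorem is derived without power series: Goursat's theorem on rectangles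
    in the logarithmic coordinate gives the mean value property, hence the maximum
    principle, and a two-constants argument finishes. *)

(** On the half-plane exp(-x v) determines v only up to multiples of 2 pi i / x. Comparing v with (1
    - exp(-x v)) / x for one small x avoids following a branch of the logarithm. This requires a
    bound on v that is locally uniform in (s, t); it comes from bounding |1 - exp(-z y)| by a
    multiple of 1 - exp(-y) on all of [0,+oo].

    Strict positivity of the exponents has to precede the composition rule. Transforms are known at
    positive arguments only, so composing kernels yields v_{s,u} = v_{s,t} o v_{t,u} only where
    v_{t,u} is known to be positive.

    The point +oo carries mass that no exponential sees. In the coordinate u = exp(-y) it is the
    endpoint 0 of a compact interval, the total mass is the moment of order zero, and one polynomial
    approximates a given continuous function for all laws at once. Uniqueness, measurability in x
    and weak continuity are all drawn from this uniformity. *)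

Section WithinContinuity.
Variable R : realType.

Lemma within_epsP (A : set (R * R * R)) (g : R * R * R -> R) :
  {within A, continuous g} <-> forall p0, A p0 -> forall e : R, 0 < e ->
    exists2 d : R, 0 < d & forall p, A p -> `|p.1.1 - p0.1.1| < d -> `|p.1.2 - p0.1.2| < d ->
      `|p.2 - p0.2| < d -> `|g p - g p0| < e.
Proof.
rewrite subspace_continuousP; split=> [H p0 Ap0 e e0|H p0 Ap0].
  have /cvgrPdist_lt/(_ e e0) := H p0 Ap0.
  rewrite /prop_near1 /within /= => -[[U W] /= [[[U1 U2] /= [nU1 nU2] sU] nW] sUW].
  have [d1 /= d10 H1] := (nbhs_ballP _ _).1 nU1.
  have [d2 /= d20 H2] := (nbhs_ballP _ _).1 nU2.
  have [d3 /= d30 H3] := (nbhs_ballP _ _).1 nW.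
  exists (Num.min d1 (Num.min d2 d3)); first by rewrite !lt_min d10 d20.
  move=> [[a b] c] Ap /=; rewrite !lt_min => /and3P[h1 _ _] /and3P[_ h2 _] /and3P[_ _ h3].
  rewrite distrC; apply: (sUW (a, b, c)) => //; split => /=.
    by apply: sU; split => /=; [apply: H1|apply: H2]; rewrite /ball /= distrC.
  by apply: H3; rewrite /ball /= distrC.
apply/cvgrPdist_lt => e e0; have [d d0 {}H] := H p0 Ap0 e e0.
rewrite /prop_near1 /within /=.
exists (ball p0.1.1 d `*` ball p0.1.2 d, ball p0.2 d).
  split => /=; last exact: nbhsx_ballx.
  by exists (ball p0.1.1 d, ball p0.1.2 d) => //; split; exact: nbhsx_ballx.
move=> [[a b] c] [[/= h1 h2] h3] Ap; rewrite distrC; apply: H => //=; rewrite distrC.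
- exact: h1.
- exact: h2.
- exact: h3.
Qed.

End WithinContinuity.

Section ContinuityIn.
Variables (R : realType) (W : topologicalType).
Implicit Types f g : W -> R.

(** [W] stays abstract so that these closure rules also apply to the subspace topologies in which
    weak continuity of the kernels is stated. *)
Lemma fun_contM f g : continuous f -> continuous g -> continuous (fun x => f x * g x).
Proof. by move=> cf cg x; apply: (@cvgM R W (nbhs x) _ f g); [exact: cf|exact: cg]. Qed.

Lemma fun_contN f : continuous f -> continuous (fun x => - f x).
Proof. by move=> cf x; apply: (@cvgN _ _ W (nbhs x) _ f); exact: cf. Qed.

Lemma fun_cont_expR f : continuous f -> continuous (fun x => expR (f x)).
Proof.
move=> cf x; apply: (@continuous_comp W R R f (@expR R) x); first exact: cf.
exact: continuous_expR.
Qed.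

Lemma fun_cont_sum I (r : seq I) (f : I -> W -> R) : (forall i, continuous (f i)) ->
  continuous (fun x => \sum_(i <- r) f i x).
Proof.
move=> cf; elim: r => [|i r IH].
  by rewrite (_ : (fun x => _) = fun=> 0); [move=> x; exact: cvg_cst|apply/funext => x; rewrite big_nil].
rewrite (_ : (fun x => _) = fun x => f i x + \sum_(j <- r) f j x); last first.
  by apply/funext => x; rewrite big_cons.
move=> x; apply: (@cvgD _ _ W (nbhs x) _ (f i)); [exact: cf|exact: IH].
Qed.

End ContinuityIn.

(** * Cauchy's theorem and complex derivatives *)

Section SegmentIntegral.
Variable R : realType.
Local Notation mu := (@lebesgue_measure R).
Implicit Types (f g : R -> R) (a b : R).

Definition sint f a b : R := \int[mu]_(x in `[a, b]) f x.

Lemma seg_integrable f a b :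
  (forall x, a <= x <= b -> {for x, continuous f}) ->
  mu.-integrable `[a, b] (EFin \o f).
Proof.
move=> cf; apply: continuous_compact_integrable; first exact: segment_compact.
by apply: continuous_in_subspaceT => x; rewrite inE /= in_itv /= => /cf.
Qed.

Lemma sintB f g a b :
  (forall x, a <= x <= b -> {for x, continuous f}) ->
  (forall x, a <= x <= b -> {for x, continuous g}) ->
  sint (fun x => f x - g x) a b = sint f a b - sint g a b.
Proof. by move=> cf cg; rewrite /sint RintegralB//; exact: seg_integrable. Qed.

Lemma sint_split f a m b : a <= m -> m <= b ->
  (forall x, a <= x <= b -> {for x, continuous f}) ->
  sint f a b = sint f a m + sint f m b.
Proof.
move=> am mb cf; have fi := seg_integrable cf.
have := @Rintegral_itvB _ f (BLeft a) (BRight b) m fi.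
rewrite !bnd_simp => /(_ am mb) => H.
rewrite /sint -(Rintegral_itv_obnd_cbnd (r := m)); last first.
  apply: integrableS fi => //.
  by move=> x /=; rewrite !in_itv /= => /andP[mx ->]; rewrite (le_trans am (ltW mx)).
by rewrite -H addrC subrK.
Qed.

Lemma sint_cst c a b : a <= b -> sint (fun=> c) a b = c * (b - a).
Proof.
move=> ab; rewrite /sint Rintegral_cst//; congr (_ * _).
have /= -> := @lebesgue_measure_itv R `[a, b].
rewrite lte_fin; case: ltgtP ab => // -> _ /=; by rewrite subrr.
Qed.

Lemma sint_le f g a b :
  (forall x, a <= x <= b -> {for x, continuous f}) ->
  (forall x, a <= x <= b -> {for x, continuous g}) ->
  (forall x, a <= x <= b -> f x <= g x) -> sint f a b <= sint g a b.
Proof.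
move=> cf cg fg; have fi := seg_integrable cf; have gi := seg_integrable cg.
exact: le_Rintegral.
Qed.

Lemma sint_approx f c e a b : a <= b ->
  (forall x, a <= x <= b -> {for x, continuous f}) ->
  (forall x, a <= x <= b -> `|f x - c| <= e) -> `|sint f a b - c * (b - a)| <= e * (b - a).
Proof.
move=> ab cf fe.
have cc (k : R) : forall x, a <= x <= b -> {for x, continuous (fun _ : R => k)}.
  by move=> x _; exact: cst_continuous.
have lo : sint (fun=> c - e) a b <= sint f a b.
  apply: sint_le => //; first exact: cc.
  move=> x /fe /=; rewrite ler_norml => /andP[? ?]; lra.
have hi : sint f a b <= sint (fun=> c + e) a b.
  apply: sint_le => //; first exact: cc.
  move=> x /fe /=; rewrite ler_norml => /andP[? ?]; lra.
by move: lo hi; rewrite !sint_cst// ler_norml => ? ?; apply/andP; split; lra.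
Qed.

End SegmentIntegral.

Section ContEps.
Variable R : realType.

Lemma cont_epsP (f : R -> R) (x : R) : {for x, continuous f} <->
  forall e, 0 < e -> exists2 d, 0 < d & forall y, `|y - x| < d -> `|f y - f x| < e.
Proof.
split=> [cf e e0|H].
  have /cvgrPdist_lt/(_ e e0)/nbhs_ballP[d /= d0 H] := cf.
  by exists d => // y yx; rewrite distrC; apply: H; rewrite /ball /= distrC.
apply/cvgrPdist_lt => e /H[d d0 {}H]; apply/nbhs_ballP; exists d => // y.
by rewrite /ball /= distrC => /H; rewrite distrC.
Qed.

End ContEps.

(** * Goursat's theorem for closed forms on rectangles *)

Section Goursat.
Variable R : realType.

(** Total differentiability with gradient (p, q), in the l1 norm of the plane. Nothing says that the
    gradient varies continuously, which is why a subdivision argument follows. *)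
Definition grad_at (A : R -> R -> R) (x0 y0 p q : R) :=
  forall e, 0 < e -> exists2 d, 0 < d & forall x y, `|x - x0| <= d -> `|y - y0| <= d ->
   `|A x y - A x0 y0 - p * (x - x0) - q * (y - y0)| <= e * (`|x - x0| + `|y - y0|).

Lemma grad_at_contx A x0 y0 p q : grad_at A x0 y0 p q ->
  {for x0, continuous (A^~ y0)}.
Proof.
move=> gA; apply/cont_epsP => e e0.
have [d d0 H] := gA 1 ltr01.
exists (Num.min d (e / (2 + `|p|))).
  by rewrite lt_min d0 divr_gt0// ltr_wpDr.
move=> x; rewrite lt_min => /andP[xd].
rewrite ltr_pdivlMr ?ltr_wpDr// => xe.
have := H x y0 (ltW xd); rewrite subrr normr0 (ltW d0) => /(_ isT).
rewrite mulr0 subr0 addr0 mul1r => H1.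
have : `|A x y0 - A x0 y0| <= `|x - x0| + `|p| * `|x - x0|.
  have := ler_normD (A x y0 - A x0 y0 - p * (x - x0)) (p * (x - x0)).
  by rewrite subrK normrM; lra.
have := normr_ge0 (x - x0); have := normr_ge0 p; nra.
Qed.

Lemma grad_at_swap A x0 y0 p q : grad_at A x0 y0 p q -> grad_at (fun y x => A x y) y0 x0 q p.
Proof.
move=> gA e e0; have [d d0 H] := gA e e0; exists d => // y x yd xd.
have := H x y xd yd; rewrite [X in e * X]addrC.
by rewrite -!addrA [in X in X -> _](addrC (- (p * _))).
Qed.

Lemma grad_at_conty A x0 y0 p q : grad_at A x0 y0 p q ->
  {for y0, continuous (A x0)}.
Proof. by move/grad_at_swap/grad_at_contx. Qed.

Variables (A B : R -> R -> R) (a0 b0 c0 d0 : R).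
Hypotheses (ab : a0 < b0) (cd : c0 < d0).
(** The shared [q] says dA/dy = dB/dx: the form A dx + B dy is closed at each point. *)
Hypothesis gAB : forall x y, a0 <= x <= b0 -> c0 <= y <= d0 ->
  exists p q r, grad_at A x y p q /\ grad_at B x y q r.

(** Minus the counterclockwise circulation of A dx + B dy along the boundary. *)
Let J a b c d := sint (fun x => A x d - A x c) a b - sint (fun y => B b y - B a y) c d.

Let contA x y : a0 <= x <= b0 -> c0 <= y <= d0 -> {for x, continuous (A^~ y)}.
Proof. by move=> hx hy; have [p [q [r [/grad_at_contx]]]] := gAB hx hy. Qed.

Let contB x y : a0 <= x <= b0 -> c0 <= y <= d0 -> {for y, continuous (B x)}.
Proof. by move=> hx hy; have [p [q [r [_ /grad_at_conty]]]] := gAB hx hy. Qed.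

Let cA y y' : c0 <= y <= d0 -> c0 <= y' <= d0 ->
  forall x, a0 <= x <= b0 -> {for x, continuous (fun x => A x y - A x y')}.
Proof. by move=> hy hy' x hx; apply: continuousB; exact: contA. Qed.

Let cB x x' : a0 <= x <= b0 -> a0 <= x' <= b0 ->
  forall y, c0 <= y <= d0 -> {for y, continuous (fun y => B x y - B x' y)}.
Proof. by move=> hy hy' y hx; apply: continuousB; exact: contB. Qed.

Let sub_itv (a b a' b' : R) : a' <= a -> b <= b' -> forall x, a <= x <= b -> a' <= x <= b'.
Proof. by move=> aa bb x /andP[ax xb]; rewrite (le_trans aa ax) (le_trans xb bb). Qed.

Let Jx a m b c d : a0 <= a -> a <= m -> m <= b -> b <= b0 -> c0 <= c -> c <= d -> d <= d0 ->
  J a b c d = J a m c d + J m b c d.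
Proof.
move=> h1 h2 h3 h4 h5 h6 h7; rewrite /J.
have hc : c0 <= c <= d0 by lra.
have hd : c0 <= d <= d0 by lra.
have s1 := sub_itv h1 h4; have s2 := sub_itv h5 h7.
rewrite (sint_split h2 h3); last by move=> x /s1; exact: cA.
have -> : sint (fun y => B b y - B a y) c d =
  sint (fun y => B b y - B m y) c d + sint (fun y => B m y - B a y) c d.
  have cf z : a <= z <= b -> forall y, c <= y <= d -> {for y, continuous (B z)}.
    by move=> /s1 hz y /s2; exact: contB.
  by rewrite !sintB; try (apply: cf; lra); ring.
ring.
Qed.

Let Jy a b c m d : a0 <= a -> a <= b -> b <= b0 -> c0 <= c -> c <= m -> m <= d -> d <= d0 ->
  J a b c d = J a b c m + J a b m d.
Proof.
move=> h1 h2 h3 h4 h5 h6 h7; rewrite /J.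
have hc : a0 <= a <= b0 by lra.
have hd : a0 <= b <= b0 by lra.
have s1 := sub_itv h1 h3; have s2 := sub_itv h4 h7.
rewrite (sint_split h5 h6); last by move=> x /s2; exact: cB.
have -> : sint (fun x => A x d - A x c) a b =
  sint (fun x => A x d - A x m) a b + sint (fun x => A x m - A x c) a b.
  have cf z : c <= z <= d -> forall y, a <= y <= b -> {for y, continuous (A^~ z)}.
    by move=> /s2 hz y /s1 hy; exact: contA.
  by rewrite !sintB; try (apply: cf; lra); ring.
ring.
Qed.

(** The affine parts cancel: both integrals have the main term q (b - a) (d - c), and only the
    differentiability error, integrated along the sides, remains. *)
Let Jlocal x0 y0 : a0 <= x0 <= b0 -> c0 <= y0 <= d0 -> forall e, 0 < e ->
  exists2 dl, 0 < dl & forall a b c d, a0 <= a -> a <= x0 <= b -> b <= b0 ->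
    c0 <= c -> c <= y0 <= d -> d <= d0 -> b - a <= dl -> d - c <= dl ->
    `|J a b c d| <= e * ((b - a) + (d - c)) ^+ 2.
Proof.
move=> hx hy e e0; have [p [q [r [gA gB]]]] := gAB hx hy.
have e20 : 0 < e / 4 by lra.
have [d1 d10 HA] := gA _ e20; have [d2 d20 HB] := gB _ e20.
exists (Num.min d1 d2); first by rewrite lt_min d10.
move=> a b c d h1 /andP[h2 h3] h4 h5 /andP[h6 h7] h8; rewrite !le_min => /andP[l1 l2] /andP[l3 l4].
have s1 := sub_itv h1 h4; have s2 := sub_itv h5 h8.
have nx x : a <= x <= b -> `|x - x0| <= b - a by move=> /andP[? ?]; rewrite ler_norml; apply/andP; split; lra.
have ny y : c <= y <= d -> `|y - y0| <= d - c by move=> /andP[? ?]; rewrite ler_norml; apply/andP; split; lra.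
have EA : `|sint (fun x => A x d - A x c) a b - (q * (d - c)) * (b - a)|
   <= (e / 2 * ((b - a) + (d - c))) * (b - a).
  apply: sint_approx; [lra|by move=> x /s1; apply: cA; lra|].
  move=> x hxx; have nxx := nx _ hxx.
  have nd : `|d - y0| <= d - c by apply: ny; lra.
  have nc : `|c - y0| <= d - c by apply: ny; lra.
  have := HA x d (le_trans nxx l1) (le_trans nd l3).
  have := HA x c (le_trans nxx l1) (le_trans nc l3).
  have := normr_ge0 (x - x0); move: nxx nd nc.
  move: `|x - x0| `|d - y0| `|c - y0| => nX nD nC.
  rewrite !ler_norml => n1 n2 n3 n4 /andP[u1 u2] /andP[u3 u4]; apply/andP; split; nra.
have EB : `|sint (fun y => B b y - B a y) c d - (q * (b - a)) * (d - c)|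
   <= (e / 2 * ((b - a) + (d - c))) * (d - c).
  apply: sint_approx; [lra|by move=> x /s2; apply: cB; lra|].
  move=> x hxx; have nxx := ny _ hxx.
  have nd : `|b - x0| <= b - a by apply: nx; lra.
  have nc : `|a - x0| <= b - a by apply: nx; lra.
  have := HB b x (le_trans nd l2) (le_trans nxx l4).
  have := HB a x (le_trans nc l2) (le_trans nxx l4).
  have := normr_ge0 (x - y0); move: nxx nd nc.
  move: `|x - y0| `|b - x0| `|a - x0| => nX nD nC.
  rewrite !ler_norml => n1 n2 n3 n4 /andP[u1 u2] /andP[u3 u4]; apply/andP; split; nra.
rewrite /J; move: EA EB; set X := sint _ a b; set Y := sint _ c d.
rewrite !ler_norml => /andP[u1 u2] /andP[u3 u4].
have ba : 0 <= b - a by lra.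
have dc : 0 <= d - c by lra.
move: (b - a) (d - c) ba dc u1 u2 u3 u4 => u v *; apply/andP; split; nra.
Qed.

Let L := b0 - a0.
Let M := d0 - c0.
Let sx n : R := L / 2 ^+ n.
Let sy n : R := M / 2 ^+ n.

(** A rectangle of the n-th subdivision on which |J| exceeds [e] times the area. Since J is
    additive, the excess survives in at least one of the four quarters. *)
Let inv e n (p : R * R) := [/\ a0 <= p.1, p.1 + sx n <= b0, c0 <= p.2, p.2 + sy n <= d0 &
  e * (sx n * sy n) < `|J p.1 (p.1 + sx n) p.2 (p.2 + sy n)|].

Let sxS n : sx n = sx n.+1 + sx n.+1.
Proof. by rewrite /sx exprS; field; rewrite expf_neq0. Qed.
Let syS n : sy n = sy n.+1 + sy n.+1.
Proof. by rewrite /sy exprS; field; rewrite expf_neq0. Qed.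
Let sx0 n : 0 < sx n. Proof. by rewrite divr_gt0 ?exprn_gt0 ?subr_gt0. Qed.
Let sy0 n : 0 < sy n. Proof. by rewrite divr_gt0 ?exprn_gt0 ?subr_gt0. Qed.

Let step e n p : inv e n p -> exists2 q, inv e n.+1 q &
  [/\ p.1 <= q.1, q.1 + sx n.+1 <= p.1 + sx n, p.2 <= q.2 & q.2 + sy n.+1 <= p.2 + sy n].
Proof.
case: p => a c [/= h1 h2 h3 h4 bad].
have X0 := sx0 n.+1; have Y0 := sy0 n.+1.
move: X0 Y0 bad h2 h4; rewrite (sxS n) (syS n); set X := sx n.+1; set Y := sy n.+1.
move=> X0 Y0 bad h2 h4.
pose ok u v := `|J u (u + X) v (v + Y)| <= e * (X * Y).
have [ok1|] := boolP (ok a c); last first.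
  by rewrite -ltNge => b1; exists (a, c); [rewrite /inv /= -/X -/Y|]; split=> //=; lra.
have [ok2|] := boolP (ok (a + X) c); last first.
  by rewrite -ltNge => b1; exists (a + X, c); [rewrite /inv /= -/X -/Y|]; split=> //=; lra.
have [ok3|] := boolP (ok a (c + Y)); last first.
  by rewrite -ltNge => b1; exists (a, c + Y); [rewrite /inv /= -/X -/Y|]; split=> //=; lra.
have [ok4|] := boolP (ok (a + X) (c + Y)); last first.
  by rewrite -ltNge => b1; exists (a + X, c + Y); [rewrite /inv /= -/X -/Y|]; split=> //=; lra.
exfalso; move: bad; rewrite (@Jx a (a + X)); try lra.
rewrite (@Jy a (a + X) c (c + Y)); try lra.
rewrite (@Jy (a + X) (a + (X + X)) c (c + Y)); try lra.
have eX : a + X + X = a + (X + X) by rewrite addrA.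
have eY : c + Y + Y = c + (Y + Y) by rewrite addrA.
move: ok1 ok2 ok3 ok4; rewrite /ok eX eY => k1 k2 k3 k4.
have tri (x y z t k : R) : `|x| <= k -> `|y| <= k -> `|z| <= k -> `|t| <= k ->
    `|x + y + (z + t)| <= 4 * k.
  move=> q1 q2 q3 q4; have := ler_normD (x + y) (z + t).
  have := ler_normD x y; have := ler_normD z t; lra.
move/lt_le_trans/(_ (tri _ _ _ _ _ k1 k3 k2 k4)).
by rewrite (_ : 4 * _ = e * ((X + X) * (Y + Y))) ?ltxx//; ring.
Qed.

Lemma expr2_ge (C e : R) : 0 < e -> exists n, C / 2 ^+ n <= e.
Proof.
move=> e0; pose n := Num.bound `|C / e|; exists n.
have h : C / e < 2 ^+ n.
  have h1 : C / e < n%:R by apply: le_lt_trans (archi_boundP (normr_ge0 _)); exact: ler_norm.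
  by apply: (lt_le_trans h1); rewrite -natrX ler_nat ltnW // ltn_expl.
by rewrite ler_pdivrMr ?exprn_gt0// mulrC -ler_pdivrMr// ltW.
Qed.

Theorem goursat :
  sint (fun x => A x d0 - A x c0) a0 b0 = sint (fun y => B b0 y - B a0 y) c0 d0.
Proof.
apply/eqP; rewrite -subr_eq0; apply/negPn/negP => J0.
have L0 : 0 < L by rewrite subr_gt0.
have M0 : 0 < M by rewrite subr_gt0.
(* Half the defect per unit area, so that the full rectangle violates the bound strictly. *)
pose e := `|J a0 b0 c0 d0| / (2 * (L * M)).
have Jgt0 : 0 < `|J a0 b0 c0 d0| by rewrite normr_gt0.
have e0 : 0 < e by rewrite divr_gt0// mulr_gt0// mulr_gt0.
have inv0 : inv e 0 (a0, c0).
  rewrite /inv /= /sx /sy !expr0 !divr1 /L /M ![_ + (_ - _)]addrC !subrK; split=> //.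
  rewrite -/L -/M (_ : e * (L * M) = `|J a0 b0 c0 d0| / 2); first by lra.
  by rewrite /e; field; rewrite !gt_eqF.
pose nxt n (p : {q | inv e n q}) : {q | inv e n.+1 q} :=
  let: exist2 q iq _ := cid2 (step (svalP p)) in exist _ q iq.
pose fix f n : {q | inv e n q} :=
  if n is m.+1 then nxt m (f m) else exist _ (a0, c0) inv0.
pose a n := (sval (f n)).1; pose c n := (sval (f n)).2.
have invf n : inv e n (a n, c n) by rewrite /a /c; case: (f n) => -[].
have mono n : [/\ a n <= a n.+1, a n.+1 + sx n.+1 <= a n + sx n,
  c n <= c n.+1 & c n.+1 + sy n.+1 <= c n + sy n].
  rewrite /a /c /=; rewrite /nxt; case: cid2 => q iq /=; by case: (f n) => -[].
have mono2 n m : [/\ a n <= a (n + m)%N, a (n + m)%N + sx (n + m)%N <= a n + sx n,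
  c n <= c (n + m)%N & c (n + m)%N + sy (n + m)%N <= c n + sy n].
  elim: m => [|m [h1 h2 h3 h4]]; first by rewrite addn0.
  have [k1 k2 k3 k4] := mono (n + m)%N; rewrite addnS; split; lra.
have abd n m : a m <= a n + sx n /\ c m <= c n + sy n.
  case: (leqP n m) => [nm|/ltnW nm].
    have := mono2 n (m - n)%N; rewrite subnKC// => -[_ h _ k].
    have := sx0 m; have := sy0 m; split; lra.
  have := mono2 m (n - m)%N; rewrite subnKC// => -[h _ k _].
  have := sx0 n; have := sy0 n; split; lra.
(* Nested intervals: every left endpoint lies below every right endpoint, so the supremum of the
   left endpoints belongs to all intervals. *)
have supP (u : nat -> R) v : (forall n m, u m <= u n + v n) ->
    forall n, u n <= sup (range u) <= u n + v n.
  move=> uv n; apply/andP; split.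
    apply: ub_le_sup; last by exists n.
    by exists (u n + v n) => _ [m _ <-].
  apply: ge_sup; first by exists (u 0); exists 0%N.
  by move=> _ [m _ <-].
have sa := supP a sx (fun n m => (abd n m).1).
have sc := supP c sy (fun n m => (abd n m).2).
have [i1 i2 i3 i4 _] := invf 0%N; simpl in *.
have ha : a0 <= sup (range a) <= b0 by have /andP[] := sa 0%N; lra.
have hc : c0 <= sup (range c) <= d0 by have /andP[] := sc 0%N; lra.
have LM0 : 0 < L * M by exact: mulr_gt0.
have LpM0 : 0 < (L + M) ^+ 2 by rewrite exprn_gt0// addr_gt0.
(* All rectangles are similar to the first one, so the area is L M / (L + M)^2 times (width +
   height)^2. With this constant the local bound contradicts [inv]. *)
have [dl dl0 loc] := Jlocal ha hc (divr_gt0 (mulr_gt0 e0 LM0) LpM0).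
have [n ndl] := expr2_ge (L + M) dl0.
have [j1 j2 j3 j4 bad] := invf n; simpl in *.
have p2 : (0 : R) < 2 ^+ n by rewrite exprn_gt0.
have : sx n + sy n <= dl by rewrite /sx /sy -mulrDl.
have := sx0 n; have := sy0 n => y0 x0 sdl.
have H := loc (a n) (a n + sx n) (c n) (c n + sy n) j1 (sa n) j2 j3 (sc n) j4.
have ex : a n + sx n - a n = sx n by ring.
have ey : c n + sy n - c n = sy n by ring.
rewrite ex ey in H; move/lt_le_trans: bad => /(_ _ (H _ _)).
have -> : sx n <= dl by lra.
have -> : sy n <= dl by lra.
move=> /(_ isT isT).
rewrite /sx /sy.
have -> : e * (L * M) / (L + M) ^+ 2 * (L / 2 ^+ n + M / 2 ^+ n) ^+ 2 =
  e * (L / 2 ^+ n * (M / 2 ^+ n)).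
  by field; rewrite !gt_eqF// addr_gt0.
by rewrite ltxx.
Qed.

End Goursat.

(** * Complex derivatives in the l1 norm *)

Section ComplexDerivative.
Variable R : realType.
Local Notation C := R[i].
Local Notation Re := complex.Re.
Local Notation Im := complex.Im.
Implicit Types (z w h l : C) (f g : C -> C).

(** The l1 norm. It takes values in [R], whereas the norm of [R[i]] takes values in [R[i]]; it is
    submultiplicative, and it treats real and imaginary parts by mere addition. *)
Definition cn z : R := `|Re z| + `|Im z|.

(** Multiplicative form of the derivative: no division by h, hence no punctured neighbourhood. *)
Definition cderiv g z l := forall e : R, 0 < e -> exists2 d : R, 0 < d &
  forall h, cn h <= d -> cn (g (z + h) - g z - l * h) <= e * cn h.

Lemma cReD z w : Re (z + w) = Re z + Re w. Proof. by case: z w => ? ? [? ?]. Qed.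
Lemma cImD z w : Im (z + w) = Im z + Im w. Proof. by case: z w => ? ? [? ?]. Qed.
Lemma cReN z : Re (- z) = - Re z. Proof. by case: z. Qed.
Lemma cImN z : Im (- z) = - Im z. Proof. by case: z. Qed.
Lemma cReM z w : Re (z * w) = Re z * Re w - Im z * Im w. Proof. by case: z w => ? ? [? ?]. Qed.
Lemma cImM z w : Im (z * w) = Re z * Im w + Im z * Re w. Proof. by case: z w => ? ? [? ?]. Qed.
Definition RIE := (cReD, cImD, cReN, cImN, cReM, cImM).

Lemma complexP z w : Re z = Re w -> Im z = Im w -> z = w.
Proof. by case: z w => ? ? [? ?] /= -> ->. Qed.

Lemma cn_ge0 z : 0 <= cn z. Proof. by rewrite addr_ge0. Qed.

Lemma cnD z w : cn (z + w) <= cn z + cn w.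
Proof. by rewrite /cn !RIE; have := ler_normD (Re z) (Re w); have := ler_normD (Im z) (Im w); lra. Qed.

Lemma cnN z : cn (- z) = cn z. Proof. by rewrite /cn !RIE !normrN. Qed.

Lemma cnM z w : cn (z * w) <= cn z * cn w.
Proof.
rewrite /cn !RIE; have := ler_normB (Re z * Re w) (Im z * Im w).
have := ler_normD (Re z * Im w) (Im z * Re w); rewrite !normrM; lra.
Qed.

Lemma normC_cn z : `|z| <= (cn z)%:C%C.
Proof.
rewrite normc_def lecR -[leRHS]ger0_norm ?cn_ge0// -sqrtr_sqr ler_sqrt ?sqr_ge0//.
rewrite /cn -(real_normK (num_real (Re z))) -(real_normK (num_real (Im z))).
by have := normr_ge0 (Re z); have := normr_ge0 (Im z); nra.
Qed.

Lemma cn_normC z (e : R) : `|z| <= e%:C%C -> cn z <= 2 * e.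
Proof.
rewrite normc_def lecR => H.
have a : `|Re z| <= e.
  by apply: le_trans H; rewrite -sqrtr_sqr ler_sqrt ?addr_ge0 ?sqr_ge0// lerDl sqr_ge0.
have b : `|Im z| <= e.
  by apply: le_trans H; rewrite -sqrtr_sqr ler_sqrt ?addr_ge0 ?sqr_ge0// lerDr sqr_ge0.
by rewrite /cn; lra.
Qed.

Lemma cn_normC_lt z (e : R) : `|z| < e%:C%C -> cn z < 2 * e.
Proof.
rewrite normc_def ltcR => H.
have : cn z <= 2 * Num.sqrt (Re z ^+ 2 + Im z ^+ 2) by apply: cn_normC; rewrite normc_def.
by lra.
Qed.

Lemma nbhsC_cnP z (P : set C) : nbhs (z : C^o) P <->
  exists2 d : R, 0 < d & forall w, cn (w - z) <= d -> P w.
Proof.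
split=> [/nbhs_ballP[d /= d0 H]|[d d0 H]].
  have [r dr] : exists r, d = r%:C%C.
    by exists (Re d); apply: complexP => //=; apply: ger0_Im; exact: ltW.
  rewrite dr in d0 H; rewrite ltcR in d0.
  exists (r / 2); first by lra.
  move=> w wz; apply: H; rewrite /ball /= distrC; apply: (le_lt_trans (normC_cn _)).
  by rewrite ltcR; lra.
apply/nbhs_ballP; exists (d / 2)%:C%C => /=; first by rewrite ltcR; lra.
by move=> w; rewrite /ball /= distrC => /cn_normC_lt ?; apply: H; lra.
Qed.

Lemma cderivP g z : derivable (g : C^o -> C^o) z 1 <-> exists l, cderiv g z l.
Proof.
split.
  move=> /cvg_ex[/= l /cvgrPdist_le H]; exists l => e e0.
  have e20 : 0 < (e / 4)%:C%C :> C by rewrite ltcR; lra.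
  have := H _ e20; rewrite /prop_near1 /dnbhs /within /= => /nbhsC_cnP[d d0 {}H].
  exists d => // h hd; have [->|h0] := eqVneq h 0.
    by rewrite addr0 mulr0 subr0 subrr /cn /= normr0 addr0 mulr0.
  have := H h; rewrite subr0 => /(_ hd h0).
  rewrite scaler1 => /cn_normC H1.
  have -> : g (z + h) - g z - l * h = - (h * (l - h^-1 *: (g (h + z) - g z))).
    rewrite mulrBr -[_ *: _]/(h^-1 * _) mulVKf// opprB [z + h]addrC; ring.
  rewrite cnN; apply: (le_trans (cnM _ _)); rewrite mulrC.
  by apply: ler_wpM2r; [exact: cn_ge0|lra].
move=> [l H]; apply/cvg_ex; exists l; apply/cvgrPdist_le => /= e e0.
have [r er] : exists r, e = r%:C%C.
  by exists (Re e); apply: complexP => //=; apply: ger0_Im; exact: ltW.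
rewrite er in e0 *; rewrite ltcR in e0.
have [d d0 {}H] := H (r / 2) (divr_gt0 e0 (ltr0Sn _ 1)).
rewrite /prop_near1 /dnbhs /within /=; apply/nbhsC_cnP; exists d => // h; rewrite subr0 => hd h0.
rewrite scaler1 (_ : l - _ = - (h^-1 * (g (z + h) - g z - l * h))); last first.
  rewrite mulrBr [l * h]mulrC mulKf// opprB [z + h]addrC //.
rewrite normrN normrM normfV ler_pdivrMl ?normr_gt0//.
apply: (le_trans (normC_cn _)).
apply: (@le_trans _ _ ((r / 2 * cn h)%:C%C)); first by rewrite lecR H.
rewrite normc_def -rmorphM lecR.
have : cn h <= 2 * Num.sqrt (Re h ^+ 2 + Im h ^+ 2) by apply: cn_normC; rewrite normc_def.
by nra.
Qed.

Lemma cderiv_cont g z l : cderiv g z l -> forall e : R, 0 < e ->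
  exists2 d : R, 0 < d & forall h, cn h <= d -> cn (g (z + h) - g z) <= e.
Proof.
move=> H e e0; have [d d0 {}H] := H 1 ltr01.
exists (Num.min d (e / (1 + cn l))).
  by rewrite lt_min d0 divr_gt0// ltr_wpDr// cn_ge0.
move=> h; rewrite le_min => /andP[/H H1].
rewrite ler_pdivlMr ?ltr_wpDr ?cn_ge0// => he.
have := cnD (g (z + h) - g z - l * h) (l * h); rewrite subrK => H2.
have := cnM l h; lra.
Qed.

Lemma cderiv_comp f g z l m : cderiv f z l -> cderiv g (f z) m -> cderiv (g \o f) z (m * l).
Proof.
move=> Hf Hg e e0.
have l0 := cn_ge0 l; have m0 := cn_ge0 m.
have e1 : 0 < e / (2 * (1 + cn l)) by rewrite divr_gt0//; lra.
have e2 : 0 < Num.min 1 (e / (2 * (1 + cn m))) by rewrite lt_min ltr01/= divr_gt0//; lra.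
have [d1 d10 {}Hg] := Hg _ e1.
have [d2 d20 Hf2] := Hf _ e2.
have [d3 d30 Hf3] := cderiv_cont Hf d10.
exists (Num.min d2 d3) => [|h]; first by rewrite lt_min d20.
rewrite le_min => /andP[/Hf2 h2 /Hf3 h3] /=.
have := Hg _ h3; rewrite [f z + _]addrC subrK => H.
have -> : g (f (z + h)) - g (f z) - m * l * h =
  (g (f (z + h)) - g (f z) - m * (f (z + h) - f z)) + m * (f (z + h) - f z - l * h) by ring.
apply: (le_trans (cnD _ _)).
have h0 := cn_ge0 h.
have A1 : cn (f (z + h) - f z) <= (1 + cn l) * cn h.
  have := cnD (f (z + h) - f z - l * h) (l * h); rewrite subrK => H2.
  have := cnM l h; have : cn (f (z + h) - f z - l * h) <= 1 * cn h.
    by apply: (le_trans h2); rewrite ler_wpM2r// ge_min lexx.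
  lra.
have A2 : cn (m * (f (z + h) - f z - l * h)) <= e / 2 * cn h.
  apply: (le_trans (cnM _ _)).
  have : cn (f (z + h) - f z - l * h) <= (e / (2 * (1 + cn m))) * cn h.
    by apply: (le_trans h2); rewrite ler_wpM2r// ge_min lexx orbT.
  move=> /(ler_wpM2l m0)/le_trans; apply.
  have -> : cn m * (e / (2 * (1 + cn m)) * cn h) = (cn m / (1 + cn m)) * (e / 2 * cn h).
    by field; rewrite gt_eqF//; lra.
  rewrite ler_piMl ?mulr_ge0//; first lra.
  by rewrite ler_pdivrMr; lra.
have : cn (g (f (z + h)) - g (f z) - m * (f (z + h) - f z)) <= e / 2 * cn h.
  apply: (le_trans H).
  rewrite (_ : e / 2 * cn h = e / (2 * (1 + cn l)) * ((1 + cn l) * cn h)); last first.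
    by field; rewrite gt_eqF//; lra.
  by rewrite ler_wpM2l// ltW.
lra.
Qed.

End ComplexDerivative.

(** * Second-order inequalities for exp, sin and cos *)

Section RealTrigExp.
Variable R : realType.
Implicit Types x a b : R.

Lemma expR_sub1_le a : expR a - 1 <= a * expR a.
Proof.
have := expR_ge1Dx (- a); have := expR_gt0 a => p0 H.
have : (1 - a) * expR a <= expR (- a) * expR a by rewrite ler_pM2r//; lra.
rewrite -expRD addNr expR0; lra.
Qed.

Lemma norm_expR_sub1 a : `|expR a - 1| <= `|a| * expR `|a|.
Proof.
have := expR_sub1_le a; have := expR_ge1Dx a.
case: (lerP 0 a) => a0 h1 h2.
  by rewrite (ger0_norm a0) ger0_norm; lra.
have : 1 <= expR (- a) by rewrite -expR0 ler_expR; lra.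
have : expR a <= 1 by rewrite -expR0 ler_expR; lra.
by move=> ? ?; rewrite (ltr0_norm a0) ler0_norm; nra.
Qed.

Lemma norm_expR_sub1a a : `|expR a - 1 - a| <= a ^+ 2 * expR `|a|.
Proof.
have h1 := expR_ge1Dx a; have h2 := expR_sub1_le a; have h3 := norm_expR_sub1 a.
rewrite ger0_norm; last lra.
rewrite -(real_normK (num_real a)).
have : expR a - 1 - a <= a * (expR a - 1) by lra.
move=> /le_trans; apply; apply: (le_trans (ler_norm _)); rewrite normrM expr2 -mulrA.
by rewrite ler_wpM2l.
Qed.

Lemma norm_sin_le b : `|sin b| <= `|b|.
Proof.
wlog b0 : b / 0 <= b => [H|].
  case: (lerP 0 b) => [/H//|b0]; rewrite -[b]opprK sinN normrN [`|- - b|]normrN; apply: H; lra.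
have dsin x : x \in `]0, b[ -> is_derive x 1 (@sin R) (cos x) by move=> _; exact: is_derive_sin.
have [|c _] := MVT_segment b0 dsin.
  by apply: continuous_subspaceT; exact: continuous_sin.
rewrite sin0 !subr0 => ->; rewrite normrM ler_piMl// ler_norml cos_geN1 cos_le1 //.
Qed.

Lemma cos_half b : 1 - cos b = 2 * sin (b / 2) ^+ 2.
Proof.
have {1}-> : b = (b / 2) *+ 2 by rewrite mulr2n; field.
by rewrite cos_mulr2n sin2cos2 !mulr2n; ring.
Qed.

Lemma cos_sub1_ge0 b : 0 <= 1 - cos b.
Proof. by rewrite subr_ge0 cos_le1. Qed.

Lemma cos_sub1_le b : 1 - cos b <= b ^+ 2.
Proof.
rewrite cos_half -(real_normK (num_real (sin _))) -(real_normK (num_real b)).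
have := norm_sin_le (b / 2); rewrite normrM [`|2^-1|]ger0_norm// => h.
have := normr_ge0 (sin (b / 2)); nra.
Qed.

Lemma cos_sub1_le1 b : 1 - cos b <= `|b|.
Proof.
rewrite cos_half -(real_normK (num_real (sin _))).
have := norm_sin_le (b / 2); rewrite normrM [`|2^-1|]ger0_norm// => h.
have := normr_ge0 (sin (b / 2)).
have : `|sin (b / 2)| <= 1 by rewrite ler_norml sin_geN1 sin_le1.
nra.
Qed.

(** Mean value theorem for sin x - x, whose derivative is at most |x| in size; the exponent 2 is all
    that [cexp_lin] requires. *)
Lemma norm_sin_sub b : `|sin b - b| <= b ^+ 2.
Proof.
wlog b0 : b / 0 <= b => [H|].
  case: (lerP 0 b) => [/H//|b0]; rewrite -[b]opprK sinN -opprD normrN sqrrN; apply: H; lra.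
have dsin x : x \in `]0, b[ -> is_derive x 1 (fun x => sin x - x) (cos x - 1).
  by move=> _; apply: is_deriveB.
have [|c cb] := MVT_segment b0 dsin.
  apply: continuous_subspaceT => x; apply: continuousB => //; exact: continuous_sin.
rewrite sin0 !subr0 => ->; rewrite normrM distrC [`|1 - _|]ger0_norm ?cos_sub1_ge0//.
rewrite (ger0_norm b0) expr2 ler_wpM2r//; apply: (le_trans (cos_sub1_le1 c)).
by move: cb; rewrite in_itv /= => /andP[? ?]; rewrite ger0_norm.
Qed.

End RealTrigExp.

(** * The complex exponential *)

Section ComplexExp.
Variable R : realType.
Local Notation C := R[i].
Local Notation Re := complex.Re.
Local Notation Im := complex.Im.
Implicit Types (z w h l : C) (f g : C -> C).

Definition cexp z : C := ((expR (Re z) * cos (Im z)) +i* (expR (Re z) * sin (Im z)))%C.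

Lemma cexpD z w : cexp (z + w) = cexp z * cexp w.
Proof.
by apply: complexP; rewrite /= ?RIE /= expRD ?cosD ?sinD; ring.
Qed.

Lemma cexp_real (x : R) : cexp x%:C%C = (expR x)%:C%C.
Proof. by apply: complexP; rewrite /= ?cos0 ?sin0 ?mulr1 ?mulr0. Qed.

(** The quantitative source of the later second-order estimates: the derivative of [cexp],
    differentiation under the Laplace integral, and the comparison of v with (1 - exp(-x v)) / x. *)
Lemma cexp_lin z : cn (cexp z - 1 - z) <= 4 * cn z ^+ 2 * expR (cn z).
Proof.
case: z => a b; rewrite {1}/cn !RIE /cn /= oppr0 addr0.
set N := `|a| + `|b|.
have a0 := normr_ge0 a; have b0 := normr_ge0 b.
have E1 : expR `|a| <= expR N by rewrite ler_expR /N; lra.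
have E2 : 1 <= expR N by rewrite -expR0 ler_expR /N; lra.
have E3 : expR a <= expR `|a| by rewrite ler_expR ler_norm.
have e0 := expR_gt0 a.
have A : `|expR a * cos b - 1 - a| <= N ^+ 2 * expR N.
  have -> : expR a * cos b - 1 - a = (expR a - 1 - a) - expR a * (1 - cos b) by ring.
  apply: (le_trans (ler_normB _ _)); rewrite normrM (ger0_norm (cos_sub1_ge0 b)) gtr0_norm//.
  have := norm_expR_sub1a a; have := cos_sub1_le b; have := cos_sub1_ge0 b.
  rewrite -(real_normK (num_real a)) -(real_normK (num_real b)) => h1 h2 h3.
  have : expR a * (1 - cos b) <= expR N * `|b| ^+ 2.
    by apply: ler_pM; rewrite ?(ltW e0)//; lra.
  have : `|a| ^+ 2 * expR `|a| <= `|a| ^+ 2 * expR N by rewrite ler_wpM2l// exprn_ge0.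
  have : 0 <= `|a| * `|b| * expR N by rewrite !mulr_ge0// expR_ge0.
  have -> : N ^+ 2 * expR N = `|a| ^+ 2 * expR N + 2 * (`|a| * `|b| * expR N) + expR N * `|b| ^+ 2.
    by rewrite /N; ring.
  lra.
have B : `|expR a * sin b - b| <= N ^+ 2 * expR N.
  have -> : expR a * sin b - b = (expR a - 1) * sin b + (sin b - b) by ring.
  apply: (le_trans (ler_normD _ _)); rewrite normrM.
  have := norm_expR_sub1 a; have := norm_sin_sub b; have := norm_sin_le b.
  rewrite -(real_normK (num_real b)) => h1 h2 h3.
  have : `|expR a - 1| * `|sin b| <= (`|a| * expR `|a|) * `|b| by apply: ler_pM.
  have : `|b| ^+ 2 <= `|b| ^+ 2 * expR N by rewrite ler_peMr// exprn_ge0.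
  have : `|a| * expR `|a| * `|b| <= `|a| * expR N * `|b| by rewrite ler_wpM2r// ler_wpM2l.
  have : 0 <= `|a| * `|b| * expR N by rewrite !mulr_ge0// expR_ge0.
  have : 0 <= `|a| ^+ 2 * expR N by rewrite mulr_ge0// expR_ge0.
  have -> : N ^+ 2 * expR N = `|a| ^+ 2 * expR N + 2 * (`|a| * `|b| * expR N) + expR N * `|b| ^+ 2.
    by rewrite /N; ring.
  lra.
have : 0 <= N ^+ 2 * expR N by rewrite mulr_ge0 ?expR_ge0// sqr_ge0.
lra.
Qed.

Lemma cn_cexp z : cn (cexp z) <= 2 * expR (Re z).
Proof.
rewrite /cn /= !normrM (ger0_norm (expR_ge0 _)).
have := expR_ge0 (Re z); have : `|cos (Im z)| <= 1 by rewrite ler_norml cos_geN1 cos_le1.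
have : `|sin (Im z)| <= 1 by rewrite ler_norml sin_geN1 sin_le1.
nra.
Qed.

Lemma cderiv_cexp z : cderiv cexp z (cexp z).
Proof.
move=> e e0; have c0 := cn_ge0 (cexp z).
have k0 : 0 < 1 + cn (cexp z) by lra.
exists (Num.min 1 (e / (4 * expR 1 * (1 + cn (cexp z))))).
  by rewrite lt_min ltr01 /= divr_gt0// !mulr_gt0// expR_gt0.
move=> h; rewrite le_min => /andP[h1].
rewrite ler_pdivlMr ?mulr_gt0 ?expR_gt0// => h2.
rewrite cexpD (_ : _ - _ - _ = cexp z * (cexp h - 1 - h)); last by ring.
apply: (le_trans (cnM _ _)).
have h0 := cn_ge0 h.
have L : cn (cexp h - 1 - h) <= 4 * cn h ^+ 2 * expR 1.
  apply: (le_trans (cexp_lin h)); rewrite ler_wpM2l ?mulr_ge0 ?sqr_ge0//.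
  by rewrite ler_expR.
apply: (le_trans (ler_wpM2l c0 L)).
have -> : cn (cexp z) * (4 * cn h ^+ 2 * expR 1) = (cn h * (4 * expR 1 * cn (cexp z))) * cn h by ring.
rewrite ler_wpM2r//; apply: (le_trans _ h2); rewrite ler_wpM2l// ler_wpM2l ?mulr_ge0 ?expR_ge0//.
lra.
Qed.

End ComplexExp.

(** * Circle means and the maximum principle *)

Section MaximumPrinciple.
Variable R : realType.
Local Notation C := R[i].
Local Notation Re := complex.Re.
Local Notation Im := complex.Im.
Implicit Types (z w h l : C) (f g : C -> C).

(** Squared modulus: multiplicative and polynomial in the coordinates, so that no square root enters
    the maximum principle. *)
Definition csq z : R := Re z ^+ 2 + Im z ^+ 2.

Definition hol f z := exists l, cderiv f z l.

Lemma holP f z : hol f z <-> derivable (f : C^o -> C^o) z 1.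
Proof. by split=> /cderivP. Qed.

Lemma hol_cst c z : hol (fun=> c) z.
Proof. by apply/holP; exact: derivable_cst. Qed.

Lemma hol_id z : hol id z.
Proof. by apply/holP; exact: derivable_id. Qed.

Lemma holD f g z : hol f z -> hol g z -> hol (fun z => f z + g z) z.
Proof. by move=> /holP hf /holP hg; apply/holP; have H := derivableD hf hg; exact: H. Qed.

Lemma holB f g z : hol f z -> hol g z -> hol (fun z => f z - g z) z.
Proof. by move=> /holP hf /holP hg; apply/holP; have H := derivableB hf hg; exact: H. Qed.

Lemma holM f g z : hol f z -> hol g z -> hol (fun z => f z * g z) z.
Proof. by move=> /holP hf /holP hg; apply/holP; have H := derivableM hf hg; exact: H. Qed.

Lemma holV f z : f z != 0 -> hol f z -> hol (fun z => (f z)^-1) z.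
Proof. by move=> f0 /holP hf; apply/holP; have H := derivableV f0 hf; exact: H. Qed.

Lemma holX f n z : hol f z -> hol (fun z => f z ^+ n) z.
Proof.
move=> hf; elim: n => [|n IH]; first exact: hol_cst.
by under eq_fun do rewrite exprS; exact: holM.
Qed.

Lemma hol_comp f g z : hol f z -> hol g (f z) -> hol (g \o f) z.
Proof. by move=> [l hf] [m hg]; exists (m * l); exact: cderiv_comp. Qed.

Lemma hol_cexp z : hol (@cexp R) z.
Proof. by exists (cexp z); exact: cderiv_cexp. Qed.

(** The Cauchy-Riemann equations for the derivative a + i b. *)
Lemma hol_grad f x y : hol f (x +i* y)%C -> exists a b,
  grad_at (fun x y => Re (f (x +i* y)%C)) x y a (- b) /\
  grad_at (fun x y => Im (f (x +i* y)%C)) x y b a.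
Proof.
move=> [[a b] H]; exists a, b.
have K (e : R) : 0 < e -> exists2 d, 0 < d & forall x' y', `|x' - x| <= d -> `|y' - y| <= d ->
    `|Re (f (x' +i* y')%C) - Re (f (x +i* y)%C) - (a * (x' - x) - b * (y' - y))| +
    `|Im (f (x' +i* y')%C) - Im (f (x +i* y)%C) - (a * (y' - y) + b * (x' - x))| <=
    e * (`|x' - x| + `|y' - y|).
  move=> /H[d d0 {}H]; exists (d / 2) => [|x' y' xd yd]; first lra.
  have hd : cn ((x' - x) +i* (y' - y))%C <= d by rewrite /cn /=; lra.
  have := H _ hd; have -> : (x +i* y + ((x' - x) +i* (y' - y)) = x' +i* y')%C.
    by apply: complexP; rewrite /= addrC subrK.
  by rewrite /cn !RIE.
split=> e /K[d d0 {}K]; exists d => // x' y' xd yd; have := K _ _ xd yd;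
  apply: le_trans.
- rewrite mulNr opprK -addrA (_ : - (a * (x' - x)) + b * (y' - y) = - (a * (x' - x) - b * (y' - y))).
    by rewrite lerDl.
  by ring.
- rewrite -addrA (_ : - (b * (x' - x)) - a * (y' - y) = - (a * (y' - y) + b * (x' - x))).
    by rewrite lerDr.
  by ring.
Qed.

Lemma csq_cexp z : csq (cexp z) = expR (Re z) ^+ 2.
Proof. by rewrite /csq /= !exprMn -mulrDr cos2Dsin2 mulr1. Qed.

Lemma csqM z w : csq (z * w) = csq z * csq w.
Proof. by rewrite /csq !RIE; ring. Qed.

Lemma csq_ge0 z : 0 <= csq z. Proof. by rewrite addr_ge0 ?sqr_ge0. Qed.

Lemma csq_eq0 z : (csq z == 0) = (z == 0).
Proof. by case: z => a b; rewrite /csq /= paddr_eq0 ?sqr_ge0// !sqrf_eq0 eq_complex. Qed.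

(* In the coordinate [w] with [z = z0 + e^w] the circle of
   radius [r] is a vertical segment, and Goursat over [[rho, ln r] x [0, 2 pi]],
   whose horizontal sides cancel by periodicity, makes the mean independent of
   the radius. *)
Lemma circle_Re_ge f z0 (r : R) : 0 < r ->
  (forall z, csq (z - z0) <= r ^+ 2 -> hol f z) ->
  exists2 z, csq (z - z0) = r ^+ 2 & Re (f z0) <= Re (f z).
Proof.
move=> r0 hf; apply: contrapT => H.
pose F w := f (z0 + cexp w).
have hF w : Re w <= ln r -> hol F w.
  move=> wr; apply: (@hol_comp (fun w => z0 + cexp w)).
    by apply: holD; [exact: hol_cst|exact: hol_cexp].
  apply: hf; rewrite addrAC subrr add0r csq_cexp ler_sqr ?nnegrE ?expR_ge0 ?(ltW r0)//.
  by rewrite -[leRHS]lnK// ler_expR.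
pose P x y := Re (F (x +i* y)%C); pose Q x y := Im (F (x +i* y)%C).
have gr x y : x <= ln r -> exists a b, grad_at P x y a (- b) /\ grad_at Q x y b a.
  by move=> xr; apply: hol_grad; exact: hF.
have pi20 : 0 < 2 * @pi R by rewrite mulr_gt0// pi_gt0.
have cP x : x <= ln r -> forall y, {for y, continuous (P x)}.
  by move=> xr y; have [a [b [/grad_at_conty]]] := gr x y xr.
have same rho : rho < ln r ->
    sint (P rho) 0 (2 * pi) = sint (P (ln r)) 0 (2 * pi).
  move=> rr.
  (* The closed form is Im (F dw) = Q dx + P dy, so [Q] and [P] play the roles of A and B. *)
  have G : forall x y, rho <= x <= ln r -> 0 <= y <= 2 * pi ->
    exists p q s, grad_at Q x y p q /\ grad_at P x y q s.
    move=> x y /andP[_ xr] _; have [a [b [? ?]]] := gr x y xr; by exists b, a, (- b).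
  have := goursat rr pi20 G; rewrite (@sintB _ (P (ln r)) (P rho)); last 2 first.
  - by move=> y _; exact: (cP _ (lexx _) y).
  - by move=> y _; exact: (cP _ (ltW rr) y).
  have -> : (fun x => Q x (2 * pi) - Q x 0) = fun=> 0.
    apply/funext => x; rewrite /Q /F (_ : cexp (x +i* (2 * pi))%C = cexp (x +i* 0)%C) ?subrr//.
    by rewrite /cexp /= mulr_natl cos2pi sin2pi cos0 sin0.
  rewrite sint_cst ?mul0r; last exact: ltW.
  by move=> /esym/eqP; rewrite subr_eq0 => /eqP ->.
have cont1 : {within `[0, 2 * pi], continuous (P (ln r))}.
  by apply: continuous_subspaceT => y; exact: (cP _ (lexx _) y).
have [c _ cmax] := EVT_max (ltW pi20) cont1.
set m := P (ln r) c in cmax.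
have mlt : m < Re (f z0).
  rewrite ltNge; apply/negP => h; apply: H; exists (z0 + cexp (ln r +i* c)%C) => //.
  by rewrite addrAC subrr add0r csq_cexp /= lnK.
pose e := (Re (f z0) - m) / 2.
have e0 : 0 < e by rewrite divr_gt0// subr_gt0.
have [l hl] : hol f z0.
  by apply: hf; rewrite subrr /csq /= expr0n /= addr0 sqr_ge0.
have [d d0 Hd] := cderiv_cont hl e0.
(* The radius is at most d / 2 because [cn_cexp] loses a factor 2; on this circle f stays within e
   of f z0. *)
pose rho := Num.min (ln r - 1) (ln (d / 2)).
have rr : rho < ln r by rewrite gt_min; apply/orP; left; lra.
have lo : (Re (f z0) - e) * (2 * pi) <= sint (P rho) 0 (2 * pi).
  rewrite -[X in _ * X <= _]subr0 -sint_cst; last exact: ltW.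
  apply: sint_le; [by move=> *; exact: cst_continuous|by move=> y _; exact: (cP _ (ltW rr) y)|].
  move=> y _.
  have : cn (cexp (rho +i* y)%C) <= d.
    apply: (le_trans (cn_cexp _)) => /=.
    have : expR rho <= d / 2.
      by rewrite -[leRHS]lnK ?posrE ?divr_gt0// ler_expR ge_min lexx orbT.
    lra.
  move=> /Hd; rewrite /cn !RIE -/(F _) -/(P rho y) => h.
  have : `|P rho y - Re (f z0)| <= e by have := normr_ge0 (Im (F (rho +i* y)%C) - Im (f z0)); lra.
  by rewrite ler_norml => /andP[? ?]; lra.
have hi : sint (P (ln r)) 0 (2 * pi) <= m * (2 * pi).
  rewrite -[X in _ <= _ * X]subr0 -sint_cst; last exact: ltW.
  apply: sint_le; [by move=> y _; exact: (cP _ (lexx _) y)|by move=> *; exact: cst_continuous|].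
  by move=> y yy; apply: cmax; rewrite in_itv.
have : (Re (f z0) - e) * (2 * pi) <= m * (2 * pi).
  by apply: (le_trans lo); rewrite same.
rewrite ler_pM2r// /e => ?; lra.
Qed.

(** Circle means alone give a weak inequality for |f|^2. The added term eps |z|^2 is strictly
    subharmonic and makes it strict, so the case of equality never has to be analysed. *)
Lemma no_interior_max f z1 (eps r : R) : 0 < eps -> 0 < r ->
  (forall z, csq (z - z1) <= r ^+ 2 -> hol f z) ->
  exists2 z, csq (z - z1) = r ^+ 2 &
    csq (f z1) + eps * csq z1 < csq (f z) + eps * csq z.
Proof.
move=> e0 r0 hf.
(* The real part is half the linear part of the increment of csq f + eps csq at z1. The quadratic
   remainder is a sum of squares, and its last term equals eps r^2. *)
pose h z := ((Re (f z1)) -i* (Im (f z1)))%C * (f z - f z1)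
  + ((eps * Re z1) -i* (eps * Im z1))%C * (z - z1).
have [z zr hz] : exists2 z, csq (z - z1) = r ^+ 2 & Re (h z1) <= Re (h z).
  apply: circle_Re_ge r0 _ => z /hf {}hf.
  exact: (holD (holM (hol_cst _ _) (holB hf (hol_cst _ _)))
    (holM (hol_cst _ _) (holB (hol_id _) (hol_cst _ _)))).
exists z => //; move: hz zr; rewrite /h /csq !RIE /=.
have : 0 < r ^+ 2 by rewrite exprn_gt0.
move: (Re z) (Im z) (Re z1) (Im z1) (Re (f z)) (Im (f z)) (Re (f z1)) (Im (f z1)) (r ^+ 2).
move=> x y x1 y1 u v u1 v1 rr rr0 h1 h2.
have q1 : 0 <= (u - u1) ^+ 2 by exact: sqr_ge0.
have q2 : 0 <= (v - v1) ^+ 2 by exact: sqr_ge0.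
have q3 : 0 < eps * ((x - x1) ^+ 2 + (y - y1) ^+ 2) by rewrite h2 mulr_gt0.
rewrite -subr_gt0 (_ : _ - _ = 2 * (u1 * (u - u1) + v1 * (v - v1)
  + (eps * x1 * (x - x1) + eps * y1 * (y - y1))) + (u - u1) ^+ 2 + (v - v1) ^+ 2
  + eps * ((x - x1) ^+ 2 + (y - y1) ^+ 2)); last by ring.
move: h1 q1 q2 q3; rewrite !subrr; lra.
Qed.

End MaximumPrinciple.

(** * The identity theorem on the half-plane *)

Section IdentityTheorem.
Variable R : realType.
Local Notation C := R[i].
Local Notation Re := complex.Re.
Local Notation Im := complex.Im.
Implicit Types (z w h l : C) (f g : C -> C).

Lemma csq_hol_cont f (x y : R) : hol f (x +i* y)%C ->
  {for (x, y), continuous (fun p : R * R => csq (f (p.1 +i* p.2)%C))}.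
Proof.
move=> [l hf].
have cR (g : R * R -> R) : (forall e : R, 0 < e -> exists2 d : R, 0 < d &
    forall p, `|p.1 - x| <= d -> `|p.2 - y| <= d -> `|g p - g (x, y)| <= e) ->
    {for (x, y), continuous g}.
  move=> H; apply/cvgrPdist_le => e /H[d d0 {}H].
  exists (ball x d, ball y d); first by split; exact: nbhsx_ballx.
  by move=> [u v] [/= hu hv]; rewrite distrC; apply: H => /=; rewrite distrC ltW.
have cf (e : R) : 0 < e -> exists2 d : R, 0 < d & forall p : R * R, `|p.1 - x| <= d ->
    `|p.2 - y| <= d -> cn (f (p.1 +i* p.2)%C - f (x +i* y)%C) <= e.
  move=> /(cderiv_cont hf)[d d0 H]; exists (d / 2); first lra.
  move=> [u v] /= hu hv; have := H ((u - x) +i* (v - y))%C.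
  have -> : (x +i* y + ((u - x) +i* (v - y)) = u +i* v)%C.
    by apply: complexP; rewrite /= addrC subrK.
  by apply; rewrite /cn /=; lra.
have cRe : {for (x, y), continuous (fun p : R * R => Re (f (p.1 +i* p.2)%C))}.
  apply: cR => e /cf[d d0 H]; exists d => // p h1 h2; have := H p h1 h2.
  by rewrite /cn !RIE; apply: le_trans; rewrite lerDl.
have cIm : {for (x, y), continuous (fun p : R * R => Im (f (p.1 +i* p.2)%C))}.
  apply: cR => e /cf[d d0 H]; exists d => // p h1 h2; have := H p h1 h2.
  by rewrite /cn !RIE; apply: le_trans; rewrite lerDr.
have -> : (fun p : R * R => csq (f (p.1 +i* p.2)%C)) =
    (fun p : R * R => Re (f (p.1 +i* p.2)%C) * Re (f (p.1 +i* p.2)%C)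
      + Im (f (p.1 +i* p.2)%C) * Im (f (p.1 +i* p.2)%C)) by apply/funext => p; rewrite -!expr2.
exact: (continuousD (continuousM cRe cRe) (continuousM cIm cIm)).
Qed.

(* Two-constants argument on the square [c - L, c + L] x [0, L]: for the pole
   [w = c - i] below the real axis, |z0 - w| < L <= |z - w| on the three
   non-real sides, so the maximum principle for [d z / (z - w)^N], which vanishes on the
   real side, forces [d z0 = 0] as N grows. *)
Lemma holomorphic_eq0_upper f z0 : (forall z, Hp z -> hol f z) ->
  (forall x : R, 0 < x -> f x%:C%C = 0) -> Hp z0 -> 0 < Im z0 -> f z0 = 0.
Proof.
move=> hf f0; case: z0 => x0 y0; rewrite /Hp /= => x00 y00.
(* Chosen so that M x0 = (y0 + 1)^2. Then |z0 - w|^2 = M^2 + M x0 < (M + x0 / 2)^2 = L^2, while c -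
   L = x0 / 2 keeps the rectangle inside the half-plane. *)
pose M := (y0 + 1) ^+ 2 / x0.
have Mx : M * x0 = (y0 + 1) ^+ 2 by rewrite /M mulfVK// gt_eqF.
have M0 : 0 < M by rewrite divr_gt0// exprn_gt0//; lra.
pose c := x0 + M; pose L := M + x0 / 2; pose w : C := (c -i* 1)%C.
have yL : y0 < L.
  rewrite /L; have : (y0 - x0 / 2) * x0 < M * x0.
    have q : 0 <= (x0 - y0) ^+ 2 by exact: sqr_ge0.
    have q2 : 0 < (y0 + 1) ^+ 2 - y0 ^+ 2 by lra.
    have q3 : 0 <= y0 ^+ 2 by exact: sqr_ge0.
    by rewrite Mx; lra.
  by rewrite ltr_pM2r// => ?; lra.
pose K : set (R * R) := `[c - L, c + L] `*` `[0, L].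
have Kc : compact K by apply: compact_setX; exact: segment_compact.
have KP p : K p <-> [/\ c - L <= p.1, p.1 <= c + L, 0 <= p.2 & p.2 <= L].
  rewrite /K /= !in_itv /=; split=> [[/andP[? ?] /andP[? ?]]//|[? ? ? ?]].
  by split; apply/andP.
have Kz0 : K (x0, y0) by apply/KP; move: yL; rewrite /= /c /L => ?; split; lra.
have KH p : K p -> Hp (p.1 +i* p.2)%C.
  by move=> /KP[h _ _ _]; rewrite /Hp /=; move: h; rewrite /c /L => ?; lra.
have wne z : -1 < Im z -> z - w != 0.
  move=> zw; apply/eqP => /(congr1 (@complex.Im R)); rewrite !RIE /=; lra.
pose F N z := f z * ((z - w)^-1) ^+ N.
have hF N z : Hp z -> -1 < Im z -> hol (F N) z.
  move=> hz zw; apply: holM; first exact: hf.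
  apply: holX; apply: (@holV _ (fun z => z - w)); first exact: wne.
  exact: (holB (hol_id _) (hol_cst _ _)).
have csqF N z : -1 < Im z -> csq (F N z) * csq (z - w) ^+ N = csq (f z).
  move=> zw; rewrite /F csqM -mulrA.
  have -> : csq ((z - w)^-1 ^+ N) * csq (z - w) ^+ N = 1.
    elim: N => [|N IH]; first by rewrite !expr0 mulr1 /csq /= expr0n /= addr0 expr1n.
    rewrite !exprS csqM mulrACA IH mulr1 -csqM mulVf ?wne//.
    by rewrite /csq /= expr0n /= addr0 expr1n.
  by rewrite mulr1.
have [pD _ HD] : exists2 p, p \in K & forall q, q \in K ->
    csq (f (q.1 +i* q.2)%C) <= csq (f (p.1 +i* p.2)%C).
  apply: (compact_EVT_max _ Kc); first by exists (x0, y0).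
  apply: continuous_in_subspaceT => -[x y]; rewrite inE => /KH hp.
  exact/csq_hol_cont/hf.
set D := csq _ in HD.
have D0 : 0 <= D by exact: csq_ge0.
pose B := (c + L) ^+ 2 + L ^+ 2.
have B0 : 0 <= B by rewrite addr_ge0// sqr_ge0.
have L0 : 0 < L by rewrite /L; lra.
have csqB p : K p -> csq (p.1 +i* p.2)%C <= B.
  by move=> /[dup] /KH hp /KP[? ? ? ?]; rewrite /csq /B /=; rewrite /Hp /= in hp; nra.
pose q0 := csq ((x0 +i* y0)%C - w).
have q0L : q0 < L ^+ 2.
  rewrite /q0 /csq !RIE /= opprK.
  have -> : x0 - c = - M by rewrite /c; ring.
  rewrite /L (_ : (M + x0 / 2) ^+ 2 = M ^+ 2 + M * x0 + (x0 / 2) ^+ 2); last by field.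
  rewrite Mx sqrrN; have : 0 < (x0 / 2) ^+ 2 by rewrite exprn_gt0// divr_gt0.
  lra.
have key N : csq (f (x0 +i* y0)%C) <= (D + B) * (q0 / L ^+ 2) ^+ N.
  (* The perturbation required by [no_interior_max] is scaled like the boundary bound D / L^(2 N) of
     [F N], so that it decays at the same rate. *)
  pose eps := (L ^+ 2) ^- N.
  have L2N : 0 < (L ^+ 2) ^+ N by rewrite !exprn_gt0.
  have eps0 : 0 < eps by rewrite invr_gt0.
  pose G p : R := csq (F N (p.1 +i* p.2)%C) + eps * csq (p.1 +i* p.2)%C.
  have [[x1 y1]] : exists2 p, p \in K & forall q, q \in K -> G q <= G p.
    apply: (compact_EVT_max _ Kc); first by exists (x0, y0).
    apply: continuous_in_subspaceT => -[x y]; rewrite inE => /[dup] /KH hp /KP[_ _ /= yy _].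
    apply: (@continuousD _ _ _ (fun p => csq (F N (p.1 +i* p.2)%C)) (fun p => eps * csq (p.1 +i* p.2)%C)).
      by apply/csq_hol_cont/hF => //=; lra.
    apply: continuousM; first exact: cst_continuous.
    exact: (csq_hol_cont (hol_id _)).
  rewrite inE => K1 G1; have /= [k1 k2 k3 k4] := (KP _).1 K1.
  have H1 := KH _ K1; rewrite /Hp /= in H1.
  have Gmax : G (x1, y1) <= (D + B) * eps.
    suff : csq (F N (x1 +i* y1)%C) <= D * eps.
      move=> h; rewrite mulrDl lerD//= [leRHS]mulrC ler_wpM2l ?(ltW eps0)//.
      exact: (csqB (x1, y1)).
    (* Distance from the maximiser to the boundary of the rectangle: if it is positive, a whole disc
       fits and [no_interior_max] gives a contradiction. *)
    pose r := Num.min (Num.min (x1 - (c - L)) (c + L - x1)) (Num.min y1 (L - y1)).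
    have [r0|r0] := ltP 0 r.
      exfalso; move: (r0); rewrite !lt_min => /andP[/andP[r1 r2] /andP[r3 r4]].
      have [rr1 rr2 rr3 rr4] : [/\ r <= x1 - (c - L), r <= c + L - x1, r <= y1 & r <= L - y1].
        by rewrite !ge_min !lexx ?orbT.
      have inK z : csq (z - (x1 +i* y1)%C) <= r ^+ 2 -> K (Re z, Im z).
        rewrite /csq !RIE /= => h.
        have ab (u v : R) : u ^+ 2 + v ^+ 2 <= r ^+ 2 -> - r <= u <= r.
          move=> uv; rewrite -ler_norml -ler_sqr ?nnegrE ?(ltW r0)// real_normK ?num_real//.
          by apply: le_trans uv; rewrite lerDl sqr_ge0.
        have /andP[? ?] := ab _ _ h; rewrite addrC in h; have /andP[? ?] := ab _ _ h.
        by apply/KP => /=; split; lra.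
      have [z|[x y] zr] := @no_interior_max _ (F N) (x1 +i* y1)%C eps r eps0 r0.
        move=> /inK kz; have := KH _ kz; have /KP[_ _ /= h _] := kz; rewrite /Hp /= => hz.
        by apply: hF => //; lra.
      have kz : K (x, y) by apply: (inK (x +i* y)%C); rewrite zr.
      have := G1 (x, y); rewrite inE => /(_ kz) /le_lt_trans h /h.
      by rewrite ltxx.
    have [y10|y1n] := eqVneq y1 0.
      have -> : F N (x1 +i* y1)%C = 0 by rewrite /F y10 f0// mul0r.
      by rewrite /csq /= expr0n /= addr0 mulr_ge0// ltW.
    have y1p : 0 < y1 by rewrite lt_neqAle eq_sym y1n.
    have far : L ^+ 2 <= csq ((x1 +i* y1)%C - w).
      rewrite /csq !RIE /= opprK; have s1 := sqr_ge0 (x1 - c); have s2 := sqr_ge0 (y1 + 1).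
      move: r0; rewrite /r !ge_min => /orP[/orP[]|/orP[]] h; last 2 first.
      - by exfalso; lra.
      - have : L ^+ 2 <= (y1 + 1) ^+ 2 by rewrite lerXn2r// ?nnegrE; lra.
        lra.
      - have -> : x1 - c = - L by lra.
        by rewrite sqrrN; lra.
      - have -> : x1 - c = L by lra.
        lra.
    have := csqF N (x1 +i* y1)%C; rewrite /= => /(_ ltac:(lra)) e1.
    have := HD (x1, y1); rewrite inE => /(_ K1) /=; rewrite -e1 => h.
    rewrite /eps ler_pdivlMr//; apply: le_trans h; rewrite ler_wpM2l ?csq_ge0//.
    by rewrite lerXn2r// nnegrE ?csq_ge0// sqr_ge0.
  have := G1 (x0, y0); rewrite inE => /(_ Kz0) h0.
  have h1 : csq (F N (x0 +i* y0)%C) <= (D + B) * eps.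
    apply: le_trans Gmax; apply: le_trans h0; rewrite lerDl mulr_ge0// ?csq_ge0//.
    exact: ltW.
  rewrite -(csqF N) /=; last by lra.
  rewrite expr_div_n -/q0 mulrA [leRHS]mulrAC -/eps.
  by rewrite ler_wpM2r// exprn_ge0// csq_ge0.
apply/eqP; rewrite -csq_eq0 eq_le csq_ge0 andbT.
have cv : (D + B) * (q0 / L ^+ 2) ^+ N @[N --> \oo] --> (0 : R).
  apply: cvg_geometric; rewrite ger0_norm ?divr_ge0 ?csq_ge0 ?sqr_ge0//.
  by rewrite ltr_pdivrMr ?mul1r// exprn_gt0.
by apply: (cvgr_to_ge cv); apply: nearW => N; exact: key.
Qed.

Theorem identity_theorem f g : holomorphic_on_H f -> holomorphic_on_H g ->
  (forall x : R, 0 < x -> f x%:C%C = g x%:C%C) -> forall z, Hp z -> f z = g z.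
Proof.
move=> hf hg fg.
pose d z := f z - g z.
have hd z : Hp z -> hol d z by move=> hz; apply: holB; apply/holP; [exact: hf|exact: hg].
have d0 x : 0 < x -> d x%:C%C = 0 by move=> /fg; rewrite /d => ->; rewrite subrr.
(* The lower quadrant is reduced to the upper one by Schwarz reflection, z -> conj (d (conj z)). *)
pose cj : C -> C := conjc.
have cjE z : cj z = (Re z -i* Im z)%C by case: z.
have cjK z : cj (cj z) = z by exact: conjcK.
pose d' z := cj (d (cj z)).
have hd' z : Hp z -> hol d' z.
  move=> hz; have [|l H] := hd (cj z); first by rewrite cjE.
  exists (cj l) => e /H[r r0 {}H]; exists r => // h hr.
  have cnj u : cn (cj u) = cn u by rewrite cjE /cn /= normrN.
  have := H (cj h); rewrite cnj => /(_ hr); rewrite -(cnj (d _ - _ - _)).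
  by rewrite /d' /d /cj !rmorphB rmorphM /= conjcK -rmorphD.
have d'0 x : 0 < x -> d' x%:C%C = 0.
  move=> x0; by rewrite /d' /cj conjc_real d0// conjc0.
move=> z hz; apply/eqP; rewrite -subr_eq0; apply/eqP; change (d z = 0).
have [z0|z0|z0] := ltgtP 0 (Im z).
- exact: holomorphic_eq0_upper d0 hz z0.
- have : d' (cj z) = 0.
    by apply: (holomorphic_eq0_upper hd' d'0); rewrite cjE //= oppr_gt0.
  by rewrite /d' cjK => /(congr1 cj); rewrite cjK /cj conjc0.
have -> : z = (Re z)%:C%C by apply: complexP; rewrite //= -z0.
exact: d0.
Qed.

End IdentityTheorem.

(** * The Bernstein-Widder theorem *)

Section BoundedIntegral.
Context d (T : measurableType d) (R : realType) (P : probability T R) (D : set T).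
Hypothesis mD : measurable D.
Implicit Types f g : T -> R.

(** Bounded measurable functions are integrable against every probability, so the rules below hold
    for all laws with no further integrability condition. *)
Definition bmf f := measurable_fun D f /\ exists B : R, forall x, D x -> `|f x| <= B.

Local Notation E f := (\int[P]_(x in D) f x).

Lemma bmf_integrable f : bmf f -> P.-integrable D (EFin \o f).
Proof.
move=> [mf [B fB]]; apply: measurable_bounded_integrable => //.
  by rewrite -ge0_fin_numE// fin_num_measure.
exists B; split; first exact: num_real.
by move=> y By x /fB /le_trans; apply; exact: ltW.
Qed.

Lemma bmf_cst c : bmf (fun=> c).
Proof. by split; [exact: measurable_cst|exists `|c|]. Qed.

Lemma bmfD f g : bmf f -> bmf g -> bmf (fun x => f x + g x).
Proof.
move=> [mf [A fA]] [mg [B gB]]; split; first exact: measurable_funD.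
by exists (A + B) => x Dx; apply: (le_trans (ler_normD _ _)); apply: lerD; auto.
Qed.

Lemma bmfM f g : bmf f -> bmf g -> bmf (fun x => f x * g x).
Proof.
move=> [mf [A fA]] [mg [B gB]]; split; first exact: measurable_funM.
by exists (A * B) => x Dx; rewrite normrM ler_pM//; auto.
Qed.

Lemma bmfZ c f : bmf f -> bmf (fun x => c * f x).
Proof. by apply: bmfM; exact: bmf_cst. Qed.

Lemma bmfN f : bmf f -> bmf (fun x => - f x).
Proof. by move=> /(bmfZ (-1)); under eq_fun do rewrite mulN1r. Qed.

Lemma bmfB f g : bmf f -> bmf g -> bmf (fun x => f x - g x).
Proof. by move=> hf /bmfN; exact: bmfD. Qed.

Lemma bmf_norm f : bmf f -> bmf (fun x => `|f x|).
Proof.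
move=> [mf [A fA]]; split; first exact: measurableT_comp.
by exists A => x /fA; rewrite normr_id.
Qed.

Lemma bmf_sum I (r : seq I) (f : I -> T -> R) : (forall i, bmf (f i)) ->
  bmf (fun x => \sum_(i <- r) f i x).
Proof.
move=> hf; elim: r => [|i r IH].
  by under eq_fun do rewrite big_nil; exact: bmf_cst.
by under eq_fun do rewrite big_cons; exact: bmfD.
Qed.

Lemma bintD f g : bmf f -> bmf g -> E (fun x => f x + g x) = E f + E g.
Proof. by move=> hf hg; rewrite RintegralD//; exact: bmf_integrable. Qed.

Lemma bintB f g : bmf f -> bmf g -> E (fun x => f x - g x) = E f - E g.
Proof. by move=> hf hg; rewrite RintegralB//; exact: bmf_integrable. Qed.

Lemma bintZ c f : bmf f -> E (fun x => c * f x) = c * E f.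
Proof. by move=> hf; rewrite RintegralZl//; exact: bmf_integrable. Qed.

Lemma bint_cst c : E (fun=> c) = c * fine (P D).
Proof. by rewrite Rintegral_cst. Qed.

Lemma bint_sum I (r : seq I) (f : I -> T -> R) : (forall i, bmf (f i)) ->
  E (fun x => \sum_(i <- r) f i x) = \sum_(i <- r) E (f i).
Proof.
move=> hf; elim: r => [|i r IH].
  by under eq_Rintegral do rewrite big_nil; rewrite bint_cst mul0r big_nil.
under eq_Rintegral do rewrite big_cons.
by rewrite bintD// ?IH ?big_cons//; exact: bmf_sum.
Qed.

Lemma bint_le f g : bmf f -> bmf g -> (forall x, D x -> f x <= g x) -> E f <= E g.
Proof. by move=> hf hg fg; apply: le_Rintegral => //; exact: bmf_integrable. Qed.

Lemma bint_norm f g : bmf f -> bmf g -> (forall x, D x -> `|f x| <= g x) -> `|E f| <= E g.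
Proof.
move=> hf hg fg; apply: (le_trans (le_normr_Rintegral mD (bmf_integrable hf))).
by apply: bint_le => //; exact: bmf_norm.
Qed.

Lemma bintE f : bmf f -> (\int[P]_(x in D) (f x)%:E = (E f)%:E)%E.
Proof. by move=> hf; rewrite /Rintegral fineK// integrable_fin_num//; exact: bmf_integrable. Qed.

End BoundedIntegral.

(** * Hausdorff's moment weights *)

Section HausdorffMoments.
Variable R : realType.
Implicit Types (m : nat -> R) (phi : R -> R).

(** The negated difference: on the moments of a measure on [0, 1], its n-th iterate gives the
    integrals of u^k (1 - u)^n, which are nonnegative. *)
Definition seq_dif m : nat -> R := fun k => m k - m k.+1.

Definition fun_dif (h : R) phi : R -> R := fun x => phi x - phi (x + h).

Lemma iter_seq_dif n m k : iter n seq_dif m k = iter n.+1 seq_dif m k + iter n seq_dif m k.+1.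
Proof. by rewrite iterS {2}/seq_dif subrK. Qed.

Lemma iter_fun_dif phi h n k :
  iter n seq_dif (fun k => phi (k.+1%:R * h)) k = iter n (fun_dif h) phi (k.+1%:R * h).
Proof.
elim: n k => [//|n IH] k; rewrite !iterS {1}/seq_dif {1}/fun_dif !IH.
by have -> : k.+2%:R * h = k.+1%:R * h + h by rewrite -[in LHS]natr1 mulrDl mul1r.
Qed.

(** The identity (u + (1 - u))^M = 1 multiplied by u^j (1 - u)^c, read on an arbitrary moment
    sequence. *)
Lemma sum_bin_dif m M c j :
  \sum_(i < M.+1) 'C(M, i)%:R * iter (c + M - i)%N seq_dif m (j + i)%N = iter c seq_dif m j.
Proof.
elim: M c j => [|M IH] c j.
  by rewrite big_ord_recl big_ord0 addr0 bin0 mul1r /= addn0 subn0 addn0.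
pose A n k := iter n seq_dif m k.
rewrite big_ord_recl bin0.
under eq_bigr => i _ do rewrite lift0 binS natrD mulrDl.
rewrite big_split /= addrA.
have -> : 1%:R * iter (c + M.+1 - 0)%N seq_dif m (j + 0)%N +
   \sum_(i < M.+1) 'C(M, i.+1)%:R * iter (c + M.+1 - i.+1)%N seq_dif m (j + i.+1)%N
   = \sum_(i < M.+1) 'C(M, i)%:R * iter (c.+1 + M - i)%N seq_dif m (j + i)%N.
  rewrite big_ord_recr /= bin_small// mul0r addr0 [RHS]big_ord_recl bin0 addSnnS.
  by congr (_ + _); apply: eq_bigr => i _; rewrite lift0.
rewrite IH.
have -> : \sum_(i < M.+1) 'C(M, i)%:R * iter (c + M.+1 - i.+1)%N seq_dif m (j + i.+1)%N
   = \sum_(i < M.+1) 'C(M, i)%:R * iter (c + M - i)%N seq_dif m (j.+1 + i)%N.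
  by apply: eq_bigr => i _; rewrite addnS subSS addSnnS.
by rewrite IH [RHS]iter_seq_dif.
Qed.

Lemma bin_trinomial (N k j : nat) : (j <= k <= N)%N ->
  ('C(N, k) * 'C(k, j) = 'C(N, j) * 'C(N - j, k - j))%N.
Proof.
move=> /andP[jk kN].
have e1 := bin_fact kN; have e2 := bin_fact jk; have e3 := bin_fact (leq_trans jk kN).
have e4 : ('C(N - j, k - j) * ((k - j)`! * (N - k)`!) = (N - j)`!)%N.
  by rewrite -[RHS](bin_fact (leq_sub2r j kN)) subnBA// subnK// (leq_trans jk kN).
apply/eqP; rewrite -(eqn_pmul2r (fact_gt0 (N - k))) -(eqn_pmul2r (fact_gt0 j))
  -(eqn_pmul2r (fact_gt0 (k - j))); apply/eqP.
transitivity (N`!).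
  by rewrite -[RHS]e1 -e2; ring.
by rewrite -[LHS]e3 -e4; ring.
Qed.

(** Formal integral of the Bernstein basis polynomial of index k and degree N: the mass that
    Hausdorff's construction puts at k / N. *)
Definition hweight m (N k : nat) : R := 'C(N, k)%:R * iter (N - k)%N seq_dif m k.

Lemma sum_hweight m N : \sum_(k < N.+1) hweight m N k = m 0%N.
Proof.
rewrite -[RHS](@sum_bin_dif m N 0 0); apply: eq_bigr => k _.
by rewrite add0n.
Qed.

(** Factorial moments are exact: a binomial variable K with parameters N and u satisfies E C(K, j) =
    C(N, j) u^j. *)
Lemma sum_hweight_bin m N j : (j <= N)%N ->
  \sum_(k < N.+1) hweight m N k * ('C(k, j)%:R / 'C(N, j)%:R) = m j.
Proof.
move=> jN.
rewrite -(big_mkord xpredT (fun k => hweight m N k * ('C(k, j)%:R / 'C(N, j)%:R))).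
rewrite (big_cat_nat (n := j)) //=; last by rewrite (leq_trans jN).
rewrite big_nat_cond big1 ?add0r; last first.
  by move=> k /andP[/andP[_ kj] _]; rewrite bin_small// mul0r mulr0.
rewrite -{1}[j]add0n big_addn subSn// big_mkord.
rewrite -[RHS](@sum_bin_dif m (N - j) 0 j); apply: eq_bigr => i _.
have iN : (i <= N - j)%N by rewrite -ltnS.
have jiN : (i + j <= N)%N by rewrite addnC -leq_subRL.
rewrite /hweight (_ : iter (0 + (N - j) - i)%N _ _ _ = iter (N - (i + j))%N (@seq_dif) m (i + j)%N);
  last by rewrite add0n -subnDA addnC.
rewrite [LHS]mulrAC; congr (_ * _).
rewrite mulrA -natrM bin_trinomial ?leq_addl//= addnK natrM mulrC mulKf//.
by rewrite pnatr_eq0 -lt0n bin_gt0.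
Qed.

(** The ratio is the product of (k - i) / (N - i) over i < j. Each factor is within i / N of k / N,
    and the errors add up to at most j^2 / N. *)
Lemma bin_ratio_approx N k j : (0 < N)%N -> (j <= N)%N -> (k <= N)%N ->
  [/\ 0 <= ('C(k, j)%:R / 'C(N, j)%:R : R), ('C(k, j)%:R / 'C(N, j)%:R : R) <= 1 &
   `|(k%:R / N%:R) ^+ j - 'C(k, j)%:R / 'C(N, j)%:R| <= j%:R ^+ 2 / N%:R :> R].
Proof.
move=> N0 jN kN; have N0' : 0 < N%:R :> R by rewrite ltr0n.
have u0 : 0 <= k%:R / N%:R :> R by rewrite divr_ge0.
have u1 : k%:R / N%:R <= 1 :> R by rewrite ler_pdivrMr// mul1r ler_nat.
elim: j jN => [|j IH] jN.
  by rewrite !bin0 divr1 expr0 subrr normr0 expr0n /= mul0r.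
have [r0 r1 H] := IH (ltnW jN).
set r : R := 'C(k, j)%:R / 'C(N, j)%:R in r0 r1 H.
pose s : R := (k - j)%:R / (N - j)%:R.
have Nj : 0 < (N - j)%:R :> R by rewrite ltr0n subn_gt0.
have s0 : 0 <= s by rewrite divr_ge0.
have s1 : s <= 1 by rewrite ler_pdivrMr// mul1r ler_nat leq_sub2r.
have Cne i : (i <= N)%N -> 'C(N, i)%:R != 0 :> R by move=> iN; rewrite pnatr_eq0 -lt0n bin_gt0.
have -> : 'C(k, j.+1)%:R / 'C(N, j.+1)%:R = r * s.
  have e (n : nat) : 'C(n, j.+1)%:R = (n - j)%:R * 'C(n, j)%:R / j.+1%:R :> R.
    by rewrite -natrM -mul_bin_left natrM mulrC mulKf.
  by rewrite !e /r /s; field; rewrite Cne ?(ltnW jN)//= (gt_eqF Nj) nat1r pnatr_eq0.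
have us : `|k%:R / N%:R - s| <= j%:R / N%:R.
  have [kj|jk] := leqP k j.
    (* For k <= j the truncated subtraction makes the factor vanish. *)
    have -> : s = 0 by rewrite /s (eqP kj) mul0r.
    by rewrite subr0 ger0_norm// ler_wpM2r ?invr_ge0 ?ler_nat// ltW.
  have -> : k%:R / N%:R - s = j%:R / N%:R * ((N - k)%:R / (N - j)%:R).
    rewrite /s !natrB//; try exact: ltnW.
    by field; rewrite !gt_eqF// subr_gt0 ltr_nat.
  rewrite ger0_norm ?mulr_ge0 ?invr_ge0// ler_piMr ?divr_ge0//.
  by rewrite ler_pdivrMr// mul1r ler_nat leq_sub2l// ltnW.
split; [exact: mulr_ge0|by rewrite mulr_ile1|].
have -> : (k%:R / N%:R) ^+ j.+1 - r * s =
  (k%:R / N%:R) * ((k%:R / N%:R) ^+ j - r) + r * (k%:R / N%:R - s) by rewrite exprS; ring.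
apply: (le_trans (ler_normD _ _)); rewrite (normrM (k%:R / N%:R)) (normrM r) (ger0_norm r0) (ger0_norm u0).
apply: (@le_trans _ _ (j%:R ^+ 2 / N%:R + j%:R / N%:R)).
  by apply: lerD; [apply: le_trans H; exact: ler_piMl|apply: le_trans us; exact: ler_piMl].
rewrite -mulrDl ler_pM2r ?invr_gt0// -!natrX -natrD ler_nat.
by rewrite -!mulnn -mulnSr leq_mul.
Qed.

Lemma hweight_moment m N j : (0 < N)%N -> (j <= N)%N ->
  (forall k, (k <= N)%N -> 0 <= hweight m N k) ->
  `|\sum_(k < N.+1) hweight m N k * (k%:R / N%:R) ^+ j - m j| <= j%:R ^+ 2 / N%:R * m 0%N.
Proof.
move=> N0 jN w0; rewrite -[X in _ - X](sum_hweight_bin m jN) -sumrB.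
apply: (le_trans (ler_norm_sum _ _ _)).
rewrite -(sum_hweight m N) mulr_sumr; apply: ler_sum => k _.
have kN : (k <= N)%N by rewrite -ltnS.
rewrite -mulrBr normrM ger0_norm ?w0// mulrC ler_wpM2r ?w0//.
by have [] := bin_ratio_approx N0 jN kN.
Qed.

End HausdorffMoments.

(** * Limits along an ultrafilter *)

Section UltraLimit.
Variable R : realType.

Lemma ultra_cvg (T : Type) (U : set_system T) (u : T -> R) (B : R) : UltraFilter U ->
  (forall n, `|u n| <= B) -> exists l : R, u @ U --> l.
Proof.
move=> UU uB; have PU := @ultra_proper _ _ UU.
(* The limit is the supremum of the levels that [u] stays above on a set of U; the ultrafilter
   decides whether u >= sup S + e or its negation holds on such a set. *)
pose S := [set a | U [set n | a <= u n]].
have SB : S (- B).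
  rewrite /S /= (_ : [set n | _] = setT); first exact: filterT.
  by apply/seteqP; split=> // n _ /=; have := uB n; rewrite ler_norml => /andP[].
have Sub a : S a -> a <= B.
  move=> /filter_ex[n /= an]; apply: (le_trans an); apply: (le_trans (ler_norm _)); exact: uB.
have hs : has_sup S by split; [exists (- B)|exists B => a /Sub].
exists (sup S); apply/cvgrPdist_lt => e e0.
have [a Sa ae] := sup_adherent e0 hs.
have : U [set n | u n < sup S + e].
  have [h|] := in_ultra_setVsetC [set n | sup S + e <= u n] UU.
    exfalso; have : sup S + e <= sup S by apply: ub_le_sup => //; case: hs.
    lra.
  apply: filterS => n /= /negP; rewrite -ltNge //.
apply: filter_app; near=> n; rewrite /= => hn.
have han : a <= u n by near: n; exact: Sa.
by rewrite ltr_norml; apply/andP; split; lra.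
Unshelve. all: by end_near. Qed.

End UltraLimit.

(** * Step functions from sublevel sets *)

Section StepApproximation.
Variable R : realType.

(** The sum counts the naturals strictly below w, that is, it is the ceiling of w. *)
Lemma sum_count (w : R) m : 0 <= w -> w <= m%:R ->
  w <= \sum_(i < m) (i%:R < w)%R%:R <= w + 1.
Proof.
move=> w0.
have H k : [/\ Num.min w k%:R <= \sum_(i < k) (i%:R < w)%R%:R :> R,
   \sum_(i < k) (i%:R < w)%R%:R <= w + 1 :> R & \sum_(i < k) (i%:R < w)%R%:R <= k%:R :> R].
  elim: k => [|k [h1 h2 h3]]; first by rewrite big_ord0 ge_min lexx orbT addr_ge0.
  rewrite big_ord_recr /= -natr1; move: h1 h2 h3; set s := \sum_(i < k) _.
  rewrite !ge_min; case: (ltP k%:R w) => hk /= /orP[] h1 h2 h3; split; try lra; apply/orP;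
    solve [left; lra | right; lra].
by move=> wm; have [h1 h2 _] := H m; rewrite h2 andbT; rewrite (min_idPl wm) in h1.
Qed.

(** A layer-cake formula. Only the sublevel sets {v <= i / m} occur; for a monotone function these
    are half-lines, whose mass a distribution function gives. *)
Lemma step_approx (v : R) m : (0 < m)%N -> 0 <= v <= 1 ->
  v <= 1 - m%:R^-1 * \sum_(i < m) (v <= i%:R / m%:R)%R%:R <= v + m%:R^-1.
Proof.
move=> m0 /andP[v0 v1]; have m0' : 0 < m%:R :> R by rewrite ltr0n.
have := @sum_count (m%:R * v) m; rewrite mulr_ge0 ?(ltW m0')// ler_piMr ?(ltW m0')// => /(_ isT isT).
have -> : \sum_(i < m) (v <= i%:R / m%:R)%R%:R = m%:R - \sum_(i < m) (i%:R < m%:R * v)%R%:R :> R.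
  apply/eqP; rewrite eq_sym subr_eq -big_split /=; apply/eqP.
  transitivity (\sum_(i < m) (1 : R)); first by rewrite sumr_const card_ord.
  apply: eq_bigr => i _; rewrite ler_pdivlMr// [v * _]mulrC.
  by case: leP => _ /=; rewrite ?addr0 ?add0r.
move: (\sum_(i < m) _) => S /andP[S1 S2].
have -> : 1 - m%:R^-1 * (m%:R - S) = S / m%:R by field; rewrite gt_eqF.
have -> : v + m%:R^-1 = (m%:R * v + 1) / m%:R by field; rewrite gt_eqF.
by rewrite ler_pM2r ?invr_gt0// S2 andbT ler_pdivlMr// mulrC.
Qed.

End StepApproximation.

(** * A probability from a sequence of positive functionals *)

Section LimitMeasure.
Context (R : realType) (Ln : nat -> (R -> R) -> R).
Hypothesis LnD : forall n f g, Ln n (fun x => f x + g x) = Ln n f + Ln n g.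
Hypothesis LnZ : forall n c f, Ln n (fun x => c * f x) = c * Ln n f.
Hypothesis Ln_le : forall n f g, (forall x, 0 <= x <= 1 -> f x <= g x) -> Ln n f <= Ln n g.
Hypothesis Ln1 : forall n, Ln n (fun=> 1) = 1.

Let LnC n c : Ln n (fun=> c) = c.
Proof. by rewrite -[RHS]mulr1 -(Ln1 n) -LnZ; congr (Ln n _); apply/funext => x; rewrite mulr1. Qed.

Let ind (a : R) : R -> R := fun u => (u <= a)%R%:R.

Let ind01 a u : 0 <= ind a u <= 1.
Proof. by rewrite /ind; case: (u <= a) => /=; rewrite ?lexx ?ler01. Qed.

Let Ln01 n a : 0 <= Ln n (ind a) <= 1.
Proof.
apply/andP; split.
  by rewrite -[X in X <= _](LnC n 0); apply: Ln_le => x _; have /andP[] := ind01 a x.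
by rewrite -[X in _ <= X](LnC n 1); apply: Ln_le => x _; have /andP[] := ind01 a x.
Qed.

Variable U : set_system nat.
Hypothesis UU : UltraFilter U.
Hypothesis Uoo : \oo `<=` U.
Local Instance PU : ProperFilter U := @ultra_proper _ _ UU.

Let limP a : {l : R | Ln^~ (ind a) @ U --> l}.
Proof.
apply: cid; apply: (@ultra_cvg _ _ _ _ 1 UU) => n; have /andP[h1 h2] := Ln01 n a.
by rewrite ger0_norm.
Qed.

(** Limit distribution function along [U]. It is monotone but may fail to be right continuous, hence
    the regularisation [F] below. *)
Let F0 a := sval (limP a).

Let F0_cvg a : Ln^~ (ind a) @ U --> F0 a. Proof. exact: svalP (limP a). Qed.

Let F0_01 a : 0 <= F0 a <= 1.
Proof.
apply/andP; split.
  by apply: (cvgr_to_ge (@F0_cvg a)); apply: nearW => n; have /andP[] := Ln01 n a.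
by apply: (cvgr_to_le (@F0_cvg a)); apply: nearW => n; have /andP[] := Ln01 n a.
Qed.

Let F0_mono a b : a <= b -> F0 a <= F0 b.
Proof.
move=> ab; apply: (ler_cvg_to (@F0_cvg a) (@F0_cvg b)); apply: nearW => n.
apply: Ln_le => x _; rewrite /ind; case: (leP x a) => xa /=; last by case: (x <= b).
by rewrite (le_trans xa ab).
Qed.

Let F0_lt0 a : a < 0 -> F0 a = 0.
Proof.
move=> a0; apply/eqP; rewrite eq_le; have /andP[-> _] := F0_01 a; rewrite andbT.
apply: (cvgr_to_le (@F0_cvg a)); apply: nearW => n.
rewrite -[X in _ <= X](LnC n 0); apply: Ln_le => x /andP[x0 _].
rewrite /ind (_ : (x <= a)%R = false)//; apply/negbTE; rewrite -ltNge.
exact: lt_le_trans a0 x0.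
Qed.

Let F0_ge1 a : 1 <= a -> F0 a = 1.
Proof.
move=> a1; apply/eqP; rewrite eq_le; have /andP[_ ->] := F0_01 a.
apply: (cvgr_to_ge (@F0_cvg a)); apply: nearW => n.
rewrite -[X in X <= _](LnC n 1); apply: Ln_le => x /andP[_ x1].
by rewrite /ind (le_trans x1 a1).
Qed.

Let S a := [set F0 b | b in [set b | a < b]].
Let F a := inf (S a).

Let S_inf a : has_inf (S a).
Proof.
split; first by exists (F0 (a + 1)); exists (a + 1) => //=; rewrite ltrDl.
by exists 0 => _ [b _ <-]; have /andP[] := F0_01 b.
Qed.

Let F_le a b : a < b -> F a <= F0 b.
Proof. by move=> ab; apply: ge_inf; [case: (S_inf a)|exists b]. Qed.

Let F_ge a : F0 a <= F a.
Proof.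
apply: lb_le_inf; first by case: (S_inf a).
by move=> _ [b /= ab <-]; apply: F0_mono; exact: ltW.
Qed.

Let F_nd : nondecreasing F.
Proof.
move=> a b ab; apply: lb_le_inf; first by case: (S_inf b).
by move=> _ [c /= bc <-]; apply: F_le; exact: le_lt_trans ab bc.
Qed.

Let F_rc : right_continuous F.
Proof.
move=> a; apply/cvgrPdist_lt => e e0.
have [_ [b /= ab <-] be] := inf_adherent e0 (S_inf a).
near=> x.
have ax : a < x by near: x; exact: nbhs_right_gt.
have xb : x < b by near: x; exact: nbhs_right_lt.
have := F_nd (ltW ax); have := F_le xb; rewrite distrC.
move=> h1 h2; rewrite ger0_norm ?subr_ge0//; rewrite -/(F a) in be; lra.
Unshelve. all: by end_near. Qed.

Let F_Ny : F x @[x --> -oo] --> (0 : R).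
Proof.
apply: cvg_near_cst; near=> x.
have x0 : x < -1 by near: x; exact: nbhs_ninfty_lt.
apply/eqP; rewrite eq_le; apply/andP; split.
  by rewrite -(@F0_lt0 (- (1 / 2))); [apply: F_le; lra|lra].
by apply: le_trans (F_ge x); have /andP[] := F0_01 x.
Unshelve. all: by end_near. Qed.

Let F_y : F x @[x --> +oo] --> (1 : R).
Proof.
apply: cvg_near_cst; near=> x.
have x0 : 1 < x by near: x; exact: nbhs_pinfty_gt.
apply/eqP; rewrite eq_le; apply/andP; split.
  by rewrite -(@F0_ge1 (x + 1)); [apply: F_le; lra|lra].
by rewrite -(F0_ge1 (ltW x0)); exact: F_ge.
Unshelve. all: by end_near. Qed.

#[local] HB.instance Definition _ := isCumulative.Build R _ R F F_nd F_rc.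
#[local] HB.instance Definition _ := isCumulativeBounded.Build R 0 1 F F_Ny F_y.

Let P : probability (measurableTypeR R) R := lebesgue_stieltjes_measure F.

Let P_itv a : P [set u | u <= a] = (F a)%:E.
Proof.
have := @cdf_lebesgue_stieltjes_id R F a; rewrite /cdf /distribution /pushforward /= => <-.
by congr (P _); apply/seteqP; split=> u /=; rewrite in_itv.
Qed.

(** The ultrafilter serves the indicators of half-lines; [g] itself converges in the ordinary sense.
    [F0] and [F] may differ at jumps, but the strictly increasing thresholds [t] make their values
    interlace, which costs one level out of m. *)
Lemma limit_measureP : exists Q : probability (measurableTypeR R) R,
  forall (g t : R -> R) (l : R), (forall u, 0 <= g u <= 1) ->
   (forall r u, 0 <= r < 1 -> (g u <= r) = (u <= t r)) ->
   (forall r r', 0 <= r -> r < r' -> r' < 1 -> t r < t r') ->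
   Ln^~ g @ \oo --> l -> (\int[Q]_u (g u)%:E = l%:E)%E.
Proof.
exists P => g t l g01 gt tlt gl.
have mg : measurable_fun setT g.
  apply: nondecreasing_measurable => // u v uv; rewrite leNgt; apply/negP => gvu.
  have /andP[gv0 _] := g01 v; have /andP[_ gu1] := g01 u.
  have hr : 0 <= g v < 1 by rewrite gv0 (lt_le_trans gvu).
  have : v <= t (g v) by rewrite -gt.
  by move=> /(le_trans uv); rewrite -gt// leNgt gvu.
have bg : bmf setT g.
  by split => //; exists 1 => u _; have /andP[g0 g1] := g01 u; rewrite ger0_norm.
have indE a : ind a = \1_[set u | u <= a].
  apply/funext => u; rewrite indicE /ind; case: (boolP (u <= a)) => h; first by rewrite mem_set.
  by rewrite memNset//; exact/negP.
have mle a : measurable [set u : R | u <= a].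
  have -> : [set u : R | u <= a] = `]-oo, a]%classic by apply/seteqP; split=> u /=; rewrite in_itv.
  exact: measurable_itv.
have bind a : bmf setT (ind a).
  split; first by rewrite indE; exact: measurable_indic.
  by exists 1 => u _; have /andP[g0 g1] := ind01 a u; rewrite ger0_norm.
have Eind a : \int[P]_u ind a u = F a.
  rewrite /Rintegral (_ : (\int[P]_u (ind a u)%:E)%E = (F a)%:E)//.
  rewrite indE (@integral_indic _ _ _ P setT measurableT _ (mle a)) setIT.
  exact: P_itv.
rewrite bintE//; congr EFin.
have glU : Ln^~ g @ U --> l by move=> A /gl; exact: Uoo.
(* Up to 1 / m, l is one minus the mean of F0 over m levels and the integral is one minus the mean
   of F; the two means differ by at most 1 / m. *)
have key k : `|\int[P]_u g u - l| <= 3 / k.+1%:R.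
  pose m := k.+1; pose a i := t (i%:R / m%:R : R).
  have m0 : 0 < m%:R :> R by rewrite ltr0n.
  pose s u : R := 1 - m%:R^-1 * \sum_(i < m) ind (a i) u.
  have gs u : g u <= s u <= g u + m%:R^-1.
    have := @step_approx R (g u) m isT (g01 u).
    rewrite /s (eq_bigr (fun i : 'I_m => ind (a i) u))// => i _.
    by rewrite /ind gt// divr_ge0//= ltr_pdivrMr// mul1r ltr_nat.
  have bs : bmf setT (fun u => m%:R^-1 * \sum_(i < m) ind (a i) u).
    by apply/bmfZ/bmf_sum => // i; exact: bind.
  have bss : bmf setT s by apply: bmfB => //; exact: bmf_cst.
  have Es : \int[P]_u s u = 1 - m%:R^-1 * \sum_(i < m) F (a i).
    rewrite bintB//; last exact: bmf_cst.
    rewrite bint_cst// bintZ//; last by apply: bmf_sum => // i; exact: bind.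
    rewrite bint_sum//; last by move=> i; exact: bind.
    rewrite [P _]probability_setT mulr1.
    by congr (_ - _ * _); apply: eq_bigr => i _; exact: Eind.
  have LnS n : Ln n s = 1 - m%:R^-1 * \sum_(i < m) Ln n (ind (a i)).
    have Lsum (r : seq 'I_m) : Ln n (fun u => \sum_(i <- r) ind (a i) u) = \sum_(i <- r) Ln n (ind (a i)).
      elim: r => [|i r IH].
        by rewrite big_nil -[RHS](LnC n 0); congr (Ln n _); apply/funext => u; rewrite big_nil.
      rewrite big_cons -IH -LnD; congr (Ln n _); apply/funext => u; by rewrite big_cons.
    rewrite -Lsum -mulNr -LnZ -[X in X + _](LnC n 1) -LnD; congr (Ln n _).
    by apply/funext => u; rewrite mulNr.
  have sumcvg (r : seq 'I_m) : (fun n => \sum_(i <- r) Ln n (ind (a i))) @ U --> \sum_(i <- r) F0 (a i).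
    elim: r => [|i r IH].
      by under eq_fun do rewrite big_nil; rewrite big_nil; exact: cvg_cst.
    under eq_fun do rewrite big_cons; rewrite big_cons; apply: cvgD => //; exact: F0_cvg.
  have scvg : Ln^~ s @ U --> 1 - m%:R^-1 * \sum_(i < m) F0 (a i).
    under eq_fun do rewrite LnS.
    by apply: cvgB; [exact: cvg_cst|apply: cvgM; [exact: cvg_cst|exact: sumcvg]].
  have l1 : l <= 1 - m%:R^-1 * \sum_(i < m) F0 (a i).
    apply: (ler_cvg_to glU scvg); apply: nearW => n; apply: Ln_le => u _.
    by have /andP[] := gs u.
  have l2 : 1 - m%:R^-1 * \sum_(i < m) F0 (a i) <= l + m%:R^-1.
    apply: (ler_cvg_to scvg (cvgD glU (cvg_cst _))); apply: nearW => n.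
    change (Ln n s <= Ln n g + m%:R^-1).
    rewrite -[X in _ + X](LnC n m%:R^-1) -LnD; apply: Ln_le => u _.
    by have /andP[] := gs u.
  have i1 : \int[P]_u g u <= \int[P]_u s u.
    by apply: bint_le => // u _; have /andP[] := gs u.
  have i2 : \int[P]_u s u <= \int[P]_u g u + m%:R^-1.
    rewrite -[X in _ + X]mulr1 -[X in _ * X]/(fine 1%E) -(probability_setT P).
    rewrite -bint_cst// -bintD//; last exact: bmf_cst.
    by apply: bint_le => // [|u _]; [apply: bmfD => //; exact: bmf_cst|have /andP[] := gs u].
  have f1 : \sum_(i < m) F0 (a i) <= \sum_(i < m) F (a i) by apply: ler_sum => i _; exact: F_ge.
  (* Interlacing: F at one threshold is at most F0 at the next. The last threshold has no successor
     below level 1, and there F is bounded by 1. *)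
  have f2 : \sum_(i < m) F (a i) <= \sum_(i < m) F0 (a i) + 1.
    rewrite /m big_ord_recr /= [X in _ <= X + _]big_ord_recl /=.
    have Fk : F (a k) <= 1.
      have : F (a k) <= F0 (a k + 1) by apply: F_le; rewrite ltrDl.
      by move=> /le_trans; apply; have /andP[] := F0_01 (a k + 1).
    have F00 : 0 <= F0 (a 0%N) by have /andP[] := F0_01 (a 0%N).
    have : \sum_(i < k) F (a i) <= \sum_(i < k) F0 (a (bump 0 i)).
      apply: ler_sum => i _; apply: F_le; rewrite /a /bump /= add1n; apply: tlt.
      - by rewrite divr_ge0.
      - by rewrite ltr_pM2r ?invr_gt0// ltr_nat.
      - by rewrite ltr_pdivrMr// mul1r ltr_nat /m ltnS.
    lra.
  have m1 : m%:R^-1 * \sum_(i < m) F0 (a i) <= m%:R^-1 * \sum_(i < m) F (a i).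
    by rewrite ler_wpM2l// invr_ge0.
  have m2 : m%:R^-1 * \sum_(i < m) F (a i) <= m%:R^-1 * (\sum_(i < m) F0 (a i) + 1).
    by rewrite ler_wpM2l// invr_ge0.
  rewrite mulrDr mulr1 in m2; rewrite Es in i1 i2.
  rewrite ler_norml; apply/andP; split; rewrite -/m; lra.
apply/eqP; rewrite -subr_eq0 -normr_le0.
have c0 : 3 / k.+1%:R @[k --> \oo] --> (0 : R).
  rewrite -[X in _ --> X](mulr0 3); apply: cvgM; [exact: cvg_cst|exact: cvg_harmonic].
by apply: (cvgr_to_ge c0); apply: nearW => k; exact: key.
Qed.

End LimitMeasure.

(** * Completely monotone functions as Laplace transforms *)

Section BernsteinWidder.
Variable R : realType.
Implicit Types (phi : R -> R) (theta u r : R).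

(** exp(-theta y) in the coordinate u = exp(-y), frozen outside [0, 1]. The value 0 at u = 0 is the
    one at y = +oo. *)
Definition gth theta u : R := if u <= 0 then 0 else if 1 <= u then 1 else u `^ theta.

Definition gth_inv theta r : R := r `^ theta^-1.

Lemma gth01 theta u : 0 < theta -> 0 <= gth theta u <= 1.
Proof.
move=> t0; rewrite /gth; case: ifPn => [_|]; first by rewrite lexx ler01.
rewrite -ltNge => u0; case: ifPn => [_|]; first by rewrite lexx ler01.
rewrite -ltNge => u1; rewrite powR_ge0 /=.
have <- : 1 `^ theta = 1 :> R by rewrite powR1.
by apply: ge0_ler_powR; rewrite ?nnegrE ?ler01 ?ltW.
Qed.

Lemma gth_invK theta r : 0 < theta -> 0 <= r -> gth_inv theta r `^ theta = r.
Proof. by move=> t0 r0; rewrite -powRrM mulVf ?gt_eqF// powRr1. Qed.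

Lemma gth_inv_lt theta r r' : 0 < theta -> 0 <= r -> r < r' -> gth_inv theta r < gth_inv theta r'.
Proof.
move=> t0 r0 rr; apply: gt0_ltr_powR => //; rewrite ?invr_gt0 ?nnegrE//.
by rewrite (le_trans r0 (ltW rr)).
Qed.

Lemma gth_le theta r u : 0 < theta -> 0 <= r < 1 -> (gth theta u <= r) = (u <= gth_inv theta r).
Proof.
move=> t0 /andP[r0 r1]; have tr0 : 0 <= gth_inv theta r by exact: powR_ge0.
rewrite /gth; case: ifPn => [u0|]; first by rewrite r0 (le_trans u0 tr0).
rewrite -ltNge => u0; case: ifPn => [u1|].
  rewrite [LHS]leNgt r1 [RHS]leNgt; congr (~~ _); apply/esym.
  have := gth_inv_lt t0 r0 r1; rewrite {2}/gth_inv powR1 => /lt_le_trans; exact.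
rewrite -ltNge => u1; apply/idP/idP => [h|h].
  rewrite leNgt; apply/negP => /(gt0_ltr_powR t0); rewrite !nnegrE => /(_ tr0 (ltW u0)).
  by rewrite gth_invK// ltNge h.
by rewrite -(gth_invK t0 r0); apply: ge0_ler_powR; rewrite ?nnegrE ?(ltW u0) ?(ltW t0).
Qed.

(** With u = w^p, the power u^theta = w^(p theta) lies between two consecutive integer powers of w,
    and those are accessible to moments. *)
Lemma gth_expn theta (p j : nat) (w : R) : 0 < theta -> 0 <= w <= 1 -> (0 < p)%N ->
  j%:R <= p%:R * theta < j.+1%:R -> w ^+ j.+1 <= gth theta (w ^+ p) <= w ^+ j.
Proof.
move=> t0 /andP[w0 w1] p0 /andP[j1 j2].
have [->|wn0] := eqVneq w 0.
  by rewrite /gth !expr0n (gtn_eqF p0) /= !lexx ler0n.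
have wp : 0 < w by rewrite lt_neqAle eq_sym wn0.
have -> : gth theta (w ^+ p) = w `^ (p%:R * theta).
  rewrite powRrM powR_mulrn// /gth leNgt exprn_gt0//=; case: ifPn => // h.
  have -> : w ^+ p = 1 by apply/eqP; rewrite eq_le h andbT exprn_ile1.
  by rewrite powR1.
rewrite -!powR_mulrn//; apply/andP; split; apply: ger_powR; rewrite ?wp//; exact: ltW.
Qed.

Section Functional.
Variable phi : R -> R.
Hypothesis phi_dif : forall n h x, 0 < h -> 0 < x -> 0 <= iter n (fun_dif h) phi x.
Hypothesis phi_le1 : forall x, 0 < x -> phi x <= 1.
Hypothesis phi_cont : forall x, 0 < x -> {for x, continuous phi}.

Let phi_noninc x y : 0 < x -> x <= y -> phi y <= phi x.
Proof.
move=> x0; rewrite le_eqVlt => /orP[/eqP ->//|xy].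
have := @phi_dif 1 (y - x) x; rewrite subr_gt0 => /(_ xy x0).
by rewrite /= /fun_dif subr_ge0 addrC subrK.
Qed.

Let h n : R := (n.+1%:R)^-1.
Let m n (k : nat) : R := phi (k.+1%:R * h n).
(** The cube comes from the error j^2 / N in [hweight_moment]: the orders j in use are at most
    (theta + 1) (n + 1), so the error is at most (theta + 1)^2 / (n + 1). *)
Let N n : nat := (n.+1 ^ 3)%N.
Let wt n k : R := hweight (m n) (N n) k.

(* In the coordinate u = exp(-y), [phi (k.+1%:R * h)] is the [k]-th moment of [w = u `^ h]
   for the measure weighted by [w], so Hausdorff's weights of order [N] at the nodes
   [w = k / N], i.e. [u = (k / N) ^+ n.+1], approximate that measure; the missing mass
   [1 - phi h] goes to [u = 0], i.e. to y = +oo. *)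
Definition approx_functional n (g : R -> R) : R :=
  (1 - phi (h n)) * g 0 + \sum_(k < (N n).+1) wt n k * g ((k%:R / (N n)%:R) ^+ n.+1).

Let h_gt0 n : 0 < h n. Proof. by rewrite invr_gt0. Qed.

Let wt_ge0 n k : 0 <= wt n k.
Proof.
rewrite /wt /hweight mulr_ge0// iter_fun_dif phi_dif// mulr_gt0//.
Qed.

Let m0 n : m n 0%N = phi (h n). Proof. by rewrite /m mul1r. Qed.

Lemma approx_functionalD n f g :
  approx_functional n (fun x => f x + g x) = approx_functional n f + approx_functional n g.
Proof.
rewrite /approx_functional mulrDr addrACA -big_split /=; congr (_ + _).
by apply: eq_bigr => k _; rewrite mulrDr.
Qed.

Lemma approx_functionalZ n c f : approx_functional n (fun x => c * f x) = c * approx_functional n f.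
Proof.
rewrite /approx_functional mulrDr mulrCA mulr_sumr; congr (_ + _).
by apply: eq_bigr => k _; rewrite mulrCA.
Qed.

Let node01 n k : (k < (N n).+1)%N -> 0 <= (k%:R / (N n)%:R : R) <= 1.
Proof.
by rewrite divr_ge0//= ler_pdivrMr ?mul1r ?ler_nat// ltr0n expn_gt0.
Qed.

Lemma approx_functional_le n f g : (forall x, 0 <= x <= 1 -> f x <= g x) ->
  approx_functional n f <= approx_functional n g.
Proof.
move=> fg; apply: lerD.
  by apply: ler_wpM2l; [rewrite subr_ge0 phi_le1|apply: fg; rewrite lexx ler01].
apply: ler_sum => k _; apply: ler_wpM2l => //; apply: fg.
have /andP[k0 k1] := node01 (ltn_ord k).
by rewrite exprn_ge0//= exprn_ile1.
Qed.

Lemma approx_functional1 n : approx_functional n (fun=> 1) = 1.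
Proof.
rewrite /approx_functional mulr1; under eq_bigr do rewrite mulr1.
by rewrite sum_hweight m0 subrK.
Qed.

Lemma approx_functional_gth theta : 0 < theta ->
  approx_functional n (gth theta) @[n --> \oo] --> phi theta.
Proof.
move=> t0.
have B n : theta + 1 <= n.+1%:R ->
  phi (theta + 2 * h n) - (theta + 1) ^+ 2 * h n <= approx_functional n (gth theta)
    <= phi theta + (theta + 1) ^+ 2 * h n.
  move=> nt; pose p := n.+1; have p0 : 0 < p%:R :> R by rewrite ltr0n.
  have pt0 : 0 <= p%:R * theta by rewrite mulr_ge0// ltW.
  (* With j the integer part of p theta, (j + 1) h exceeds theta and (j + 2) h is at most theta + 2
     h; monotonicity of phi then places the moments of orders j and j + 1. *)
  have := truncn_itv pt0; set j := Num.Def.truncn _ => jj.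
  have /andP[j1 j2] := jj.
  have N0 : (0 < N n)%N by rewrite expn_gt0.
  have jN : (j.+1 <= N n)%N.
    rewrite -(ler_nat R) natrX -natr1.
    apply: (@le_trans _ _ (p%:R * (theta + 1))); first by rewrite mulrDr mulr1 lerD// ler1n.
    apply: (@le_trans _ _ (p%:R * p%:R)); first by rewrite ler_pM2l.
    by rewrite -expr2 -[leLHS]mulr1 -[leRHS]/(p%:R ^+ 3) [leRHS]exprSr ler_pM2l ?exprn_gt0// ler1n.
  have Np : (N n)%:R = p%:R ^+ 3 :> R by rewrite natrX.
  have bnd (i : nat) : i%:R <= p%:R * (theta + 1) ->
      i%:R ^+ 2 / (N n)%:R * m n 0%N <= (theta + 1) ^+ 2 * h n.
    move=> ip; have -> : (theta + 1) ^+ 2 * h n = (p%:R * (theta + 1)) ^+ 2 / (N n)%:R.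
      by rewrite Np /h -/p; field; rewrite gt_eqF.
    apply: (@le_trans _ _ (i%:R ^+ 2 / (N n)%:R)).
      by rewrite ler_piMr ?divr_ge0 ?sqr_ge0// m0 phi_le1.
    by rewrite ler_pM2r ?invr_gt0 ?ltr0n// lerXn2r// ?nnegrE// (le_trans _ ip).
  have j1p : j.+1%:R <= p%:R * (theta + 1) by rewrite -natr1 mulrDr mulr1 lerD// ler1n.
  have jp : j%:R <= p%:R * (theta + 1).
    by apply: le_trans j1p; rewrite ler_nat.
  have M1 := @hweight_moment _ (m n) _ _ N0 jN (fun k _ => wt_ge0 n k).
  have M2 := @hweight_moment _ (m n) _ _ N0 (ltnW jN) (fun k _ => wt_ge0 n k).
  have := le_trans M1 (bnd _ j1p); have := le_trans M2 (bnd _ jp).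
  rewrite !ler_norml => /andP[_ u2] /andP[u1 _].
  have mj : m n j <= phi theta.
    by apply: phi_noninc => //; rewrite /h ler_pdivlMr// mulrC ltW.
  have mj1 : phi (theta + 2 * h n) <= m n j.+1.
    apply: phi_noninc; first by rewrite mulr_gt0.
    rewrite -[j.+2]addn2 natrD mulrDl lerD// /h ler_pdivrMr// mulrC.
    exact: j1.
  have e k : approx_functional k (gth theta) =
      \sum_(i < (N k).+1) wt k i * gth theta ((i%:R / (N k)%:R) ^+ k.+1).
    by rewrite /approx_functional {1}/gth lexx mulr0 add0r.
  have lo : \sum_(k < (N n).+1) wt n k * (k%:R / (N n)%:R) ^+ j.+1 <= approx_functional n (gth theta).
    rewrite e; apply: ler_sum => k _; apply: ler_wpM2l => //.
    by have /andP[] := gth_expn t0 (node01 (ltn_ord k)) (ltn0Sn n) jj.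
  have hi : approx_functional n (gth theta) <= \sum_(k < (N n).+1) wt n k * (k%:R / (N n)%:R) ^+ j.
    rewrite e; apply: ler_sum => k _; apply: ler_wpM2l => //.
    by have /andP[] := gth_expn t0 (node01 (ltn_ord k)) (ltn0Sn n) jj.
  by apply/andP; split; rewrite /wt in lo hi; lra.
have hc : h n @[n --> \oo] --> (0 : R) by exact: cvg_harmonic.
have c1 : theta + 2 * h n @[n --> \oo] --> theta.
  rewrite -[X in _ --> X]addr0 -[X in _ --> _ + X](mulr0 2).
  by apply: cvgD; [exact: cvg_cst|apply: cvgM => //; exact: cvg_cst].
have c2 : (theta + 1) ^+ 2 * h n @[n --> \oo] --> (0 : R).
  by rewrite -[X in _ --> X](mulr0 ((theta + 1) ^+ 2)); apply: cvgM => //; exact: cvg_cst.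
apply: (@squeeze_cvgr _ _ _ _ (fun n => phi (theta + 2 * h n) - (theta + 1) ^+ 2 * h n)
   (fun n => phi theta + (theta + 1) ^+ 2 * h n)).
- near=> n; apply: B; near: n.
  exists (Num.bound (theta + 1)) => // n /= bn.
  apply: (@le_trans _ _ (Num.bound (theta + 1))%:R); last by rewrite ler_nat ltnW.
  by apply/ltW/archi_boundP; lra.
- rewrite -[X in _ --> X]subr0; apply: cvgB => //.
  by apply: (continuous_cvg _ _ c1); exact: phi_cont.
- by rewrite -[X in _ --> X]addr0; apply: cvgD => //; exact: cvg_cst.
Unshelve. all: by end_near. Qed.

Theorem bernstein_widder : exists mu : probability (\bar R) R,
  mu (~` @Sp R) = 0%E /\ forall theta, 0 < theta ->
  (\int[mu]_(y in [set y : \bar R | (0 <= y)%E /\ (y < +oo)%E]) (expR (- theta * fine y))%:E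
    = (phi theta)%:E)%E.
Proof.
have [U [UU Uoo]] := @ultraFilterLemma nat \oo _.
have [Q HQ] := limit_measureP approx_functionalD approx_functionalZ approx_functional_le
  approx_functional1 UU Uoo.
(* Clipping at 1 and sending u <= 0 to +oo matches the freezing in [gth], so [T] lands in [0,+oo]
   wherever [Q] has its mass. *)
pose T u : \bar R := if u <= 0 then +oo%E else (- ln (Num.min u 1))%:E.
have mT : measurable_fun setT T.
  apply: measurable_fun_ifT; [exact: measurable_fun_ler| exact: measurable_cst|].
  apply/measurable_EFinP; apply: measurableT_comp => //.
  by apply: measurableT_comp; [exact: measurable_ln|exact: measurable_minr].
have T0 u : (0 <= T u)%E.
  rewrite /T; case: ifPn => // _; rewrite lee_fin oppr_ge0 ln_le0// ge_min lexx orbT//.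
pose X : {mfun (measurableTypeR R) >-> \bar R} := HB.pack T
  (@isMeasurableFun.Build _ _ (measurableTypeR R) (\bar R) T mT).
exists (distribution Q X); split.
  change (Q (T @^-1` (~` @Sp R)) = 0%E); have -> : T @^-1` (~` @Sp R) = set0.
    by rewrite -subset0 => u /=; apply; exact: T0.
  exact: measure0.
move=> theta t0.
rewrite -(HQ (gth theta) (gth_inv theta) (phi theta) (fun u => gth01 u t0) (fun r u h => gth_le u t0 h)
  (fun r r' hr hrr _ => gth_inv_lt t0 hr hrr) (approx_functional_gth t0)).
set D := [set y | _].
have mD : measurable D.
  rewrite (_ : D = `[0%E, +oo%E[%classic); first exact: emeasurable_itv.
  by apply/seteqP; split=> y /=; rewrite in_itv /= => /andP.
rewrite integral_mkcond ge0_integral_distribution; last 2 first.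
- apply/(measurable_restrictT _ mD)/measurable_EFinP.
  apply: measurableT_comp; first exact: measurable_expR.
  by apply: measurable_funM; [exact: measurable_cst|apply: measurable_funTS; exact: fine_measurable].
- by move=> y; rewrite patchE; case: ifPn => // _; rewrite lee_fin expR_ge0.
apply: eq_integral => u _; rewrite /= patchE /= /T /gth.
have [u0|u0] := leP u 0.
  by rewrite memNset// /D /= => -[]; rewrite ltxx.
rewrite mem_set; last first.
  have := T0 u; have u0F : (u <= 0) = false by rewrite leNgt u0.
  rewrite /T u0F /D /= => Tu; split => //; exact: ltry.
rewrite /= mulrNN; congr EFin; case: ifPn => [u1|].
  by rewrite (min_idPr u1) ln1 mulr0 expR0.
rewrite -ltNge => u1; rewrite (min_idPl (ltW u1)) mulrC expRM lnK//.
Qed.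

End Functional.
End BernsteinWidder.

(** * Laplace transforms of measures on the half-line *)

Section ExpCoordinate.
Variable R : realType.
Implicit Types (y : \bar R) (u theta : R).

(** The exponential extended by its limit 0 at +oo. *)
Definition lapf theta y : R := if y is r%:E then expR (- theta * r) else 0.

(** Left inverse of [lapf 1] on the state space, made total so that it maps all of [R] continuously
    into [0,+oo]. *)
Definition nln u : \bar R := if u <= 0 then +oo%E else (- ln (Num.min u 1))%:E.

Lemma lapf_ge0 theta y : 0 <= lapf theta y.
Proof. by case: y => [r| |] //=; rewrite expR_ge0. Qed.

Lemma lapf_le1 theta y : 0 <= theta -> Sp y -> lapf theta y <= 1.
Proof.
case: y => [r| |] //= t0; rewrite /Sp /= lee_fin => r0.
by rewrite -expR0 ler_expR mulNr oppr_le0 mulr_ge0.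
Qed.

Lemma lapf_expn n y : lapf n.+1%:R y = lapf 1 y ^+ n.+1.
Proof.
case: y => [r| |] /=; rewrite ?expr0n//.
by rewrite -expRM_natl; congr expR; ring.
Qed.

Lemma measurable_lapf theta : measurable_fun setT (lapf theta).
Proof.
rewrite (_ : lapf theta = fun y => if y \is a fin_num then expR (- theta * fine y) else 0); last first.
  by apply/funext => -[r| |].
apply: measurable_fun_ifT; [|apply: measurableT_comp; first exact: measurable_expR|exact: measurable_cst].
  apply: (measurable_fun_bool true).
  rewrite setTI (_ : _ @^-1` _ = `]-oo%E, +oo%E[%classic); first exact: emeasurable_itv.
  by apply/seteqP; split=> -[r| |]; rewrite /= in_itv //= ?ltNyr ?ltry.
by apply: measurable_funM; [exact: measurable_cst|exact: fine_measurable].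
Qed.

Lemma measurable_Sp : measurable (@Sp R).
Proof.
rewrite (_ : @Sp R = `[0%E, +oo%E]%classic); first exact: emeasurable_itv.
by apply/seteqP; split=> y; rewrite /Sp /= in_itv /= leey andbT.
Qed.

Lemma nln_Sp u : Sp (nln u).
Proof.
by rewrite /Sp /nln /=; case: ifPn => // _; rewrite lee_fin oppr_ge0 ln_le0// ge_min lexx orbT.
Qed.

Lemma nln_lapf y : Sp y -> nln (lapf 1 y) = y.
Proof.
case: y => [r| |]; rewrite /Sp /nln //= ?lexx// lee_fin => r0.
rewrite leNgt expR_gt0 /= (min_idPl _) ?expRK ?mulN1r ?opprK//.
by rewrite -expR0 ler_expR ?mulN1r oppr_le0.
Qed.

Lemma nln_continuous : continuous nln.
Proof.
move=> u; have [u0|u0|->] := ltgtP u 0.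
- apply: cvg_near_cst; near=> v.
  have v0 : v < 0 by near: v; exact: lt_nbhsl.
  by rewrite /nln (ltW u0) (ltW v0).
- have cv : (- ln (Num.min v 1))%:E @[v --> u] --> (- ln (Num.min u 1))%:E.
    apply: cvg_EFin; first exact: nearW.
    apply: cvgN; apply: (@cvg_comp _ _ _ (fun v => Num.min v 1) (@ln R) _ (nbhs (Num.min u 1))).
      exact: (@continuous_min R R id (fun=> 1) u cvg_id (cvg_cst _)).
    by apply: continuous_ln; rewrite lt_min u0 ltr01.
  rewrite /continuous_at /nln (leNgt u) u0 /=.
  apply: cvg_trans cv; apply: near_eq_cvg; near=> v.
  have v0 : 0 < v by near: v; exact: lt_nbhsr.
  by rewrite leNgt v0.
rewrite /continuous_at {2}/nln lexx; apply/cvgeyPge => A; near=> v.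
rewrite /nln; case: ifPn; first by rewrite leey.
rewrite -ltNge => v0; rewrite lee_fin lerNr -[leRHS]expRK.
rewrite ler_ln ?posrE ?expR_gt0 ?lt_min ?v0 ?ltr01// ge_min; apply/orP; left; apply: ltW.
by near: v; apply: lt_nbhsl; exact: expR_gt0.
Unshelve. all: by end_near. Qed.

(** Turns continuity on the compact space [0,+oo] into continuity of a function on [R], where
    polynomials are available. *)
Lemma Sp_continuous_nln (f : \bar R -> R) : {within @Sp R, continuous f} ->
  continuous (f \o nln).
Proof.
move=> cf u P nP.
have h : within (@Sp R) (nbhs (nln u)) (f @^-1` P).
  by rewrite (nbhs_subspace_in (nln_Sp u)); exact: (cf (nln u) P nP).
have := @nln_continuous u _ h; rewrite /= nbhs_simpl /=.
by apply: filterS => v /= hv; apply: hv; exact: nln_Sp.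
Qed.

End ExpCoordinate.

(** * Polynomial approximation on the unit interval *)

Section WeierstrassApproximation.
Variable R : realType.

(** A form of uniform continuity that can be integrated against a variance. On the compact set where
    |g u - g v| >= e the square (u - v)^2 has a positive minimum; K is the maximal oscillation
    divided by it. *)
Lemma continuous_quadratic_modulus (g : R -> R) (e : R) : continuous g -> 0 < e ->
  exists2 K, 0 <= K & forall u v, 0 <= u <= 1 -> 0 <= v <= 1 ->
   `|g u - g v| <= e + K * (u - v) ^+ 2.
Proof.
move=> cg e0.
pose Q : set (R * R) := `[0, 1] `*` `[0, 1].
have Qc : compact Q by apply: compact_setX; exact: segment_compact.
have QP u v : 0 <= u <= 1 -> 0 <= v <= 1 -> Q (u, v) by split; rewrite /= in_itv.
pose H (p : R * R) : R := `|g p.1 - g p.2|.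
have cH : continuous H.
  move=> p; apply: cvg_norm; apply: cvgB.
    by apply: continuous_comp; [exact: cvg_fst|exact: cg].
  by apply: continuous_comp; [exact: cvg_snd|exact: cg].
have [pB _ HB] : exists2 p, p \in Q & forall q, q \in Q -> H q <= H p.
  apply: (compact_EVT_max _ Qc); first by exists (0, 0); apply: QP; rewrite lexx ler01.
  exact: continuous_subspaceT.
pose Q' := Q `&` [set p | e <= H p].
have Q'c : compact Q'.
  apply: (subclosed_compact _ Qc); last by move=> p [].
  apply: closedI; first exact: compact_closed.
  exact: ((continuous_closedP H).1 cH _ (@closed_ge _ e)).
have [[p0 Q'p0]|Q'0] := pselect (Q' !=set0); last first.
  exists 0 => // u v hu hv; rewrite mul0r addr0 leNgt; apply/negP => h.
  by apply: Q'0; exists (u, v); split; [exact: QP|exact: ltW].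
pose S (p : R * R) : R := (p.1 - p.2) ^+ 2.
have cS : continuous S.
  move=> p; rewrite /S; under eq_fun do rewrite expr2.
  by apply: cvgM; apply: cvgB; try exact: cvg_fst; exact: cvg_snd.
have [pm Q'm Hm] : exists2 p, p \in Q' & forall q, q \in Q' -> S p <= S q.
  apply: (compact_EVT_min _ Q'c); first by exists p0.
  exact: continuous_subspaceT.
have Sm0 : 0 < S pm.
  rewrite lt_neqAle sqr_ge0 andbT eq_sym; apply/negP.
  rewrite sqrf_eq0 subr_eq0 => /eqP h; move: Q'm; rewrite inE => -[_ /=].
  by rewrite /H h subrr normr0 leNgt e0.
have HpB0 : 0 <= H pB by exact: normr_ge0.
exists (H pB / S pm); first by rewrite divr_ge0 ?(ltW Sm0).
move=> u v hu hv; have [h|h] := lerP `|g u - g v| e.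
  by apply: (le_trans h); rewrite lerDl mulr_ge0 ?sqr_ge0// divr_ge0 ?(ltW Sm0).
have Q'uv : (u, v) \in Q' by rewrite inE; split; [exact: QP|exact: ltW].
apply: (@le_trans _ _ (H pB)); first by apply: (HB (u, v)); rewrite inE; exact: QP.
rewrite -[leLHS]add0r lerD ?(ltW e0)// -mulrA ler_peMr// mulrC ler_pdivlMr// mul1r.
exact: (Hm _ Q'uv).
Qed.

Lemma iter_seq_dif_exp (u : R) n k : iter n (@seq_dif R) (fun i => u ^+ i) k = u ^+ k * (1 - u) ^+ n.
Proof.
elim: n k => [|n IH] k; first by rewrite mulr1.
by rewrite iterS /seq_dif !IH [u ^+ k.+1]exprS [(1 - u) ^+ n.+1]exprS; ring.
Qed.

(** Bernstein polynomials. The Hausdorff weights of the sequence u^i are the binomial probabilities,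
    so [hweight_moment] bounds their variance. *)
Lemma weierstrass_approx (g : R -> R) (e : R) : continuous g -> 0 < e ->
  exists p : {poly R}, forall u, 0 <= u <= 1 -> `|g u - p.[u]| <= e.
Proof.
move=> cg e0.
have e20 : 0 < e / 2 by lra.
have [K K0 HK] := continuous_quadratic_modulus cg e20.
(* The variance bound is 6 / N: the first moment contributes at most 2 / N and the second 4 / N. *)
have [N N0 HN] : exists2 N : nat, (2 <= N)%N & K * (6 / N%:R) <= e / 2.
  exists (Num.bound (12 * K / e)).+2 => //.
  have h : 12 * K / e <= (Num.bound (12 * K / e)).+2%:R.
    apply: le_trans (ltW (archi_boundP _)) _; first by rewrite divr_ge0 ?mulr_ge0// ltW.
    by rewrite ler_nat leqW.
  rewrite ler_pdivrMr// in h; rewrite mulrA ler_pdivrMr ?ltr0n//; lra.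
pose p : {poly R} := \sum_(k < N.+1) (g (k%:R / N%:R) * 'C(N, k)%:R) *: ('X^k * (1 - 'X) ^+ (N - k)).
exists p => u /andP[u0 u1].
pose b k := hweight (fun i => u ^+ i) N k.
have bE k : b k = 'C(N, k)%:R * (u ^+ k * (1 - u) ^+ (N - k)).
  by rewrite /b /hweight iter_seq_dif_exp.
have b0 k : 0 <= b k by rewrite bE !mulr_ge0 ?exprn_ge0// subr_ge0.
have pE : p.[u] = \sum_(k < N.+1) b k * g (k%:R / N%:R).
  rewrite horner_sum; apply: eq_bigr => k _.
  by rewrite bE hornerZ hornerM hornerXn horner_exp hornerD hornerN hornerX -polyC1 hornerC; ring.
have b1 : \sum_(k < N.+1) b k = 1 by rewrite sum_hweight expr0.
have Np : (0 < N)%N by exact: leq_trans N0.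
have Np' : 0 < N%:R :> R by rewrite ltr0n.
have M1 := @hweight_moment R (fun i => u ^+ i) N 1 Np Np (fun k _ => b0 k).
have M2 := @hweight_moment R (fun i => u ^+ i) N 2 Np N0 (fun k _ => b0 k).
rewrite -[g u]mul1r -b1 mulr_suml pE -sumrB.
apply: (le_trans (ler_norm_sum _ _ _)).
apply: (@le_trans _ _ (\sum_(k < N.+1) b k * (e / 2 + K * (u - k%:R / N%:R) ^+ 2))).
  apply: ler_sum => k _; rewrite -mulrBr normrM ger0_norm// ler_wpM2l//.
  apply: HK; first by rewrite u0.
  by rewrite divr_ge0//= ler_pdivrMr// mul1r ler_nat -ltnS.
have -> : \sum_(k < N.+1) b k * (e / 2 + K * (u - k%:R / N%:R) ^+ 2) =
   e / 2 * (\sum_(k < N.+1) b k) + K * (u ^+ 2 * (\sum_(k < N.+1) b k)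
   - 2 * u * (\sum_(k < N.+1) b k * (k%:R / N%:R) ^+ 1) + \sum_(k < N.+1) b k * (k%:R / N%:R) ^+ 2).
  rewrite !mulr_sumr -sumrB -big_split /= mulr_sumr -big_split /=.
  by apply: eq_bigr => k _; ring.
rewrite b1; move: M1 M2; rewrite -/b !expr1 !expr0 mulr1 !mulr1.
set S1 := \sum_(k < _) _; set S2 := \sum_(k < _) _.
rewrite !ler_norml => /andP[h1 _] /andP[_ h2].
have var : u ^+ 2 - 2 * u * S1 + S2 <= 6 / N%:R.
  have : u * (u - S1) <= 1 * (1 ^+ 2 / N%:R).
    apply: (@le_trans _ _ (u * (1 ^+ 2 / N%:R))); first by rewrite ler_wpM2l//; lra.
    by rewrite ler_wpM2r// divr_ge0// expr1n.
  rewrite expr1n; move: h2; rewrite (_ : 2 ^+ 2 / N%:R = 4 / N%:R); last by rewrite -natrX.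
  lra.
have := ler_wpM2l K0 var; lra.
Qed.

End WeierstrassApproximation.

(** * Laws, their Laplace transforms and measurability *)

Section LaplaceDetermines.
Variable R : realType.
Local Notation Sp := (@Sp R).
Local Notation prob := (probability (\bar R) R).
Implicit Types (mu nu : prob) (theta : R) (f : \bar R -> R).

Definition lap mu theta : R := \int[mu]_(y in Sp) lapf theta y.

Definition on_Sp mu := mu (~` Sp) = 0%E.

Lemma on_Sp1 mu : on_Sp mu -> fine (mu Sp) = 1.
Proof.
move=> h; have mS := measurable_Sp R.
have := probability_setC mu (measurableC mS); rewrite setCK h sube0 => ->//.
Qed.

Lemma bmf_lapf theta : 0 <= theta -> bmf Sp (lapf theta).
Proof.
move=> t0; split; first exact/measurable_funTS/measurable_lapf.
by exists 1 => y Sy; rewrite ger0_norm ?lapf_ge0 ?lapf_le1.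
Qed.

Lemma laplace_relE mu theta : 0 <= theta ->
  (\int[mu]_(y in [set y : \bar R | (0 <= y)%E /\ (y < +oo)%E]) (expR (- theta * fine y))%:E
    = (lap mu theta)%:E)%E.
Proof.
move=> t0; rewrite /lap -bintE; [|exact: measurable_Sp|exact: bmf_lapf].
rewrite integral_mkcond [RHS]integral_mkcond; apply: eq_integral => y _.
rewrite !patchE; case: y => [r| |].
- case: (pselect ((0:R)%:E <= r%:E)%E) => h.
    by rewrite !mem_set//; split => //; exact: ltry.
  by rewrite !memNset// => -[].
- by rewrite memNset ?mem_set//; [exact: leey|case].
- by rewrite !memNset// /Defs.Sp /= => -[].
Qed.

Lemma within_Sp_continuous (phi : R -> R) : continuous phi ->
  phi r @[r --> +oo] --> 0 ->
  {within Sp, continuous (fun y : \bar R => if y is r%:E then phi r else 0)}.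
Proof.
move=> cphi phi0; apply: continuous_in_subspaceT => -[r| |]; rewrite inE /Defs.Sp //= => _.
  move=> P; exact: cphi.
move=> P nP; have := phi0 P nP => -[M [Mr HM]].
exists M; split => // -[r| |] //=; first by rewrite lte_fin; exact: HM.
by move=> _; exact: nbhs_singleton.
Qed.

Lemma lapf_continuous theta : 0 < theta -> {within Sp, continuous (lapf theta)}.
Proof.
move=> t0; apply: within_Sp_continuous.
  move=> r; apply: (@cvg_comp _ _ _ (fun r => - theta * r) (@expR R) _ (nbhs (- theta * r))).
    exact: mulrl_continuous.
  exact: continuous_expR.
apply/cvgrPdist_lt => e e0; near=> r.
rewrite sub0r normrN ger0_norm ?expR_ge0// -[ltRHS]lnK// ltr_expR.
rewrite mulNr ltrNl -ltr_pdivrMl//.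
by near: r; apply: nbhs_pinfty_gt; exact: num_real.
Unshelve. all: by end_near. Qed.

Lemma continuous_on_Sp_bmf f : {within Sp, continuous f} -> bmf Sp f.
Proof.
move=> cf; have cg := Sp_continuous_nln cf.
have fE y : Sp y -> f y = (f \o @nln R) (lapf 1 y) by move=> Sy /=; rewrite nln_lapf.
split.
  apply: (@eq_measurable_fun _ _ _ _ _ ((f \o @nln R) \o lapf 1)).
    by move=> y; rewrite inE => /fE.
  apply: measurable_funTS; apply: measurableT_comp; last exact: measurable_lapf.
  exact: continuous_measurable_fun.
have [c _ Hc] : exists2 c, c \in `[0, 1] & forall t, t \in `[0, 1] ->
    `|(f \o @nln R) t| <= `|(f \o @nln R) c|.
  apply: (@EVT_max R (fun t => `|(f \o @nln R) t|)); first exact: ler01.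
  by apply: continuous_subspaceT => t; apply: cvg_norm; exact: cg.
exists `|(f \o @nln R) c| => y Sy; rewrite fE//; apply: Hc.
by rewrite in_itv /= lapf_ge0 lapf_le1.
Qed.

Lemma Sp_weierstrass f (e : R) : {within Sp, continuous f} -> 0 < e ->
  exists p : {poly R}, forall y, Sp y -> `|f y - p.[lapf 1 y]| <= e.
Proof.
move=> cf e0; have [p Hp] := weierstrass_approx (Sp_continuous_nln cf) e0.
exists p => y Sy; have := Hp (lapf 1 y); rewrite lapf_ge0 lapf_le1//= nln_lapf//.
exact.
Qed.

(** Moments of exp(-y). The zeroth is set to the full mass 1, because [lap mu 0] would omit the atom
    at +oo. *)
Definition moment mu (i : nat) : R := if i is j.+1 then lap mu j.+1%:R else 1.

Lemma bmf_lapf_exp i : bmf Sp (fun y => lapf (1:R) y ^+ i).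
Proof.
elim: i => [|i IH]; first exact: bmf_cst.
by under eq_fun do rewrite exprS; apply: bmfM => //; exact: bmf_lapf.
Qed.

Lemma bmf_poly (p : {poly R}) : bmf Sp (fun y => p.[lapf 1 y]).
Proof.
under eq_fun do rewrite horner_coef.
by apply: bmf_sum => i; apply: bmfZ; exact: bmf_lapf_exp.
Qed.

Lemma int_poly mu (p : {poly R}) : on_Sp mu ->
  \int[mu]_(y in Sp) p.[lapf 1 y] = \sum_(i < size p) p`_i * moment mu i.
Proof.
move=> hmu; have mS := measurable_Sp R.
under eq_Rintegral do rewrite horner_coef.
rewrite bint_sum//; last by move=> i; apply: bmfZ; exact: bmf_lapf_exp.
apply: eq_bigr => i _; rewrite bintZ//; last exact: bmf_lapf_exp.
congr (_ * _); case: (nat_of_ord i) => [|j] /=.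
  by rewrite bint_cst// mul1r on_Sp1.
by apply: eq_Rintegral => y _; rewrite lapf_expn.
Qed.

(** The quantifiers matter: the polynomial is chosen before the law. *)
Lemma int_continuous_approx f (e : R) : {within Sp, continuous f} -> 0 < e ->
  exists p : {poly R}, forall mu, on_Sp mu ->
    `|\int[mu]_(y in Sp) f y - \sum_(i < size p) p`_i * moment mu i| <= e.
Proof.
move=> cf e0; have mS := measurable_Sp R; have [p Hp] := Sp_weierstrass cf e0.
have bf := continuous_on_Sp_bmf cf.
exists p => mu hmu; rewrite -int_poly// -bintB//; last exact: bmf_poly.
rewrite -[leRHS]mulr1 -[X in _ <= _ * X](on_Sp1 hmu) -bint_cst//.
exact: (bint_norm mu mS (bmfB bf (bmf_poly p)) (bmf_cst _ e) Hp).
Qed.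

Lemma int_continuous_eq mu nu f : on_Sp mu -> on_Sp nu ->
  (forall n, lap mu n.+1%:R = lap nu n.+1%:R) -> {within Sp, continuous f} ->
  \int[mu]_(y in Sp) f y = \int[nu]_(y in Sp) f y.
Proof.
move=> hmu hnu mn cf; apply/eqP; rewrite -subr_eq0 -normr_le0; apply/ler_addgt0Pr => e e0.
have [|p Hp] := @int_continuous_approx f (e / 2) cf; first lra.
have := Hp mu hmu; have := Hp nu hnu.
have -> : \sum_(i < size p) p`_i * moment mu i = \sum_(i < size p) p`_i * moment nu i.
  by apply: eq_bigr => i _; congr (_ * _); case: (nat_of_ord i) => //= j; exact: mn.
rewrite !ler_norml add0r => /andP[? ?] /andP[? ?]; apply/andP; split; lra.
Qed.

(** On the state space these increase with m to the indicator of y < a, and they are continuous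
    because they are functions of exp(-y). *)
Definition ramp (a : R) (m : nat) (y : \bar R) : R :=
  Num.min 1 (m%:R * Num.max 0 (lapf 1 y - expR (- a))).

Lemma ramp_continuous a m : {within Sp, continuous (ramp a m)}.
Proof.
have g : continuous (fun u : R => Num.min 1 (m%:R * Num.max 0 (u - expR (- a)))).
  move=> u.
  have c1 : {for u, continuous (fun u => u - expR (- a))}.
    by apply: cvgB; [exact: cvg_id|exact: cvg_cst].
  have c2 : {for u, continuous (fun u => Num.max 0 (u - expR (- a)))}.
    exact: (@continuous_max R R (fun=> 0) _ u (cvg_cst _) c1).
  have c3 : {for u, continuous (fun u => m%:R * Num.max 0 (u - expR (- a)))}.
    by apply: cvgM; [exact: cvg_cst|exact: c2].
  exact: (@continuous_min R R (fun=> 1) _ u (cvg_cst _) c3).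
move=> y; apply: (@cvg_comp _ _ _ (lapf 1) (fun u : R => Num.min 1 (m%:R * Num.max 0 (u - expR (- a)))) _ (nbhs (lapf 1 y))).
  exact: (@lapf_continuous 1 ltr01 y).
exact: g.
Qed.

Lemma ramp01 a m y : 0 <= ramp a m y <= 1.
Proof. by rewrite /ramp ge_min lexx /= andbT le_min ler01 /= mulr_ge0// le_max lexx. Qed.

Lemma lapf_lt_ray (a : R) y : Sp y -> (expR (- a) < lapf 1 y) = (y < a%:E)%E.
Proof.
case: y => [r| |]; rewrite /Defs.Sp //= ?lee_fin => _; last by rewrite ltNge expR_ge0.
by rewrite ltr_expR mulN1r ltrN2 lte_fin.
Qed.

Lemma int_ramp_cvg mu a : on_Sp mu ->
  (\int[mu]_(y in Sp) ramp a m y)%:E @[m --> \oo] --> mu `]-oo, a%:E[%classic.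
Proof.
move=> hmu; have mS := measurable_Sp R.
have mray : measurable (`]-oo, a%:E[%classic : set (\bar R)) by exact: emeasurable_itv.
have bR m : bmf Sp (ramp a m) by exact/continuous_on_Sp_bmf/ramp_continuous.
have [] := @dominated_convergence _ _ _ mu Sp mS (fun m y => (ramp a m y)%:E)
   (fun y => (\1_(`]-oo, a%:E[%classic : set (\bar R)) y)%:E) (cst 1%E).
- by move=> n; apply/measurable_EFinP; case: (bR n).
- by apply/measurable_EFinP; exact: measurable_indic.
- apply: aeW => y Sy; rewrite indicE; have := lapf_lt_ray a Sy; rewrite /ramp.
  have [ya|ya] := ltP y a%:E => e.
    rewrite mem_set; last by rewrite /= in_itv.
    have d0 : 0 < lapf 1 y - expR (- a) by rewrite subr_gt0.
    apply: cvg_near_cst; near=> m.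
    congr EFin; apply/min_idPl; rewrite (max_idPr (ltW d0)) -ler_pdivrMr// mul1r.
    by near: m; exact: nbhs_infty_ger.
  rewrite memNset; last by rewrite /= in_itv /= ltNge ya.
  apply: cvg_near_cst; near=> m.
  congr EFin; rewrite (max_idPl _) ?mulr0 ?(min_idPr _)//.
  by rewrite subr_le0 leNgt e.
- exact: finite_measure_integrable_cst.
- apply: aeW => y n Sy; rewrite /= lee_fin; have /andP[r0 r1] := ramp01 a n y.
  by rewrite ger0_norm.
move=> _ _.
have -> : (\int[mu]_(y in Sp) (\1_(`]-oo, a%:E[%classic : set (\bar R)) y)%:E = mu `]-oo, a%:E[%classic)%E.
  rewrite integral_indic//.
  have mI : measurable ((`]-oo, a%:E[%classic : set (\bar R)) `&` Sp) by exact: measurableI.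
  have mC : measurable (~` Sp) by exact: measurableC.
  apply/eqP; rewrite eq_le; apply/andP; split.
    by apply: le_measure; rewrite ?inE//; exact: subIsetl.
  rewrite -[leRHS]adde0 -[X in (_ <= _ + X)%E]hmu.
  apply: (@le_trans _ _ (mu ((`]-oo, a%:E[%classic `&` Sp) `|` ~` Sp))).
    apply: le_measure; rewrite ?inE//; first exact: measurableU.
    by move=> y hy; have [Sy|nSy] := pselect (Sp y); [left|right].
  exact: measureU2.
apply: cvg_trans; apply: near_eq_cvg; apply: nearW => m /=.
by rewrite bintE.
Unshelve. all: by end_near. Qed.

Lemma rays_setI_closed : setI_closed (@ErealGenInftyO.G R).
Proof.
move=> _ _ [r ->] [s ->]; exists (Num.min r s).
by apply/seteqP; split=> y; rewrite /= !in_itv /= EFin_min lt_min => /andP.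
Qed.

Lemma dynkin_ereal (P : set (set (\bar R))) : P setT ->
  (forall r : R, P `]-oo, r%:E[%classic) ->
  (forall S, measurable S -> P S -> P (~` S)) ->
  (forall F : (set (\bar R))^nat, (forall n, measurable (F n)) -> trivIset setT F ->
    (forall n, P (F n)) -> P (\bigcup_k F k)) ->
  forall B, measurable B -> P B.
Proof.
move=> PT Pray PC PU B mB.
apply: (@dynkin_induction _ (\bar R) (@ErealGenInftyO.G R) P) => //.
- exact: ErealGenInftyO.measurableE.
- exact: rays_setI_closed.
- by move=> _ [r ->].
- by move: mB; rewrite /measurable /= ErealGenInftyO.measurableE.
Qed.

Theorem laplace_unique mu nu : on_Sp mu -> on_Sp nu ->
  (forall n, lap mu n.+1%:R = lap nu n.+1%:R) ->
  forall B, measurable B -> mu B = nu B.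
Proof.
move=> hmu hnu mn; apply: dynkin_ereal.
- by rewrite !probability_setT.
- move=> r; have := @int_ramp_cvg mu r hmu.
  under eq_fun do rewrite (int_continuous_eq hmu hnu mn (@ramp_continuous r _)).
  by move=> h; apply: (cvg_unique _ h (@int_ramp_cvg nu r hnu)).
- by move=> S mS e; rewrite !probability_setC// e.
- move=> F mF tF e; rewrite !measure_bigcup//.
  by apply: eq_eseriesr => i _; exact: e.
Qed.

(** Integrals of continuous functions are limits of combinations of countably many Laplace values;
    ramps lead to open rays, and Dynkin's theorem to Borel sets. *)
Theorem laplace_measurable (D : set (\bar R)) (k : \bar R -> prob) : measurable D ->
  (forall x, D x -> on_Sp (k x)) ->
  (forall n, measurable_fun D (fun x => lap (k x) n.+1%:R)) ->
  forall B, measurable B -> measurable_fun D (fun x => k x B).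
Proof.
move=> mD kS ml.
have mf f : {within Sp, continuous f} -> measurable_fun D (fun x => \int[k x]_(y in Sp) f y).
  move=> cf; have e0 n : 0 < n.+1%:R^-1 :> R by rewrite invr_gt0.
  have {e0}P n := cid (int_continuous_approx cf (e0 n)).
  apply: (@measurable_fun_cvg _ _ _ _ (fun n x => \sum_(i < size (sval (P n))) (sval (P n))`_i * moment (k x) i)).
    move=> n; apply: measurable_sum => i; apply: measurable_funM; first exact: measurable_cst.
    by case: (nat_of_ord i) => [|j] /=; [exact: measurable_cst|exact: ml].
  move=> x Dx; apply/cvgrPdist_le => e e0; near=> n.
  apply: (le_trans (svalP (P n) (k x) (kS _ Dx))); apply: ltW.
  by near: n; exact: near_infty_natSinv_lt (PosNum e0).
apply: dynkin_ereal.
- by under eq_fun do rewrite probability_setT; exact: measurable_cst.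
- move=> r; apply: (@emeasurable_fun_cvg _ _ _ _ (fun m x => (\int[k x]_(y in Sp) ramp r m y)%:E)).
    by move=> m; apply/measurable_EFinP/mf/ramp_continuous.
  by move=> x Dx; exact: (@int_ramp_cvg (k x) r (kS _ Dx)).
- move=> S mS mk; under eq_fun do rewrite probability_setC//.
  by apply: emeasurable_funB => //; exact: measurable_cst.
- move=> F mF tF mk.
  apply: (@eq_measurable_fun _ _ _ _ _ (fun x => \sum_(0 <= i <oo | i \in setT) k x (F i))%E).
    by move=> x _; rewrite measure_bigcup.
  exact: ge0_emeasurable_sum.
Unshelve. all: by end_near. Qed.

End LaplaceDetermines.

(** * From evolution families to branching kernels *)

Section CompletelyMonotone.
Variable R : realType.
Implicit Types (f g phi psi : R -> R) (n : nat).

(* [CM n phi] : the signs (-1)^k phi^(k) >= 0 on (0,+oo) for k <= n, phrased through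
   successive negated derivatives so that it is stable under products by induction. *)
Fixpoint CM n phi : Prop := (forall x : R, 0 < x -> 0 <= phi x) /\
  if n is m.+1 then exists psi, (forall x : R, 0 < x -> is_derive x 1 phi (- psi x)) /\ CM m psi
  else True.

Lemma CM_ge0 n phi : CM n phi -> forall x, 0 < x -> 0 <= phi x.
Proof. by case: n => [|n] []. Qed.

Lemma CM_pred n phi : CM n.+1 phi -> CM n phi.
Proof.
elim: n phi => [|n IH] phi [p0 [psi [dpsi cpsi]]]; first by [].
by split=> //; exists psi; split => //; exact: IH.
Qed.

Lemma CMD n phi psi : CM n phi -> CM n psi -> CM n (fun x => phi x + psi x).
Proof.
elim: n phi psi => [|n IH] phi psi.
  by move=> [a _] [b _]; split => // x x0; rewrite addr_ge0 ?a ?b.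
move=> [a [phi' [dphi cphi]]] [b [psi' [dpsi cpsi]]]; split.
  by move=> x x0; rewrite addr_ge0 ?a ?b.
exists (fun x => phi' x + psi' x); split; last exact: IH.
by move=> x x0; rewrite opprD; apply: is_deriveD; [exact: dphi|exact: dpsi].
Qed.

Lemma CMM n phi psi : CM n phi -> CM n psi -> CM n (fun x => phi x * psi x).
Proof.
elim: n phi psi => [|n IH] phi psi.
  by move=> [a _] [b _]; split => // x x0; rewrite mulr_ge0 ?a ?b.
move=> /[dup] /CM_pred cp [a [phi' [dphi cphi]]] /[dup] /CM_pred cq [b [psi' [dpsi cpsi]]]; split.
  by move=> x x0; rewrite mulr_ge0 ?a ?b.
exists (fun x => phi x * psi' x + psi x * phi' x); split; last by apply: CMD; exact: IH.
move=> x x0; have h1 := dphi x x0; have h2 := dpsi x x0.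
apply: is_derive_eq; rewrite /GRing.scale /=; ring.
Qed.

Lemma CM_cst n (c : R) : 0 <= c -> CM n (fun=> c).
Proof.
elim: n c => [|n IH] c c0; split => //.
exists (fun=> 0); split; last exact: IH.
by move=> x _; rewrite oppr0; exact: is_derive_cst.
Qed.

Lemma CM_noninc n phi x y : CM n.+1 phi -> 0 < x -> x <= y -> phi y <= phi x.
Proof.
move=> [p0 [psi [dpsi /CM_ge0 cpsi]]] x0 xy.
have dphi z : z \in `]x, y[ -> is_derive z 1 phi (- psi z).
  by rewrite in_itv /= => /andP[xz _]; apply: dpsi; exact: lt_trans xz.
have [|c] := MVT_segment xy dphi.
  apply: derivable_within_continuous => z; rewrite in_itv /= => /andP[xz _].
  by have := dpsi z (lt_le_trans x0 xz) => /@ex_derive.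
rewrite in_itv /= => /andP[xc _] e.
have : 0 <= psi c by apply: cpsi; exact: lt_le_trans xc.
by move=> h; rewrite -subr_le0 e mulNr oppr_le0 mulr_ge0// subr_ge0.
Qed.

Lemma is_derive_fun_dif f (x h a b : R) : is_derive x 1 f a -> is_derive (x + h) 1 f b ->
  is_derive x 1 (fun_dif h f) (a - b).
Proof.
move=> da db; apply: is_deriveB.
have d1 : is_derive x 1 (fun x => x + h) (1 : R).
  by rewrite -[X in is_derive _ _ _ X]addr0; apply: is_deriveD.
by have := @is_derive1_comp R f (fun x => x + h) x _ _ db d1; rewrite mulr1; exact.
Qed.

(** A difference loses one order: its sign comes from monotonicity, and differencing commutes with
    differentiation. *)
Lemma CM_fun_dif n phi (h : R) : 0 < h -> CM n.+1 phi -> CM n (fun_dif h phi).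
Proof.
move=> h0; elim: n phi => [|n IH] phi cphi; (split; first by move=> x x0;
  rewrite /fun_dif subr_ge0; apply: (CM_noninc cphi) => //; rewrite lerDl ltW) => //.
case: cphi => p0 [psi [dpsi cpsi]].
exists (fun_dif h psi); split; last exact: IH.
move=> x x0; rewrite /fun_dif (_ : - (psi x - psi (x + h)) = - psi x - - psi (x + h)); last by ring.
by apply: is_derive_fun_dif; apply: dpsi; rewrite ?addr_gt0.
Qed.

Lemma CM_iter_fun_dif n phi (h : R) : 0 < h -> CM n phi ->
  forall x, 0 < x -> 0 <= iter n (fun_dif h) phi x.
Proof.
move=> h0; elim: n phi => [|n IH] phi; first exact: CM_ge0.
by move=> /(CM_fun_dif h0) /IH H x x0; rewrite iterSr; exact: H.
Qed.

Lemma Bernstein_CM f n (k : nat) : Bernstein f -> CM n (fun x => (-1) ^+ k * derive1n k.+1 f x).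
Proof.
move=> [df [f0 sf]]; elim: n k => [|n IH] k; split; try by move=> x; exact: sf.
  by [].
exists (fun x => (-1) ^+ k.+1 * derive1n k.+2 f x); split; last exact: IH.
move=> x x0; rewrite exprS mulN1r mulNr opprK.
have d : is_derive x 1 (derive1n k.+1 f) (derive1n k.+2 f x).
  by apply: DeriveDef; [exact: df|rewrite [in RHS]derive1nS derive1E].
exact: (is_deriveZ ((-1) ^+ k)).
Qed.

Lemma Bernstein_is_derive f (x : R) : Bernstein f -> 0 < x -> is_derive x 1 f (derive1n 1 f x).
Proof. by move=> [df _] x0; apply: DeriveDef; [exact: (df 0%N)|rewrite [in RHS]derive1nS derive1E]. Qed.

(** The negated derivative is c f' exp(-c f): here f' is handled by [Bernstein_CM] and the
    exponential has one order less, so stability under products closes the induction. *)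
Lemma Bernstein_expR_CM f n (c : R) : 0 <= c -> Bernstein f -> CM n (fun x => expR (- c * f x)).
Proof.
move=> c0 Bf; have P x : 0 < x -> 0 <= expR (- c * f x) by rewrite expR_ge0.
elim: n => [//|n IH]; split => //.
exists (fun x => c * ((-1) ^+ 0 * derive1n 1 f x) * expR (- c * f x)); split; last first.
  by apply: CMM => //; apply: CMM; [exact: CM_cst|exact: Bernstein_CM].
move=> x x0; have d := Bernstein_is_derive Bf x0.
have d1 : is_derive x 1 (fun x => - c * f x) (- c * derive1n 1 f x) by exact: (is_deriveZ (- c)).
have := @is_derive1_comp R (@expR R) (fun x => - c * f x) x _ _ (is_derive_expR (- c * f x)) d1.
by rewrite mulrC expr0 mul1r !mulNr; exact.
Qed.

End CompletelyMonotone.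

(** * Mixtures and convolutions of laws on [0,+oo] *)

Section Mixtures.
Variable R : realType.
Local Notation Sp := (@Sp R).
Local Notation prob := (probability (\bar R) R).
Implicit Types (mu nu : prob) (theta : R).

Lemma on_Sp_integral mu (f : \bar R -> \bar R) : on_Sp mu -> measurable_fun setT f ->
  (forall y, (0 <= f y)%E) -> (\int[mu]_y f y = \int[mu]_(y in Sp) f y)%E.
Proof.
move=> hmu mf f0; have mS := measurable_Sp R; have mC := measurableC mS.
rewrite -(setUv Sp) ge0_integral_setU//; last 2 first.
- by rewrite setUv.
- exact/disj_setPCl.
by rewrite [X in (_ + X)%E]null_set_integral ?adde0//; exact: measurable_funTS.
Qed.

Lemma lapf_patch_ge0 theta y : (0 <= ((EFin \o lapf theta) \_ Sp) y)%E.
Proof. by rewrite patchE; case: ifP => // _; rewrite lee_fin lapf_ge0. Qed.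

Lemma measurable_lapf_patch theta : measurable_fun setT ((EFin \o lapf theta) \_ Sp).
Proof.
apply/(measurable_restrictT _ (measurable_Sp R)); apply: measurable_funTS.
by apply/measurable_EFinP; exact: measurable_lapf.
Qed.

Lemma lapE mu theta : 0 <= theta ->
  (lap mu theta)%:E = (\int[mu]_y ((EFin \o lapf theta) \_ Sp) y)%E.
Proof.
by move=> t0; rewrite -integral_mkcond -bintE//; [exact: measurable_Sp|exact: bmf_lapf].
Qed.

Section Mixture.
Variables (mu : prob) (l : \bar R -> prob).
Hypothesis hmu : on_Sp mu.
Hypothesis ml : forall B, measurable B -> measurable_fun Sp (l^~ B).
Hypothesis hl : forall y, Sp y -> on_Sp (l y).

(** The Giry bind expects a kernel on all of [\bar R]; off the state space any law will do, since
    [mu] has no mass there. *)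
Let l' (y : \bar R) : prob := if (0 <= y)%E then l y else \d_0%E.

Let l'E y : Sp y -> l' y = l y. Proof. by rewrite /Defs.Sp /l' => /= ->. Qed.

Let ml'B B : measurable B -> measurable_fun setT (fun y => l' y B).
Proof.
move=> mB; have mS := measurable_Sp R; rewrite -(setUv Sp).
apply/measurable_funU => //; first exact: measurableC.
split.
  by apply: eq_measurable_fun (ml mB) => y; rewrite inE => /l'E ->.
apply: (@eq_measurable_fun _ _ _ _ _ (cst (\d_0%E B))); last exact: measurable_cst.
by move=> y; rewrite inE /l' /= /Defs.Sp /= => /negP/negbTE ->.
Qed.

Let lg (y : \bar R) : giry (\bar R) R := l' y.

Let mlg : measurable_fun setT lg.
Proof. by apply: measurable_giry_codensity => // B mB; exact: ml'B. Qed.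

Let mix := giry_bind mu mlg.

Let mix_int (h : \bar R -> \bar R) : measurable_fun setT h -> (forall y, (0 <= h y)%E) ->
  (\int[mix]_y h y = \int[mu]_(y in Sp) \int[l y]_z h z)%E.
Proof.
move=> mh h0; have := giry_int_bind mu mlg mh h0; rewrite /giry_int => ->.
rewrite on_Sp_integral//.
- by apply: eq_integral => y; rewrite inE => /l'E e; rewrite /lg e.
- have := measurableT_comp (measurable_giry_int mh h0) mlg; exact.
- by move=> y; exact: integral_ge0.
Qed.

Let mixE B : measurable B -> mix B = (\int[mu]_(y in Sp) l y B)%E.
Proof.
move=> mB; have := @mix_int (EFin \o \1_B).
rewrite integral_indic// setIT => -> //.
- by apply: eq_integral => y _; rewrite integral_indic// setIT.
- by apply/measurable_EFinP; exact: measurable_indic.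
- by move=> y; rewrite lee_fin.
Qed.

Let mixT : mix setT = 1%E.
Proof.
rewrite mixE//; under eq_integral do rewrite probability_setT.
have mS := measurable_Sp R.
rewrite integral_cst// mul1e.
have e : mu Sp = (fine (mu Sp))%:E by rewrite fineK// fin_num_measure.
by rewrite [LHS]e on_Sp1.
Qed.

Let mixP : prob := HB.pack (SubProbability.sort mix)
  (@Measure_isProbability.Build _ _ R mix mixT).

(** [kcomp] is only a set function. Realising it as a probability gives it a Laplace transform and
    brings it within reach of [laplace_unique]. *)
Lemma mixture_exists : exists m : prob, [/\ on_Sp m,
  forall B, measurable B -> m B = (\int[mu]_(y in Sp) l y B)%E &
  forall theta, 0 <= theta -> lap m theta = \int[mu]_(y in Sp) lap (l y) theta].
Proof.
have mS := measurable_Sp R.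
exists mixP; split.
- rewrite /on_Sp [LHS]mixE; last exact: measurableC.
  by apply: integral0_eq => y /hl.
- exact: mixE.
- move=> theta t0; apply: EFin_inj; rewrite lapE// [LHS]mix_int; last 2 first.
  + exact: measurable_lapf_patch.
  + exact: lapf_patch_ge0.
  rewrite -bintE//.
    by apply: eq_integral => y _; rewrite lapE.
  split; last first.
    exists 1 => y Sy; rewrite ger0_norm; last by apply: Rintegral_ge0 => z _; exact: lapf_ge0.
    rewrite -[leRHS]mul1r -[X in _ <= _ * X](on_Sp1 (hl Sy)) -bint_cst//.
    apply: bint_le => //; [exact: bmf_lapf|exact: bmf_cst|].
    by move=> z Sz; exact: lapf_le1.
  have mg := measurableT_comp (measurable_giry_int (measurable_lapf_patch theta) (@lapf_patch_ge0 theta)) mlg.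
  apply: (@eq_measurable_fun _ _ _ _ _ (fine \o (giry_int ^~ ((EFin \o lapf theta) \_ Sp) \o lg))).
    by move=> y; rewrite inE => /l'E e; rewrite /= /giry_int /lg e -lapE.
  apply: measurable_funTS; apply: measurableT_comp mg.
  exact: fine_measurable.
Qed.

End Mixture.

Section Convolution.
Variables (mu nu : prob).
Hypotheses (hmu : on_Sp mu) (hnu : on_Sp nu).

Let measurable_shift (a : \bar R) : measurable_fun setT (fun b : \bar R => (a + b)%E).
Proof. by apply: emeasurable_funD; [exact: measurable_cst|exact: measurable_id]. Qed.

Let shift_mfun (a : \bar R) : {mfun (\bar R) >-> (\bar R)} := HB.pack (fun b : \bar R => (a + b)%E)
  (@isMeasurableFun.Build _ _ (\bar R) (\bar R) _ (measurable_shift a)).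

Let l (a : \bar R) : prob := distribution nu (shift_mfun a).

Let lE a B : l a B = nu [set b | B (a + b)%E]. Proof. by []. Qed.

Let ml B : measurable B -> measurable_fun setT (l^~ B).
Proof.
move=> mB; pose A : set (\bar R * \bar R) := (fun p => (p.1 + p.2)%E) @^-1` B.
have mA : measurable A.
  have mD : measurable_fun setT (fun p : \bar R * \bar R => (p.1 + p.2)%E).
    by apply: emeasurable_funD; [exact: measurable_fst|exact: measurable_snd].
  by rewrite -[A]setTI; exact: mD.
have := measurable_fun_xsection nu mA.
apply: eq_measurable_fun => a _; rewrite lE /=; congr (nu _).
by apply/seteqP; split=> b; rewrite /xsection /= inE.
Qed.

Let hl a : Sp a -> on_Sp (l a).
Proof.
move=> Sa; rewrite /on_Sp lE; apply/eqP; rewrite eq_le measure_ge0 andbT -[leRHS]hnu.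
apply: le_measure; rewrite ?inE.
- rewrite -[X in measurable X]setTI; apply: measurable_shift => //.
  exact/measurableC/measurable_Sp.
- exact/measurableC/measurable_Sp.
- by move=> b /=; apply: contra_not => Sb; exact: adde_ge0.
Qed.

Let lap_l a theta : 0 < theta -> Sp a -> lap (l a) theta = lapf theta a * lap nu theta.
Proof.
move=> t0 Sa; have t0' := ltW t0; apply: EFin_inj; rewrite lapE//.
rewrite ge0_integral_distribution; last 2 first.
- exact: measurable_lapf_patch.
- exact: lapf_patch_ge0.
rewrite on_Sp_integral//; last 2 first.
- by apply: measurableT_comp; [exact: measurable_lapf_patch|exact: measurable_shift].
- by move=> y; exact: lapf_patch_ge0.
have mS := measurable_Sp R; have bl := bmf_lapf t0'.
rewrite /lap -bintZ// -bintE//; last exact: bmfZ.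
apply: eq_integral => b; rewrite inE => Sb.
rewrite /= patchE mem_set; last exact: adde_ge0.
congr EFin; case: a Sa => [r| |] //; case: b Sb => [s| |] //= _ _; rewrite ?mulr0 ?mul0r//.
by rewrite mulrDr expRD.
Qed.

(** A convolution is the mixture over [mu] of the translates of [nu]. *)
Lemma convolution_exists : exists m : prob, [/\ on_Sp m,
  forall B, measurable B -> m B = Defs.conv mu nu B &
  forall theta, 0 < theta -> lap m theta = lap mu theta * lap nu theta].
Proof.
have mS := measurable_Sp R.
have [m [h1 h2 h3]] := @mixture_exists mu l hmu (fun B mB => measurable_funTS (ml mB)) hl.
exists m; split => //.
  move=> B mB; rewrite h2// /Defs.conv on_Sp_integral//; exact: ml.
move=> theta t0; rewrite h3 ?ltW//.
transitivity (\int[mu]_(y in Sp) (lap nu theta * lapf theta y)).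
  by apply: eq_Rintegral => y; rewrite inE => Sy; rewrite lap_l// mulrC.
rewrite (bintZ mu mS _ (bmf_lapf (ltW t0))) mulrC; exact: erefl.
Qed.

End Convolution.

Lemma lap_dirac (x : \bar R) theta : Sp x -> 0 <= theta ->
  lap (\d_x : prob) theta = lapf theta x.
Proof.
move=> Sx t0; apply: EFin_inj; rewrite lapE// integral_dirac//; last exact: measurable_lapf_patch.
by rewrite diracT mul1e patchE mem_set.
Qed.

Lemma dirac_on_Sp (x : \bar R) : Sp x -> on_Sp (\d_x : prob).
Proof. by move=> Sx; rewrite /on_Sp /= diracE memNset//; apply. Qed.

End Mixtures.

(** * The branching axioms for kernels with given exponents *)

Section BranchingKernels.
Variable R : realType.
Local Notation Sp := (@Sp R).
Local Notation prob := (probability (\bar R) R).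
Local Notation C := R[i].
Variable v : R -> R -> C -> C.
Hypothesis hv : top_rev_evol_family_H v.
Hypothesis hBF : forall s t, Delta s t -> inBF (v s t).

Let V s t (theta : R) : R := complex.Re (v s t theta%:C%C).

Let VE s t theta : Delta s t -> 0 < theta -> v s t theta%:C%C = (V s t theta)%:C%C.
Proof. by move=> /hBF [_ [f [_ [_ H]]]] t0; rewrite /V H. Qed.

Let V_gt0 s t theta : Delta s t -> 0 < theta -> 0 < V s t theta.
Proof. by move=> /hBF [[_ H] _] t0; exact: H. Qed.

Let V_id s theta : 0 <= s -> 0 < theta -> V s s theta = theta.
Proof. by move=> s0 t0; rewrite /V (hv.2.1 s s0). Qed.

Let V_comp s t u theta : 0 <= s -> s <= t -> t <= u -> 0 < theta ->
  V s u theta = V s t (V t u theta).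
Proof.
move=> s0 st tu t0; rewrite /V (hv.2.2.1 s t u s0 st tu)// VE//.
by split => //; exact: le_trans st.
Qed.

Let V_cont s0 t0 theta : Delta s0 t0 -> 0 < theta -> forall e : R, 0 < e ->
  exists2 d : R, 0 < d & forall s t, Delta s t -> `|s - s0| < d -> `|t - t0| < d ->
    `|V s t theta - V s0 t0 theta| < e.
Proof.
move=> D0 th0 e e0; have e20 : 0 < e / 2 by lra.
have Kc : compact [set (theta%:C%C : C^o)] by exact: compact_set1.
have [|d d0 H] := hv.2.2.2 s0 t0 D0 _ Kc _ (e / 2) e20; first by move=> _ ->.
exists d => // s t Dst hs ht; have := H s t Dst hs ht _ erefl => /cn_normC_lt.
rewrite /cn !RIE => h; have := normr_ge0 (complex.Im (v s t theta%:C%C) - complex.Im (v s0 t0 theta%:C%C)).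
rewrite -/(V s t theta) -/(V s0 t0 theta) in h; lra.
Qed.

(** The conditions stand inside the existential so that choice yields a total family. The law at +oo
    is the Dirac mass; at finite y the transform exp(-y f) is completely monotone. *)
Lemma kernel_law_exists s t y : exists mu : prob, Delta s t -> Sp y ->
  on_Sp mu /\ forall theta, 0 < theta -> lap mu theta = lapf (V s t theta) y.
Proof.
have [[Dst Sy]|H] := pselect (Delta s t /\ Sp y); last first.
  by exists (\d_(0%E) : prob) => D Sy; exfalso; apply: H.
case: y Sy => [r| |] Sy //; last first.
  exists (\d_(+oo%E) : prob) => _ _; split; first exact: dirac_on_Sp.
  by move=> theta t0; rewrite lap_dirac// ltW.
have r0 : 0 <= r by move: Sy; rewrite /Defs.Sp /= lee_fin.
have [_ [f [Bf [_ fE]]]] := hBF Dst.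
have Vf theta : 0 < theta -> V s t theta = f theta by move=> t0; rewrite /V fE.
pose phi x := expR (- r * f x).
have CMphi n : CM n phi by exact: Bernstein_expR_CM.
have [mu [hmu lmu]] : exists mu : prob, mu (~` Sp) = 0%E /\ forall theta, 0 < theta ->
  (\int[mu]_(y in [set y : \bar R | (0 <= y)%E /\ (y < +oo)%E]) (expR (- theta * fine y))%:E
    = (phi theta)%:E)%E.
  apply: bernstein_widder.
  - by move=> n h x h0; apply: CM_iter_fun_dif.
  - move=> x x0; rewrite -expR0 ler_expR mulNr oppr_le0 mulr_ge0//.
    by have [_ [f0 _]] := Bf; exact: f0.
  - move=> x x0; have [_ [psi [dpsi _]]] := CMphi 1%N.
    by apply/differentiable_continuous/derivable1_diffP; have := dpsi x x0 => /@ex_derive.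
exists mu => _ _; split => // theta t0.
have := lmu theta t0; rewrite laplace_relE ?ltW// => -[->].
by rewrite /phi Vf//= mulNr mulrC -mulNr.
Qed.

Variable k : R -> R -> \bar R -> prob.
Hypothesis kS : forall s t y, Delta s t -> Sp y -> on_Sp (k s t y).
(** Written with [lapf], the relation includes y = +oo, where both sides are 0. *)
Hypothesis kL : forall s t y theta, Delta s t -> Sp y -> 0 < theta ->
  lap (k s t y) theta = lapf (V s t theta) y.

Let k_unique s t y (mu : prob) : Delta s t -> Sp y -> on_Sp mu ->
  (forall theta, 0 < theta -> lapf (V s t theta) y = lap mu theta) ->
  forall B, measurable B -> k s t y B = mu B.
Proof.
move=> D Sy hmu H; apply: laplace_unique => //; first exact: kS.
by move=> n; rewrite kL// H.
Qed.

Let k_measurable s t : Delta s t -> forall B, measurable B -> measurable_fun Sp (fun x => k s t x B).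
Proof.
move=> D; apply: laplace_measurable.
- exact: measurable_Sp.
- by move=> x; exact: kS.
- move=> n; apply: (@eq_measurable_fun _ _ _ _ _ (lapf (V s t n.+1%:R))).
    by move=> x; rewrite inE => Sx; rewrite kL.
  by apply: measurable_funTS; exact: measurable_lapf.
Qed.

Let k_continuous (f : \bar R -> R) : {within Sp, continuous f} ->
  {within [set p : R * R * R | Delta p.1.1 p.1.2 /\ 0 <= p.2],
    continuous (fun p => Rintegral (k p.1.1 p.1.2 (p.2)%:E) Sp (fun y => f y))}.
Proof.
move=> cf; set A := [set p : R * R * R | _].
(* The moments of the kernels are explicit and jointly continuous in (s, t, x); a fixed polynomial
   in them follows every integral of f up to e / 4. *)
pose mom i (p : R * R * R) : R := if i is j.+1 then expR (- V p.1.1 p.1.2 j.+1%:R * p.2) else 1.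
have momE i p : A p -> moment (k p.1.1 p.1.2 (p.2)%:E) i = mom i p.
  by case: i => [//|j] [D p20] /=; rewrite kL// /Defs.Sp /= lee_fin.
have cp2 : {within A, continuous (fun p : R * R * R => p.2)}.
  by apply: continuous_subspaceT => p; exact: cvg_snd.
have cmom i : {within A, continuous (mom i)}.
  case: i => [|j]; first by move=> p; exact: cvg_cst.
  have cV : {within A, continuous (fun p => V p.1.1 p.1.2 j.+1%:R)}.
    apply/within_epsP => p0 [D0 _] e e0; have [//|d d0 H] := V_cont D0 _ e0 (theta := j.+1%:R).
    by exists d => // p [D _] h1 h2 _; exact: H.
  exact: (fun_cont_expR (fun_contM (fun_contN cV) cp2)).
apply/within_epsP => p0 Ap0 e e0.
have e40 : 0 < e / 4 by lra.
have [q Hq] := int_continuous_approx cf e40.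
pose Q p := \sum_(i < size q) q`_i * mom i p.
have cQ : {within A, continuous Q}.
  apply: fun_cont_sum => i; apply: fun_contM; [by move=> p; exact: cvg_cst|exact: cmom].
have QE p : A p -> `|Rintegral (k p.1.1 p.1.2 (p.2)%:E) Sp f - Q p| <= e / 4.
  move=> Ap; have Sp2 : Sp (p.2)%:E by case: Ap => _; rewrite /Defs.Sp /= lee_fin.
  have := Hq _ (kS Ap.1 Sp2).
  by rewrite (eq_bigr (fun i : 'I_(size q) => q`_i * mom i p))// => i _; rewrite momE.
have [d d0 H] := (within_epsP A Q).1 cQ p0 Ap0 (e / 4) e40.
exists d => // p Ap h1 h2 h3; have := H p Ap h1 h2 h3; have := QE p Ap; have := QE p0 Ap0.
rewrite !ler_norml !ltr_norml => /andP[? ?] /andP[? ?] /andP[? ?]; apply/andP; split; lra.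
Qed.

Lemma branching_kernels : BP_kernel_family k /\
  (forall s t, Delta s t -> laplace_rel (k s t) (v s t)).
Proof.
have S_fin (x : R) : 0 <= x -> Sp x%:E by rewrite /Defs.Sp /= lee_fin.
split; last first.
  move=> s t D x theta x0 t0; split; first by rewrite VE.
  rewrite laplace_relE ?ltW// kL//; last exact/S_fin/ltW.
  by rewrite /= mulNr mulrC -mulNr.
split; [|split; [|split; [|split; [|split; [|split]]]]].
- move=> s t D; split; first by move=> x; exact: kS.
  exact: k_measurable.
- move=> s x s0 Sx; apply: (@k_unique s s x (\d_x)) => //; first exact: dirac_on_Sp.
  by move=> theta t0; rewrite V_id// lap_dirac// ltW.
- move=> s t u s0 st tu x Sx B mB; have D1 : Delta s t by [].
  have D2 : Delta t u by split => //; exact: le_trans st.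
  have D3 : Delta s u by split => //; exact: le_trans tu.
  have [m [hm mE lm]] := @mixture_exists R (k s t x) (k t u) (kS D1 Sx) (k_measurable D2)
    (fun y => @kS t u y D2).
  rewrite /Defs.kcomp -mE//; apply/esym; apply: k_unique => // theta t0.
  (* Integrating exp(-y V t u theta) against the law k s t x evaluates the transform of that law at
     the positive point V t u theta. *)
  rewrite lm ?ltW// (V_comp s0 st tu t0) -(kL D1 Sx (V_gt0 D2 t0)).
  by apply: eq_Rintegral => y; rewrite inE => Sy; rewrite kL.
- exact: k_continuous.
- move=> s t x y D x0 y0 B mB.
  have [m [hm mE lm]] := convolution_exists (kS D (S_fin _ x0)) (kS D (S_fin _ y0)).
  rewrite -mE//; apply/esym; apply: k_unique => //; first by apply: S_fin; exact: addr_ge0.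
  by move=> theta t0; rewrite lm// !kL ?S_fin//= mulrDr expRD.
- move=> s t D; have S0 : Sp 0%E by exact: S_fin.
  apply: (@k_unique s t 0%E (\d_0%E)) => //; first exact: dirac_on_Sp.
  by move=> theta t0; rewrite lap_dirac ?ltW//= !mulr0.
- move=> s t D; have Sy : Sp +oo%E by rewrite /Defs.Sp /=; exact: leey.
  apply: (@k_unique s t +oo%E (\d_+oo%E)) => //; first exact: dirac_on_Sp.
  by move=> theta t0; rewrite lap_dirac ?ltW.
Qed.

End BranchingKernels.

Section PartTwo.
Variable R : realType.

Theorem branching_kernels_exist (v : R -> R -> R[i] -> R[i]) : top_rev_evol_family_H v ->
  (forall s t, Delta s t -> inBF (v s t)) ->
  exists k : R -> R -> \bar R -> probability (\bar R) R,
    BP_kernel_family k /\ (forall s t, Delta s t -> laplace_rel (k s t) (v s t)).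
Proof.
move=> hv hBF.
have [k hk] := choice (fun p : R * R * \bar R => kernel_law_exists hBF p.1.1 p.1.2 p.2).
exists (fun s t y => k (s, t, y)); apply: branching_kernels => //.
  by move=> s t y D Sy; have [] := hk (s, t, y) D Sy.
by move=> s t y theta D Sy t0; have [_] := hk (s, t, y) D Sy; exact.
Qed.

Theorem branching_kernels_unique (v : R -> R -> R[i] -> R[i])
    (k1 k2 : R -> R -> \bar R -> probability (\bar R) R) :
  BP_kernel_family k1 -> (forall s t, Delta s t -> laplace_rel (k1 s t) (v s t)) ->
  BP_kernel_family k2 -> (forall s t, Delta s t -> laplace_rel (k2 s t) (v s t)) ->
  forall s t x (B : set (\bar R)), Delta s t -> Sp x -> measurable B ->
    k1 s t x B = k2 s t x B.
Proof.
move=> [c1 [_ [_ [_ [_ [z1 i1]]]]]] L1 [c2 [_ [_ [_ [_ [z2 i2]]]]]] L2 s t x B D Sx mB.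
have [h1 _] := c1 s t D; have [h2 _] := c2 s t D.
(* The Laplace relation concerns 0 < x < +oo; the endpoints are settled by the axioms on 0 and
   +oo. *)
case: x Sx => [r| |] Sx //; last by rewrite i1// i2.
have r0 : 0 <= r by move: Sx; rewrite /Defs.Sp /= lee_fin.
move: r0; rewrite le_eqVlt => /orP[/eqP r0|r0]; first by rewrite -r0 z1// z2.
apply: laplace_unique mB; [exact: h1|exact: h2|] => n.
have n0 : 0 < n.+1%:R :> R by [].
have [_ e1] := L1 s t D r n.+1%:R r0 n0; have [_ e2] := L2 s t D r n.+1%:R r0 n0.
by apply: EFin_inj; rewrite -!laplace_relE ?ler0n// e1 e2.
Qed.

End PartTwo.

(** * From branching kernels to evolution families *)

Section ComplexLaplace.
Variable R : realType.
Local Notation Sp := (@Sp R).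
Local Notation prob := (probability (\bar R) R).
Local Notation C := R[i].
Local Notation Re := complex.Re.
Local Notation Im := complex.Im.
Implicit Types (mu : prob) (z w h : C) (F G : \bar R -> C) (y : \bar R).

Definition cint mu F : C := ((\int[mu]_(y in Sp) Re (F y)) +i* (\int[mu]_(y in Sp) Im (F y)))%C.

Definition bcf F := bmf Sp (fun y => Re (F y)) /\ bmf Sp (fun y => Im (F y)).

Let mS := measurable_Sp R.

Lemma bcfD F G : bcf F -> bcf G -> bcf (fun y => F y + G y).
Proof.
move=> [f1 f2] [g1 g2]; split.
  by under eq_fun do rewrite cReD; exact: bmfD.
by under eq_fun do rewrite cImD; exact: bmfD.
Qed.

Lemma bcfZ c F : bcf F -> bcf (fun y => c * F y).
Proof.
move=> [f1 f2]; split.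
  by under eq_fun do rewrite cReM; apply: bmfB; exact: bmfZ.
by under eq_fun do rewrite cImM; apply: bmfD; exact: bmfZ.
Qed.

Lemma bcf_cst c : bcf (fun=> c).
Proof. by split; exact: bmf_cst. Qed.

Lemma bcfB F G : bcf F -> bcf G -> bcf (fun y => F y - G y).
Proof. by move=> hF /(bcfZ (-1)); under eq_fun do rewrite mulN1r; exact: bcfD. Qed.

Lemma cintD mu F G : bcf F -> bcf G -> cint mu (fun y => F y + G y) = cint mu F + cint mu G.
Proof.
move=> [f1 f2] [g1 g2]; apply: complexP; rewrite /cint /=.
  by under eq_Rintegral do rewrite cReD; rewrite bintD.
by under eq_Rintegral do rewrite cImD; rewrite bintD.
Qed.

Lemma cintZ mu c F : bcf F -> cint mu (fun y => c * F y) = c * cint mu F.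
Proof.
move=> [f1 f2]; apply: complexP; rewrite /cint ?RIE /=.
  by under eq_Rintegral do rewrite cReM; rewrite bintB ?bintZ//; exact: bmfZ.
by under eq_Rintegral do rewrite cImM; rewrite bintD ?bintZ//; exact: bmfZ.
Qed.

Lemma cintB mu F G : bcf F -> bcf G -> cint mu (fun y => F y - G y) = cint mu F - cint mu G.
Proof.
move=> hF hG; rewrite -[cint mu G]mul1r -mulNr -cintZ// -cintD//; last exact: bcfZ.
by congr cint; apply/funext => y; rewrite mulN1r.
Qed.

Lemma cint_cst mu c : on_Sp mu -> cint mu (fun=> c) = c.
Proof. by move=> hmu; apply: complexP; rewrite /cint /= bint_cst// on_Sp1// mulr1. Qed.

Lemma cint_norm mu F g : bcf F -> bmf Sp g -> (forall y, Sp y -> cn (F y) <= g y) ->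
  cn (cint mu F) <= 2 * \int[mu]_(y in Sp) g y.
Proof.
move=> [f1 f2] hg H; rewrite /cn /=.
have := @bint_norm _ _ _ mu _ mS _ _ f1 hg; have := @bint_norm _ _ _ mu _ mS _ _ f2 hg.
have h1 y : Sp y -> `|Re (F y)| <= g y by move=> /H; apply: le_trans; rewrite lerDl.
have h2 y : Sp y -> `|Im (F y)| <= g y by move=> /H; apply: le_trans; rewrite lerDr.
by move=> /(_ h2) ? /(_ h1) ?; lra.
Qed.

(** Up to the sign (-1)^j, the j-th derivative in z of exp(-z y), with its limit 0 at +oo. *)
Definition cl (j : nat) z y : C := if y is r%:E then (r ^+ j)%:C%C * cexp (- (z * r%:C%C)) else 0.

(** From t <= exp t at t = c r / n, raised to the power n. *)
Lemma expr_le_expR (c r : R) n : 0 < c -> 0 <= r -> r ^+ n <= (n%:R / c) ^+ n * expR (c * r).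
Proof.
move=> c0 r0; case: n => [|n].
  by rewrite !expr0 mul1r -expR0 ler_expR mulr_ge0 ?(ltW c0).
have n0 : 0 < n.+1%:R :> R by [].
have : c * r / n.+1%:R <= expR (c * r / n.+1%:R).
  by apply: le_trans (expR_ge1Dx _); rewrite lerDr.
move=> /(@lerXn2r _ n.+1 _ _); rewrite !nnegrE expR_ge0 => /(_ _ isT).
rewrite divr_ge0 ?mulr_ge0 ?(ltW c0)// => /(_ isT).
rewrite -expRM_natr divfK ?gt_eqF// => H.
have -> : r = (n.+1%:R / c) * (c * r / n.+1%:R) by field; rewrite nat1r !gt_eqF.
rewrite exprMn; apply: ler_wpM2l; first by rewrite exprn_ge0// divr_ge0// ltW.
apply: (le_trans H); rewrite ler_expR.
by have -> : (n.+1%:R / c) * (c * r / n.+1%:R) = r by field; rewrite nat1r !gt_eqF.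
Qed.

Lemma cn_real (a : R) : cn a%:C%C = `|a|.
Proof. by rewrite /cn /= normr0 addr0. Qed.

Lemma cn_cl j z (r : R) : 0 <= r -> cn (cl j z r%:E) <= 2 * (r ^+ j * expR (- (Re z * r))).
Proof.
move=> r0; rewrite /cl; apply: (le_trans (cnM _ _)); rewrite cn_real ger0_norm ?exprn_ge0//.
rewrite mulrCA ler_wpM2l ?exprn_ge0//; apply: (le_trans (cn_cexp _)).
by rewrite !RIE /= mulr0 subr0.
Qed.

Lemma measurable_cl j z : measurable_fun setT (fun y => Re (cl j z y)) /\
  measurable_fun setT (fun y => Im (cl j z y)).
Proof.
have mfin : measurable_fun setT (fun y : \bar R => y \is a fin_num).
  apply: (measurable_fun_bool true).
  rewrite setTI (_ : _ @^-1` _ = `]-oo%E, +oo%E[%classic); first exact: emeasurable_itv.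
  by apply/seteqP; split=> -[r| |]; rewrite /= in_itv //= ?ltNyr ?ltry.
have mf (g : R -> R) : continuous g -> measurable_fun setT (fun y : \bar R => g (fine y)).
  by move=> cg; apply: measurableT_comp; [exact: continuous_measurable_fun|exact: fine_measurable].
have ce (a : R) : continuous (fun r : R => expR (- (a * r))).
  move=> r; apply: (@continuous_comp R R R (fun r => - (a * r)) (@expR R)); last exact: continuous_expR.
  by apply: continuousN; exact: mulrl_continuous.
have cc (a : R) : continuous (fun r : R => cos (- (a * r))).
  move=> r; apply: (@continuous_comp R R R (fun r => - (a * r)) (@cos R)); last exact: continuous_cos.
  by apply: continuousN; exact: mulrl_continuous.
have cs (a : R) : continuous (fun r : R => sin (- (a * r))).
  move=> r; apply: (@continuous_comp R R R (fun r => - (a * r)) (@sin R)); last exact: continuous_sin.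
  by apply: continuousN; exact: mulrl_continuous.
have mx : measurable_fun setT (fun y : \bar R => fine y ^+ j).
  by apply: measurable_funX; exact: fine_measurable.
split.
- rewrite (_ : (fun y => _) = fun y => if y \is a fin_num then
    fine y ^+ j * (expR (- (Re z * fine y)) * cos (- (Im z * fine y))) else 0); last first.
    by apply/funext => -[r| |] //=; rewrite ?RIE /= ?RIE /= ?mulr0 ?mul0r ?subr0 ?addr0 ?add0r.
  apply: measurable_fun_ifT => //.
  apply: measurable_funM => //; apply: measurable_funM; [exact: (mf _ (ce _))|exact: (mf _ (cc _))].
- rewrite (_ : (fun y => _) = fun y => if y \is a fin_num then
    fine y ^+ j * (expR (- (Re z * fine y)) * sin (- (Im z * fine y))) else 0); last first.
    by apply/funext => -[r| |] //=; rewrite ?RIE /= ?RIE /= ?mulr0 ?mul0r ?subr0 ?addr0 ?add0r.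
  apply: measurable_fun_ifT => //.
  apply: measurable_funM => //; apply: measurable_funM; [exact: (mf _ (ce _))|exact: (mf _ (cs _))].
Qed.

Lemma cl_bound j z : 0 < Re z -> exists2 B, 0 <= B & forall y, Sp y -> cn (cl j z y) <= B.
Proof.
move=> z0; have B0 : 0 <= 2 * (j%:R / Re z) ^+ j.
  by apply: mulr_ge0 => //; apply: exprn_ge0; rewrite divr_ge0// ltW.
exists (2 * (j%:R / Re z) ^+ j) => //.
case=> [r| |]; rewrite /Defs.Sp //= ?lee_fin => r0.
  apply: (le_trans (cn_cl _ _ r0)); rewrite ler_wpM2l//.
  rewrite expRN ler_pdivrMr ?expR_gt0//; exact: expr_le_expR.
by rewrite /cn /= normr0 addr0.
Qed.

Lemma bcf_cl j z : 0 < Re z -> bcf (cl j z).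
Proof.
move=> /(cl_bound j) [B B0 H]; have [m1 m2] := measurable_cl j z.
split; (split; first exact: measurable_funTS); exists B => y /H; apply: le_trans.
  by rewrite lerDl.
by rewrite lerDr.
Qed.

(** K must not depend on y. Bounding |h| by Re z / 2 spends one half of the decay exp(-Re z r); the
    other half absorbs the factor r^(j + 2) of the Taylor remainder. *)
Lemma cl_second_order j z : 0 < Re z -> exists2 K, 0 <= K &
  forall y h, Sp y -> cn h <= Re z / 2 ->
   cn (cl j (z + h) y - cl j z y + h * cl j.+1 z y) <= K * cn h ^+ 2.
Proof.
move=> z0; have z20 : 0 < Re z / 2 by rewrite divr_gt0.
exists (8 * (j.+2%:R / (Re z / 2)) ^+ j.+2).
  by rewrite mulr_ge0// exprn_ge0// divr_ge0// ltW.
case=> [r| |] h; rewrite /Defs.Sp //= ?lee_fin => r0 hz; last first.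
  rewrite subrr mulr0 addr0 {1}/cn /= normr0 addr0 mulr_ge0 ?sqr_ge0//.
  by apply: mulr_ge0 => //; apply: exprn_ge0; rewrite divr_ge0// ltW.
have -> : (r ^+ j)%:C%C * cexp (- ((z + h) * r%:C%C)) - (r ^+ j)%:C%C * cexp (- (z * r%:C%C)) +
   h * ((r ^+ j.+1)%:C%C * cexp (- (z * r%:C%C))) =
   cl j z r%:E * (cexp (- (h * r%:C%C)) - 1 - - (h * r%:C%C)).
  have -> : cl j z r%:E = (r ^+ j)%:C%C * cexp (- (z * r%:C%C)) by [].
  rewrite mulrDl opprD cexpD.
  have -> : (r ^+ j.+1)%:C%C = r%:C%C * (r ^+ j)%:C%C by rewrite exprS rmorphM.
  ring.
apply: (le_trans (cnM _ _)).
have h0 := cn_ge0 h; set H := cn h in h0 hz *.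
have hr : cn (- (h * r%:C%C)) <= H * r.
  by rewrite cnN; apply: (le_trans (cnM _ _)); rewrite cn_real ger0_norm.
have E1 : cn (cexp (- (h * r%:C%C)) - 1 - - (h * r%:C%C)) <= 4 * (H * r) ^+ 2 * expR (H * r).
  apply: (le_trans (cexp_lin _)); apply: ler_pM; rewrite ?expR_ge0 ?ler_expR//.
    by rewrite mulr_ge0// sqr_ge0.
  by rewrite ler_wpM2l// lerXn2r// nnegrE ?cn_ge0// mulr_ge0.
apply: (le_trans (ler_pM (cn_ge0 _) (cn_ge0 _) (cn_cl j z r0) E1)).
have -> : 2 * (r ^+ j * expR (- (Re z * r))) * (4 * (H * r) ^+ 2 * expR (H * r)) =
   8 * H ^+ 2 * (r ^+ j.+2 * (expR (- (Re z * r)) * expR (H * r))).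
  by rewrite [r ^+ j.+2]exprS [r ^+ j.+1]exprS; ring.
rewrite -expRD [leRHS]mulrAC ler_wpM2l ?mulr_ge0 ?sqr_ge0//.
apply: (@le_trans _ _ (r ^+ j.+2 * expR (- (Re z / 2 * r)))).
  rewrite ler_wpM2l ?exprn_ge0// ler_expR.
  have : H * r <= Re z / 2 * r by rewrite ler_wpM2r.
  lra.
by rewrite expRN ler_pdivrMr ?expR_gt0//; exact: expr_le_expR.
Qed.

Lemma cint_cl_second_order j z : 0 < Re z -> exists2 K, 0 <= K &
  forall mu h, on_Sp mu -> cn h <= Re z / 2 ->
   cn (cint mu (cl j (z + h)) - cint mu (cl j z) + h * cint mu (cl j.+1 z)) <= K * cn h ^+ 2.
Proof.
move=> z0; have [K K0 HK] := cl_second_order j z0.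
exists (2 * K); first by rewrite mulr_ge0.
move=> mu h hmu hz.
have zh0 : 0 < Re (z + h).
  have : `|Re h| <= Re z / 2 by apply: le_trans hz; rewrite lerDl.
  rewrite cReD ler_norml => /andP[? ?]; lra.
have b1 := bcf_cl j z0; have b2 := bcf_cl j zh0; have b3 := bcf_cl j.+1 z0.
rewrite -cintB// -cintZ// -cintD//; [|exact: bcfB|exact: bcfZ].
have := @cint_norm mu _ (fun=> K * cn h ^+ 2) (bcfD (bcfB b2 b1) (bcfZ h b3)) (bmf_cst _ _)
  (fun y Sy => HK y h Sy hz).
by rewrite bint_cst// on_Sp1// mulr1 -mulrA.
Qed.

Lemma cderiv_cint_cl mu j z : on_Sp mu -> 0 < Re z ->
  cderiv (fun z => cint mu (cl j z)) z (- cint mu (cl j.+1 z)).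
Proof.
move=> hmu z0 e e0; have [K K0 HK] := cint_cl_second_order j z0.
exists (Num.min (Re z / 2) (e / (1 + K))).
  by rewrite lt_min !divr_gt0//; lra.
move=> h; rewrite le_min => /andP[h1 h2].
rewrite mulNr opprK [cint _ _ * h]mulrC.
apply: (le_trans (HK mu h hmu h1)).
rewrite expr2 mulrA ler_wpM2r ?cn_ge0//.
move: h2; rewrite ler_pdivlMr; last lra.
have := cn_ge0 h; nra.
Qed.

(** One constant for all laws, as joint continuity in (s, t, z) demands. *)
Lemma cint_cl_lipschitz z : 0 < Re z -> exists2 K, 0 <= K & forall mu h, on_Sp mu ->
  cn h <= Re z / 2 -> cn (cint mu (cl 0 (z + h)) - cint mu (cl 0 z)) <= K * cn h.
Proof.
move=> z0; have [K K0 HK] := cint_cl_second_order 0 z0.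
have [B B0 HB] := cl_bound 1 z0.
exists (K * Re z + 2 * B) => [|mu h hmu hz].
  by rewrite addr_ge0 ?mulr_ge0// ltW.
have := HK mu h hmu hz; set X := cint mu (cl 0 (z + h)) - _; set Y := cint mu (cl 1 z) => H1.
have hY : cn Y <= 2 * B.
  have := @cint_norm mu _ (fun=> B) (bcf_cl 1 z0) (bmf_cst _ _) HB.
  by rewrite bint_cst// on_Sp1// mulr1.
have := cnD (X + h * Y) (- (h * Y)); rewrite addrK cnN => H2.
have H3 := cnM h Y; have h0 := cn_ge0 h.
have : cn h * cn Y <= cn h * (2 * B) by rewrite ler_wpM2l.
have : K * cn h ^+ 2 <= K * Re z * cn h.
  by rewrite expr2 mulrA ler_wpM2r// ler_wpM2l//; lra.
lra.
Qed.

Lemma cint_cl_real mu theta : cint mu (cl 0 theta%:C%C) = (lap mu theta)%:C%C.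
Proof.
apply: complexP; rewrite /cint /lap /=.
  apply: eq_Rintegral => -[r| |] _ //=.
  by rewrite ?RIE /= ?RIE /= !mul0r ?mulr0 ?subr0 ?oppr0 ?addr0 ?oppr0 cos0 mulr1 mul1r mulNr.
rewrite -[RHS](mul0r (fine (mu Sp))) -bint_cst//; apply: eq_Rintegral => -[r| |] _ //=.
by rewrite ?RIE /= ?RIE /= !mul0r ?mulr0 ?subr0 ?oppr0 ?addr0 ?oppr0 sin0 !mulr0 ?addr0.
Qed.

Lemma cn_cint_cl_le mu z : on_Sp mu -> 0 < Re z -> cn (cint mu (cl 0 z)) <= 4 * lap mu (Re z).
Proof.
move=> hmu z0; have bl : bmf Sp (lapf (Re z)) by apply: bmf_lapf; exact: ltW.
have := @cint_norm mu _ (fun y => 2 * lapf (Re z) y) (bcf_cl 0 z0) (bmfZ 2 bl).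
rewrite bintZ// mulrA -natrM; apply => -[r| |]; rewrite /Defs.Sp //= ?lee_fin => r0.
  by have := cn_cl 0 z r0; rewrite expr0 mul1r mulNr.
by rewrite /cn /= normr0 addr0 mulr0.
Qed.

(** Bounds a complex increment by a real one. Near 0 both sides are of order y; for y > 1, including
    +oo, the left side is at most 3 and 1 - exp(-y) is at least 1/2. *)
Lemma cn_1_sub_cl (M : R) : 0 <= M -> exists2 K, 0 <= K & forall z y, cn z <= M -> 0 < Re z ->
  Sp y -> cn (1 - cl 0 z y) <= K * (1 - lapf 1 y).
Proof.
move=> M0.
pose L := M + 4 * M ^+ 2 * expR M.
have L0 : 0 <= L by rewrite addr_ge0// !mulr_ge0 ?sqr_ge0 ?expR_ge0.
have E0 := expR_ge0 (1 : R).
exists (6 + expR 1 * L); first by rewrite addr_ge0// mulr_ge0.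
have cn1 : cn (1 : C) = 1 by rewrite /cn /= normr1 normr0 addr0.
move=> z [r| |] zM; rewrite /Defs.Sp //= ?lee_fin => z0 r0; last first.
  by rewrite subr0 cn1 subr0 mulr1 -[leLHS]addr0 lerD ?mulr_ge0// ler1n.
rewrite mulN1r.
have [r1|r1] := leP r 1.
  set W := - (z * r%:C%C); have cW : cn W <= M * r.
    by rewrite cnN; apply: (le_trans (cnM _ _)); rewrite cn_real ger0_norm// ler_wpM2r.
  have W0 := cn_ge0 W.
  have MrM : M * r <= M by rewrite ler_piMr.
  have H1 : cn (cexp W - 1 - W) <= 4 * (M * r) ^+ 2 * expR M.
    apply: (le_trans (cexp_lin _)); apply: ler_pM; rewrite ?expR_ge0 ?ler_expR ?(le_trans cW)//.
      by rewrite mulr_ge0// sqr_ge0.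
    by rewrite ler_wpM2l// lerXn2r// nnegrE ?mulr_ge0.
  have H2 : cn (1 - (r ^+ 0)%:C%C * cexp W) <= r * L.
    rewrite expr0 mul1r -cnN opprB -[X in cn X](subrK W); apply: (le_trans (cnD _ _)).
    apply: (le_trans (lerD H1 cW)).
    have -> : r * L = r * (4 * M ^+ 2 * expR M) + M * r by rewrite /L; ring.
    rewrite lerD2r exprMn (_ : 4 * (M ^+ 2 * r ^+ 2) * expR M = r * (r * (4 * M ^+ 2 * expR M))); last by ring.
    by rewrite ler_wpM2l// ler_piMl// !mulr_ge0 ?sqr_ge0 ?expR_ge0.
  apply: (le_trans H2).
  have H3 : r <= expR 1 * (1 - expR (- r)).
    have h1 : r <= expR r - 1 by have := expR_ge1Dx r; lra.
    have -> : 1 - expR (- r) = (expR r - 1) * expR (- r).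
      by rewrite mulrBl mul1r -expRD addrN expR0.
    rewrite mulrCA -expRD; apply: (le_trans h1); rewrite ler_peMr//; first lra.
    by rewrite -[leLHS]expR0 ler_expR; lra.
  have : r * L <= expR 1 * (1 - expR (- r)) * L by rewrite ler_wpM2r.
  have : 0 <= 1 - expR (- r) by rewrite subr_ge0 -expR0 ler_expR; lra.
  lra.
have H1 : cn (1 - (r ^+ 0)%:C%C * cexp (- (z * r%:C%C))) <= 3.
  apply: (le_trans (cnD _ _)); rewrite cn1 cnN.
  have := cn_cl 0 z r0; rewrite /cl expr0 mul1r.
  have : expR (- (Re z * r)) <= 1 by rewrite -expR0 ler_expR oppr_le0 mulr_ge0// ltW.
  lra.
apply: (le_trans H1).
have H2 : 1 / 2 <= 1 - expR (- r).
  have : expR (- r) <= 1 / 2.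
    rewrite expRN div1r lef_pV2 ?posrE ?expR_gt0//.
    by apply: le_trans (expR_ge1Dx r); lra.
  lra.
have : 0 <= expR 1 * L * (1 - expR (- r)) by rewrite !mulr_ge0//; lra.
lra.
Qed.

Lemma cn_1_sub_cint (M : R) : 0 <= M -> exists2 K, 0 <= K & forall z mu, cn z <= M ->
  0 < Re z -> on_Sp mu -> cn (1 - cint mu (cl 0 z)) <= K * (1 - lap mu 1).
Proof.
move=> M0; have [K K0 HK] := cn_1_sub_cl M0.
exists (2 * K); first by rewrite mulr_ge0.
move=> z mu zM z0 hmu; have bl : bmf Sp (lapf (1 : R)) by exact: bmf_lapf.
have b1 : bmf Sp (fun y => 1 - lapf (1 : R) y) by apply: bmfB => //; exact: bmf_cst.
rewrite -{1}(cint_cst 1 hmu) -cintB//; [|exact: bcf_cst|exact: bcf_cl].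
have := @cint_norm mu _ (fun y => K * (1 - lapf 1 y)) (bcfB (bcf_cst 1) (bcf_cl 0 z0)) (bmfZ K b1)
  (fun y Sy => HK z y zM z0 Sy).
rewrite bintZ// bintB//; last exact: bmf_cst.
by rewrite bint_cst// on_Sp1// mulr1 mulrA.
Qed.

Lemma cl_continuous z : 0 < Re z -> {within Sp, continuous (fun y => Re (cl 0 z y))} /\
  {within Sp, continuous (fun y => Im (cl 0 z y))}.
Proof.
move=> z0.
have decay (phi : R -> R) : (forall r, `|phi r| <= expR (- (Re z * r))) -> phi r @[r --> +oo] --> 0.
  move=> H; apply/cvgrPdist_lt => e e0; near=> r.
  rewrite sub0r normrN; apply: (le_lt_trans (H r)).
  rewrite -[ltRHS]lnK// ltr_expR ltrNl -ltr_pdivrMl//.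
  by near: r; apply: nbhs_pinfty_gt; exact: num_real.
have ce : continuous (fun r : R => expR (- (Re z * r))).
  move=> r; apply: (@continuous_comp R R R (fun r => - (Re z * r)) (@expR R)); last exact: continuous_expR.
  by apply: continuousN; exact: mulrl_continuous.
have cb : continuous (fun r : R => - (Im z * r)).
  by move=> r; apply: continuousN; exact: mulrl_continuous.
split.
- rewrite (_ : (fun y => _) = fun y : \bar R => if y is r%:E then
    expR (- (Re z * r)) * cos (- (Im z * r)) else 0); last first.
    by apply/funext => -[r| |] //=; rewrite ?RIE /= ?RIE /= ?mulr0 ?mul0r ?subr0 ?addr0 ?add0r mul1r.
  apply: within_Sp_continuous.
    apply: fun_contM; first exact: ce.
    by move=> r; apply: (@continuous_comp R R R (fun r => - (Im z * r)) (@cos R) r); [exact: cb|exact: continuous_cos].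
  apply: decay => r; rewrite normrM ger0_norm ?expR_ge0// ler_piMr ?expR_ge0//.
  by rewrite ler_norml cos_geN1 cos_le1.
- rewrite (_ : (fun y => _) = fun y : \bar R => if y is r%:E then
    expR (- (Re z * r)) * sin (- (Im z * r)) else 0); last first.
    by apply/funext => -[r| |] //=; rewrite ?RIE /= ?RIE /= ?mulr0 ?mul0r ?subr0 ?addr0 ?add0r mul1r.
  apply: within_Sp_continuous.
    apply: fun_contM; first exact: ce.
    by move=> r; apply: (@continuous_comp R R R (fun r => - (Im z * r)) (@sin R) r); [exact: cb|exact: continuous_sin].
  apply: decay => r; rewrite normrM ger0_norm ?expR_ge0// ler_piMr ?expR_ge0//.
  by rewrite ler_norml sin_geN1 sin_le1.
Unshelve. all: by end_near. Qed.

End ComplexLaplace.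

(** * Exponents on the positive axis *)

Section RealExponent.
Variable R : realType.
Local Notation Sp := (@Sp R).
Local Notation prob := (probability (\bar R) R).
Local Notation C := R[i].
Local Notation Re := complex.Re.
Local Notation Im := complex.Im.

Lemma bernoulli_le (u : R) n : 0 <= u <= 1 -> 1 - n%:R * (1 - u) <= u ^+ n.
Proof.
move=> /andP[u0 u1]; elim: n => [|n IH]; first by rewrite mul0r subr0.
have un1 : u ^+ n <= 1 by rewrite exprn_ile1.
have un0 : 0 <= u ^+ n by rewrite exprn_ge0.
have -> : u ^+ n.+1 = u ^+ n - u ^+ n * (1 - u) by rewrite exprSr; ring.
have : u ^+ n * (1 - u) <= 1 - u by rewrite ler_piMl// subr_ge0.
by rewrite -natr1 mulrDl; lra.
Qed.

Lemma lap_le1 (mu : prob) theta : on_Sp mu -> 0 <= theta -> lap mu theta <= 1.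
Proof.
move=> hmu t0; rewrite -(on_Sp1 hmu) -[leRHS]mul1r -bint_cst//; last exact: measurable_Sp.
apply: bint_le; [exact: measurable_Sp|exact: bmf_lapf|exact: bmf_cst|].
by move=> y Sy; exact: lapf_le1.
Qed.

Lemma lapf_mulrn n theta y : lapf (n.+1%:R * theta) y = lapf (theta : R) y ^+ n.+1.
Proof.
case: y => [r| |] /=; rewrite ?expr0n//.
by rewrite -expRM_natl; congr expR; ring.
Qed.

Lemma lapf_anti (a b : R) y : a <= b -> Sp y -> lapf b y <= lapf a y.
Proof.
case: y => [r| |] //= ab; rewrite /Defs.Sp /= lee_fin => r0.
by rewrite ler_expR ler_wpM2r// lerN2.
Qed.

(** A transform equal to 1 at a means exp(-a y) = 1 almost surely. Bernoulli's inequality exploits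
    this through integrals alone: it bounds the transform from below at (m + 1) a >= b. *)
Lemma lap_eq1 (mu : prob) (a b : R) : on_Sp mu -> 0 < a -> 0 <= b -> lap mu a = 1 -> lap mu b = 1.
Proof.
move=> hmu a0 b0 la; apply/eqP; rewrite eq_le lap_le1//=.
have mS := measurable_Sp R.
have [m hm] : exists m : nat, b <= m.+1%:R * a.
  exists (Num.bound (b / a)); rewrite -ler_pdivrMr//.
  have := archi_boundP (divr_ge0 b0 (ltW a0)); rewrite -natr1; lra.
have ba : bmf Sp (lapf a) by apply: bmf_lapf; exact: ltW.
have bb : bmf Sp (lapf b) by exact: bmf_lapf.
have b1 : bmf Sp (fun y => 1 - lapf a y) by apply: bmfB => //; exact: bmf_cst.
have b2 : bmf Sp (fun y => m.+1%:R * (1 - lapf a y)) by exact: bmfZ.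
have b3 : bmf Sp (fun y => 1 - m.+1%:R * (1 - lapf a y)) by apply: bmfB => //; exact: bmf_cst.
have -> : 1 = \int[mu]_(y in Sp) (1 - m.+1%:R * (1 - lapf a y)).
  rewrite bintB//; last exact: bmf_cst.
  rewrite bintZ// bintB//; last exact: bmf_cst.
  by rewrite bint_cst// on_Sp1// -/(lap mu a) la mul1r subrr mulr0 subr0.
apply: bint_le => // y Sy.
apply: (@le_trans _ _ (lapf (m.+1%:R * a) y)); last exact: lapf_anti.
by rewrite lapf_mulrn bernoulli_le// lapf_ge0 lapf_le1// ltW.
Qed.

Variable k : R -> R -> \bar R -> prob.
Variable v : R -> R -> C -> C.
Hypothesis hk : BP_kernel_family k.
Hypothesis hv : forall s t, Delta s t -> holomorphic_on_H (v s t) /\ laplace_rel (k s t) (v s t).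

Definition real_exponent (s t theta : R) : R := Re (v s t theta%:C%C).
Local Notation V := real_exponent.

Lemma BP_on_Sp s t y : Delta s t -> Sp y -> on_Sp (k s t y).
Proof. by move=> D Sy; have [h _] := hk.1 s t D; exact: h. Qed.

Lemma real_exponentE s t theta : Delta s t -> 0 < theta -> v s t theta%:C%C = (V s t theta)%:C%C.
Proof.
move=> D t0; have [_ L] := hv D; have [h _] := L 1 theta ltr01 t0.
exact: complexP.
Qed.

Lemma lap_kernel s t x theta : Delta s t -> 0 < x -> 0 < theta ->
  lap (k s t x%:E) theta = expR (- x * V s t theta).
Proof.
move=> D x0 t0; have [_ L] := hv D; have [_] := L x theta x0 t0.
by rewrite laplace_relE ?ltW// => -[].
Qed.

Let Sp_fin (x : R) : 0 <= x -> Sp x%:E.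
Proof. by rewrite /Defs.Sp /= lee_fin. Qed.

Lemma lap_eq_measure (mu nu : prob) theta : (forall B, measurable B -> mu B = nu B) ->
  lap mu theta = lap nu theta.
Proof.
move=> H; rewrite /lap /Rintegral; congr fine; apply: eq_measure_integral => A mA _; exact: H.
Qed.

Lemma lap_kernel_Sp s t y theta : Delta s t -> Sp y -> 0 < theta ->
  lap (k s t y) theta = lapf (V s t theta) y.
Proof.
move=> D Sy t0; case: y Sy => [r| |] Sy //.
- have : 0 <= r by move: Sy; rewrite /Defs.Sp /= lee_fin.
  rewrite le_eqVlt => /orP[/eqP r0|r0]; last by rewrite lap_kernel//= mulrC mulrN mulNr.
  rewrite -r0 (@lap_eq_measure _ (\d_(0%E) : prob)).
    by rewrite lap_dirac ?ltW//= ?mulr0//; exact: Sp_fin.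
  by move=> B mB; have [_ [_ [_ [_ [_ [H _]]]]]] := hk; rewrite H.
- rewrite (@lap_eq_measure _ (\d_(+oo%E) : prob)).
    by rewrite lap_dirac ?ltW.
  by move=> B mB; have [_ [_ [_ [_ [_ [_ H]]]]]] := hk; rewrite H.
Qed.

Lemma real_exponent_ge0 s t theta : Delta s t -> 0 < theta -> 0 <= V s t theta.
Proof.
move=> D t0; have := lap_kernel D ltr01 t0.
have := lap_le1 (BP_on_Sp D (Sp_fin ler01)) (ltW t0) => h e; move: h; rewrite e.
by rewrite -[leRHS]expR0 ler_expR mulN1r oppr_le0.
Qed.

Lemma real_exponent_id s theta : 0 <= s -> 0 < theta -> V s s theta = theta.
Proof.
move=> s0 t0; have D : Delta s s by split.
have := lap_kernel D ltr01 t0.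
rewrite (@lap_eq_measure _ (\d_(1%:E) : prob)).
  rewrite lap_dirac ?ltW//=; last exact: Sp_fin.
  by move=> /expR_inj; rewrite mulr1 mulN1r => /oppr_inj.
by move=> B mB; have [_ [H _]] := hk; rewrite H//; exact: Sp_fin.
Qed.

(** The condition on V t u theta reflects that transforms are known at positive arguments. This
    conditional form is what the proof of [real_exponent_gt0] uses; [real_exponent_comp_gt0] then
    drops the condition. *)
Lemma real_exponent_comp s t u theta : 0 <= s -> s <= t -> t <= u -> 0 < theta ->
  0 < V t u theta -> V s u theta = V s t (V t u theta).
Proof.
move=> s0 st tu t0 v0.
have D1 : Delta s t by []. have D2 : Delta t u by split => //; exact: le_trans st.
have D3 : Delta s u by split => //; exact: le_trans tu.
have [[cS cm] cS2] := (hk.1 t u D2, fun y => @BP_on_Sp t u y D2).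
have S1 : Sp 1%:E by exact: Sp_fin.
have [m [_ mE mL]] := @mixture_exists R (k s t 1%:E) (k t u) (BP_on_Sp D1 S1) cm cS2.
have : lap (k s u 1%:E) theta = lap (k s t 1%:E) (V t u theta).
  rewrite (@lap_eq_measure _ m).
    rewrite mL ?ltW//; apply: eq_Rintegral => y; rewrite inE => Sy.
    by rewrite lap_kernel_Sp.
  by move=> B mB; rewrite mE//; have [_ [_ [H _]]] := hk; rewrite -(H s t u).
rewrite !lap_kernel// => /expR_inj; rewrite !mulN1r => /oppr_inj //.
Qed.

Lemma kernel_int_continuous f s0 t0 x (e : R) : {within Sp, continuous f} -> Delta s0 t0 ->
  0 <= x -> 0 < e -> exists2 d : R, 0 < d & forall s t, Delta s t -> `|s - s0| < d ->
    `|t - t0| < d ->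
    `|\int[k s t x%:E]_(y in Sp) f y - \int[k s0 t0 x%:E]_(y in Sp) f y| < e.
Proof.
move=> cf D0 x0 e0; have [_ [_ [_ [K3 _]]]] := hk.
have /within_epsP H := K3 f cf.
have [d d0 {}H] := H (s0, t0, x) (conj D0 x0) e e0.
exists d => // s t D hs ht; have := H (s, t, x) (conj D x0) hs ht; apply.
by rewrite /= subrr normr0.
Qed.

Lemma real_exponent_continuous s0 t0 theta (e : R) : Delta s0 t0 -> 0 < theta -> 0 < e ->
  exists2 d : R, 0 < d & forall s t, Delta s t -> `|s - s0| < d -> `|t - t0| < d ->
    `|V s t theta - V s0 t0 theta| < e.
Proof.
move=> D0 th0 e0; set V0 := V s0 t0 theta.
have p0 : 0 < expR (- 1 * V0) by exact: expR_gt0.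
have /cvgrPdist_lt/(_ e e0)/nbhs_ballP[r /= r0 Hr] := continuous_ln p0.
have [d d0 H] := kernel_int_continuous (lapf_continuous th0) D0 ler01 r0.
exists d => // s t D hs ht; have := H s t D hs ht.
rewrite -/(lap _ _) -/(lap _ _) !lap_kernel// distrC => /Hr.
by rewrite /= !expRK !mulN1r opprK addrC.
Qed.

Lemma real_exponent_eq0 s t (a b : R) : Delta s t -> 0 < a -> 0 < b -> V s t a = 0 -> V s t b = 0.
Proof.
move=> D a0 b0 va; have hS := BP_on_Sp D (Sp_fin ler01).
have la : lap (k s t 1%:E) a = 1 by rewrite lap_kernel// va mulr0 expR0.
have := lap_eq1 hS a0 (ltW b0) la.
rewrite lap_kernel// -[RHS]expR0 => /expR_inj /eqP.
by rewrite mulN1r oppr_eq0 => /eqP.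
Qed.

Lemma real_exponent_gt0 s t theta : Delta s t -> 0 < theta -> 0 < V s t theta.
Proof.
move=> D th0; rewrite lt_neqAle real_exponent_ge0// andbT eq_sym.
apply/eqP => /(@real_exponent_eq0 s t theta 1 D th0 ltr01) V10.
have [s0 st] := D.
pose E := [set r | s <= r <= t /\ V s r 1 = 0].
have lbE : has_inf E.
  split; first by exists t; split => //; rewrite st lexx.
  by exists s => r [/andP[]].
set m := inf E.
have sm : s <= m by apply: lb_le_inf; [exact: lbE.1|move=> r [/andP[]]].
have mt : m <= t by apply: ge_inf; [exact: lbE.2|split => //; rewrite st lexx].
have Dm : Delta s m by [].
have m0 : 0 <= m by exact: le_trans sm.
have Vm : V s m 1 = 0.
  apply/eqP; rewrite eq_le real_exponent_ge0// andbT leNgt; apply/negP => Vm.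
  have [d d0 H] := real_exponent_continuous Dm ltr01 Vm.
  have [r [/andP[sr rt] Vr] rd] := inf_adherent d0 lbE.
  have mr : m <= r by apply: ge_inf; [exact: lbE.2|split => //; rewrite sr rt].
  have rm : `|r - m| < d by rewrite ger0_norm ?subr_ge0// ltrBlDl.
  have ss : `|s - s| < d by rewrite subrr normr0.
  have := H s r (conj s0 sr) ss rm.
  by rewrite Vr sub0r normrN ger0_norm ?ltxx// ltW.
have sm' : s < m.
  rewrite lt_neqAle sm andbT; apply/eqP => sm1.
  by move: Vm; rewrite -sm1 real_exponent_id// => /eqP; rewrite oner_eq0.
have Dmm : Delta m m by [].
have [d d0 H] := real_exponent_continuous Dmm ltr01 (@ltr01 R).
pose a := Num.max s (m - d / 2).
have am : a < m by rewrite gt_max sm'/=; lra.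
have sa : s <= a by rewrite le_max lexx.
have am' : `|a - m| < d.
  rewrite ltr0_norm ?subr_lt0// opprB ltrBlDr -ltrBlDl lt_max; apply/orP; right; lra.
have Dam : Delta a m by split; [exact: le_trans sa|exact: ltW].
have := H a m Dam am'; rewrite subrr normr0 real_exponent_id// => /(_ d0).
rewrite ltr_norml => /andP[Va _]; have {}Va : 0 < V a m 1 by lra.
have Dsa : Delta s a by [].
have Vsa : V s a 1 = 0.
  have := real_exponent_comp s0 sa (ltW am) ltr01 Va; rewrite Vm => /esym.
  exact: real_exponent_eq0.
have : m <= a by apply: ge_inf; [exact: lbE.2|split => //; rewrite sa /= (le_trans (ltW am))].
by rewrite leNgt am.
Qed.

Lemma real_exponent_comp_gt0 s t u theta : 0 <= s -> s <= t -> t <= u -> 0 < theta ->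
  V s u theta = V s t (V t u theta).
Proof.
move=> s0 st tu t0; apply: real_exponent_comp => //; apply: real_exponent_gt0 => //.
by split => //; exact: le_trans st.
Qed.

End RealExponent.

(** * Exponents on the half-plane *)

Section ComplexExponent.
Variable R : realType.
Local Notation Sp := (@Sp R).
Local Notation prob := (probability (\bar R) R).
Local Notation C := R[i].
Local Notation Re := complex.Re.
Local Notation Im := complex.Im.
Variable k : R -> R -> \bar R -> prob.
Variable v : R -> R -> C -> C.
Hypothesis hk : BP_kernel_family k.
Hypothesis hv : forall s t, Delta s t -> holomorphic_on_H (v s t) /\ laplace_rel (k s t) (v s t).
Local Notation V := (real_exponent v).

Let kS s t (x : R) : Delta s t -> 0 <= x -> on_Sp (k s t x%:E).
Proof. by move=> D x0; apply: (BP_on_Sp hk D); rewrite /Defs.Sp /= lee_fin. Qed.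

Let VE s t theta (D : Delta s t) := @real_exponentE R k v hv s t theta D.
Let lapk s t x theta (D : Delta s t) := @lap_kernel R k v hv s t x theta D.
Let V_gt0 s t theta (D : Delta s t) := @real_exponent_gt0 R k v hk hv s t theta D.

Lemma cexp_exponent s t (x : R) z : Delta s t -> 0 < x -> Hp z ->
  cexp (- (x%:C%C * v s t z)) = cint (k s t x%:E) (cl 0 z).
Proof.
move=> D x0 hz; have [hol_v _] := hv D; have hS := kS D (ltW x0).
apply: (@identity_theorem R (fun z => cexp (- (x%:C%C * v s t z))) (fun z => cint (k s t x%:E) (cl 0 z)) _ _ _ z hz).
- move=> w hw; apply/holP.
  have h1 : hol (fun w => (- x%:C%C) * v s t w) w.
    by apply: holM; [exact: hol_cst|apply/holP; exact: hol_v].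
  have := hol_comp h1 (hol_cexp _).
  by rewrite (_ : _ \o _ = fun z => cexp (- (x%:C%C * v s t z)))//; apply/funext => u /=; rewrite mulNr.
- move=> w hw; apply/holP; exists (- cint (k s t x%:E) (cl 1 w)); exact: cderiv_cint_cl.
- move=> theta th0; rewrite cint_cl_real VE// lapk// -cexp_real mulNr.
  by congr cexp; rewrite rmorphN rmorphM.
Qed.

Lemma cn_cexp_ge (z : C) : expR (Re z) <= cn (cexp z).
Proof.
rewrite /cn /= !normrM (ger0_norm (expR_ge0 _)) -mulrDr ler_peMr ?expR_ge0//.
have := sin2cos2 (Im z); rewrite -(real_normK (num_real (sin _))) -(real_normK (num_real (cos _))).
have := normr_ge0 (sin (Im z)); have := normr_ge0 (cos (Im z)); nra.
Qed.

(** The inequality |E exp(-z Y)| <= E exp(-Re z Y) costs a factor 4 in the l1 norm, but it is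
    available for every initial state x, and a large x makes the factor harmless: x = 4 / d leads to
    exp 4 <= 4. *)
Lemma Re_exponent_ge s t z : Delta s t -> Hp z -> V s t (Re z) <= Re (v s t z).
Proof.
move=> D hz; rewrite leNgt; apply/negP => H.
set d := V s t (Re z) - Re (v s t z); have d0 : 0 < d by rewrite subr_gt0.
have x0 : 0 < 4 / d by rewrite divr_gt0.
have := cn_cint_cl_le (kS D (ltW x0)) hz; rewrite -(cexp_exponent D x0 hz) lapk//.
move=> /(le_trans (cn_cexp_ge _)); rewrite !RIE /= mul0r subr0.
rewrite -ler_pdivrMr ?expR_gt0// -expRN -expRD.
have -> : - (4 / d * Re (v s t z)) - - (4 / d) * V s t (Re z) = 4 by rewrite /d; field; rewrite gt_eqF.
by have := expR_ge1Dx (4 : R); lra.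
Qed.

Lemma exponent_Hp s t z : Delta s t -> Hp z -> Hp (v s t z).
Proof. by move=> D hz; apply: lt_le_trans (Re_exponent_ge D hz); exact: V_gt0. Qed.

Lemma cn_scale (x : R) (z : C) : 0 <= x -> cn (x%:C%C * z) = x * cn z.
Proof. by move=> x0; rewrite /cn !RIE /= !mul0r subr0 addr0 !normrM ger0_norm// mulrDr. Qed.

(** An a priori bound. The constant of [cn_1_sub_cint] serves every law, so x may be adapted to the
    unknown size q of v without circularity. *)
Lemma cn_exponent_le (M : R) : 0 <= M -> exists2 K, 0 <= K & forall s t z, Delta s t -> Hp z ->
  cn z <= M -> cn (v s t z) <= K * V s t 1.
Proof.
move=> M0; have [K K0 HK] := cn_1_sub_cint M0.
exists (2 * K) => [|s t z D hz zM]; first by rewrite mulr_ge0.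
have V1 := V_gt0 D ltr01.
set q := cn (v s t z); have : 0 <= q by exact: cn_ge0.
rewrite le_eqVlt => /orP[/eqP<-|q0]; first by rewrite !mulr_ge0// ltW.
(* With x q = 1/32 the quadratic error of [cexp_lin] is at most 8 / 32^2, a quarter of the linear
   term, so |1 - exp(-x v)| controls x q up to a factor 2. *)
have x0 : 0 < 1 / (32 * q) by rewrite divr_gt0// mulr_gt0.
set x := 1 / (32 * q) in x0; have xq : x * q = 1 / 32 by rewrite /x; field; rewrite gt_eqF.
have H1 := HK z _ zM hz (kS D (ltW x0)).
rewrite -(cexp_exponent D x0 hz) lapk// in H1.
have H2 : 1 - expR (- x * V s t 1) <= x * V s t 1.
  by have := expR_ge1Dx (- x * V s t 1); lra.
have H3 := cexp_lin (- (x%:C%C * v s t z)).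
have cW : cn (- (x%:C%C * v s t z)) = 1 / 32 by rewrite cnN cn_scale ?(ltW x0).
rewrite cW in H3.
have H4 : expR (1 / 32) <= 2 :> R.
  have : 1 - 1 / 32 <= expR (- (1 / 32)) :> R by have := expR_ge1Dx (- (1 / 32) : R); lra.
  have : expR (- (1 / 32)) * expR (1 / 32) = 1 :> R by rewrite -expRD addNr expR0.
  have := expR_gt0 (1 / 32 : R); nra.
have H5 : 1 / 32 <= cn (1 - cexp (- (x%:C%C * v s t z))) + 8 * (1 / 32) ^+ 2.
  have := cnD (1 - cexp (- (x%:C%C * v s t z))) (cexp (- (x%:C%C * v s t z)) - 1 - - (x%:C%C * v s t z)).
  rewrite (_ : _ + _ = - - (x%:C%C * v s t z)); last by ring.
  rewrite cnN cW; lra.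
have H6 : x * q <= x * (2 * K * V s t 1).
  have : K * (1 - expR (- x * V s t 1)) <= K * (x * V s t 1) by rewrite ler_wpM2l.
  rewrite xq; lra.
by rewrite -(ler_pM2l x0).
Qed.

Lemma cint_kernel_continuous s0 t0 (x : R) z (e : R) : Delta s0 t0 -> 0 <= x -> Hp z -> 0 < e ->
  exists2 d : R, 0 < d & forall s t, Delta s t -> `|s - s0| < d -> `|t - t0| < d ->
    cn (cint (k s t x%:E) (cl 0 z) - cint (k s0 t0 x%:E) (cl 0 z)) < e.
Proof.
move=> D0 x0 hz e0; have [c1 c2] := cl_continuous hz.
have e20 : 0 < e / 2 by lra.
have [d1 d10 H1] := kernel_int_continuous hk c1 D0 x0 e20.
have [d2 d20 H2] := kernel_int_continuous hk c2 D0 x0 e20.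
exists (Num.min d1 d2); first by rewrite lt_min d10.
move=> s t D; rewrite !lt_min => /andP[s1 s2] /andP[t1 t2].
by rewrite /cn !RIE; have := H1 s t D s1 t1; have := H2 s t D s2 t2; rewrite /cint /=; lra.
Qed.

Lemma exponent_first_order s t z (x : R) B : Delta s t -> Hp z -> 0 < x -> cn (v s t z) <= B ->
  x * B <= 1 ->
  cn (x%:C%C * v s t z - (1 - cint (k s t x%:E) (cl 0 z))) <= 4 * expR 1 * (x * B) ^+ 2.
Proof.
move=> D hz x0 vB xB; rewrite -(cexp_exponent D x0 hz).
have -> : x%:C%C * v s t z - (1 - cexp (- (x%:C%C * v s t z))) =
  cexp (- (x%:C%C * v s t z)) - 1 - - (x%:C%C * v s t z) by ring.
apply: (le_trans (cexp_lin _)); rewrite cnN (cn_scale _ (ltW x0)).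
have h0 : 0 <= x * cn (v s t z) by rewrite mulr_ge0 ?cn_ge0// ltW.
have h1 : x * cn (v s t z) <= x * B by rewrite ler_wpM2l// ltW.
have hE : expR (x * cn (v s t z)) <= expR 1 by rewrite ler_expR (le_trans h1).
have hs : (x * cn (v s t z)) ^+ 2 <= (x * B) ^+ 2 by rewrite lerXn2r// nnegrE (le_trans h0).
rewrite [leLHS]mulrAC; apply: ler_pM => //; last by rewrite ler_wpM2l.
by rewrite mulr_ge0 ?expR_ge0.
Qed.

(** One x serves a whole neighbourhood: both first-order errors are at most x e / 4, and at this x
    the transform is continuous in (s, t) by weak continuity and Lipschitz in z uniformly in the
    law. Variation in z is included to prepare for compact sets. *)
Lemma exponent_jointly_continuous s0 t0 z0 (e : R) : Delta s0 t0 -> Hp z0 -> 0 < e ->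
  exists2 d : R, 0 < d & forall s t z, Delta s t -> `|s - s0| < d -> `|t - t0| < d ->
    cn (z - z0) <= d -> cn (v s t z - v s0 t0 z0) <= e.
Proof.
move=> D0 hz0 e0.
have z00 : 0 < Re z0 by [].
have M0 : 0 <= cn z0 + Re z0 by rewrite addr_ge0 ?cn_ge0// ltW.
have [K K0 HK] := cn_exponent_le M0.
pose B := K * (V s0 t0 1 + 1) + 1.
have V00 := V_gt0 D0 ltr01.
have B0 : 0 < B by rewrite /B ltr_wpDl// mulr_ge0//; lra.
have E0 := expR_gt0 (1 : R).
pose x := Num.min (1 / B) (e / (16 * expR 1 * B ^+ 2)).
have x0 : 0 < x by rewrite lt_min !divr_gt0// !mulr_gt0 ?exprn_gt0.
have xB : x * B <= 1 by rewrite -ler_pdivlMr// ge_min lexx.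
have xe : 4 * expR 1 * (x * B) ^+ 2 <= x * (e / 4).
  have : x <= e / (16 * expR 1 * B ^+ 2) by rewrite ge_min lexx orbT.
  rewrite ler_pdivlMr ?mulr_gt0 ?exprn_gt0// => h.
  have -> : 4 * expR 1 * (x * B) ^+ 2 = x * (x * (16 * expR 1 * B ^+ 2) / 4) by field.
  by rewrite ler_pM2l//; lra.
have [L L0 HL] := cint_cl_lipschitz z00.
have xe0 : 0 < x * e / 4 by rewrite divr_gt0// mulr_gt0.
have [d1 d10 H1] := cint_kernel_continuous D0 (ltW x0) hz0 xe0.
have [d2 d20 H2] := real_exponent_continuous hk hv D0 ltr01 (@ltr01 R).
pose d3 := Num.min (Re z0 / 2) (x * e / 4 / (1 + L)).
have d30 : 0 < d3 by rewrite lt_min !divr_gt0// ?mulr_gt0//; lra.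
have lt_d r : r < Num.min d1 (Num.min d2 d3) -> r < d1 /\ r < d2.
  by rewrite lt_min => /andP[-> ]; rewrite lt_min => /andP[->].
exists (Num.min d1 (Num.min d2 d3)); first by rewrite lt_min d10 lt_min d20 d30.
move=> s t z D /lt_d[s1 s2] /lt_d[t1 t2].
rewrite le_min => /andP[_]; rewrite le_min => /andP[_]; rewrite le_min => /andP[z1 z2].
have zE : z = z0 + (z - z0) by ring.
have hz : Hp z.
  have : `|Re (z - z0)| <= Re z0 / 2 by apply: le_trans z1; rewrite lerDl.
  rewrite /Hp /= !RIE ler_norml => /andP[? ?]; lra.
have zM : cn z <= cn z0 + Re z0.
  by rewrite {1}zE; apply: (le_trans (cnD _ _)); rewrite lerD2l; lra.
have vB : cn (v s t z) <= B.
  apply: (le_trans (HK s t z D hz zM)); have := H2 s t D s2 t2.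
  rewrite ltr_norml => /andP[_ h]; rewrite /B ler_wpDr// ler_wpM2l//; lra.
have vB0 : cn (v s0 t0 z0) <= B.
  have zM0 : cn z0 <= cn z0 + Re z0 by rewrite lerDl; exact: ltW.
  apply: (le_trans (HK s0 t0 z0 D0 hz0 zM0)).
  rewrite /B ler_wpDr// ler_wpM2l//; lra.
have F1 := exponent_first_order D hz x0 vB xB.
have F2 := exponent_first_order D0 hz0 x0 vB0 xB.
have F3 := H1 s t D s1 t1.
have F4 : cn (cint (k s t x%:E) (cl 0 z) - cint (k s t x%:E) (cl 0 z0)) <= x * e / 4.
  have := HL (k s t x%:E) (z - z0) (kS D (ltW x0)) z1; rewrite -zE.
  move: z2; rewrite ler_pdivlMr; last lra.
  by have := cn_ge0 (z - z0); nra.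
rewrite -(ler_pM2l x0) -(cn_scale _ (ltW x0)).
set P := cint (k s t x%:E) (cl 0 z) in F1 F4; set Q := cint (k s t x%:E) (cl 0 z0) in F3 F4.
set P0 := cint (k s0 t0 x%:E) (cl 0 z0) in F2 F3.
have -> : x%:C%C * (v s t z - v s0 t0 z0) = (x%:C%C * v s t z - (1 - P)) +
  (- (x%:C%C * v s0 t0 z0 - (1 - P0)) + (- (P - Q) - (Q - P0))) by ring.
have G1 := cnD (x%:C%C * v s t z - (1 - P)) (- (x%:C%C * v s0 t0 z0 - (1 - P0)) + (- (P - Q) - (Q - P0))).
have G2 := cnD (- (x%:C%C * v s0 t0 z0 - (1 - P0))) (- (P - Q) - (Q - P0)).
have G3 := cnD (- (P - Q)) (- (Q - P0)).
rewrite !cnN in G2 G3; lra.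
Qed.

Lemma exponent_compact_continuous s0 t0 : Delta s0 t0 ->
  forall K : set C^o, compact K -> K `<=` Hp (R := R) ->
  forall eps : R, 0 < eps -> exists2 delta : R, 0 < delta &
  forall s t, Delta s t -> `|s - s0| < delta -> `|t - t0| < delta ->
    forall z, K z -> `|v s t z - v s0 t0 z| < (eps%:C)%C.
Proof.
move=> D0 K cK KH eps e0.
pose P (d : R) (z : C^o) := forall s t, Delta s t -> `|s - s0| < d -> `|t - t0| < d ->
  `|v s t z - v s0 t0 z| < (eps%:C)%C.
(* Near-covering form of compactness with the radius as parameter: joint continuity gives each point
   of K a neighbourhood and a range of admissible radii. *)
have := (@compact_near_coveringP C^o K).1 cK R (0^'+) P _.
case => [z Kz|d /= d0 Hd].
  have e40 : 0 < eps / 4 by lra.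
  have [d d0 H] := exponent_jointly_continuous D0 (KH z Kz) e40.
  exists ([set w | cn (w - z) <= d], [set r : R | 0 < r < d]).
    split; first by apply/nbhsC_cnP; exists d.
    exists d => // r /=; rewrite sub0r normrN => h1 h2.
    by rewrite h2; move: h1; rewrite gtr0_norm.
  move=> [w r] [/= hw /andP[r0 rd]] s t D hs ht.
  have h1 := H s t w D (lt_trans hs rd) (lt_trans ht rd) hw.
  have h2 : cn (v s0 t0 w - v s0 t0 z) <= eps / 4 by apply: H; rewrite ?subrr ?normr0.
  apply: (le_lt_trans (normC_cn _)); rewrite ltcR.
  have -> : v s t w - v s0 t0 w = (v s t w - v s0 t0 z) - (v s0 t0 w - v s0 t0 z) by ring.
  by apply: (le_lt_trans (cnD _ _)); rewrite cnN; lra.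
have d20 : 0 < d / 2 by lra.
exists (d / 2) => // s t D hs ht z Kz.
apply: (Hd (d / 2) _ d20 z Kz) => //.
by rewrite /= sub0r normrN gtr0_norm//; lra.
Qed.

Lemma exponent_id s z : 0 <= s -> Hp z -> v s s z = z.
Proof.
move=> s0 hz; have D : Delta s s by [].
apply: (@identity_theorem R (v s s) id _ _ _ z hz); first by have [] := hv D.
  by move=> w _; apply/holP; exact: hol_id.
by move=> theta th0; rewrite VE// (real_exponent_id hk hv).
Qed.

Lemma exponent_comp s t u z : 0 <= s -> s <= t -> t <= u -> Hp z -> v s u z = v s t (v t u z).
Proof.
move=> s0 st tu hz.
have D1 : Delta s t by []. have D2 : Delta t u by split => //; exact: le_trans st.
have D3 : Delta s u by split => //; exact: le_trans tu.
apply: (@identity_theorem R (v s u) (v s t \o v t u) _ _ _ z hz); first by have [] := hv D3.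
  move=> w hw; apply/holP; apply: hol_comp; apply/holP.
    by have [h _] := hv D2; exact: h.
  by have [h _] := hv D1; apply: h; exact: exponent_Hp.
by move=> theta th0 /=; rewrite !VE// ?V_gt0// (real_exponent_comp_gt0 hk hv s0 st tu).
Qed.

Lemma exponent_evolution : top_rev_evol_family_H v.
Proof.
split; [|split; [|split]].
- by move=> s t D; split; [have [] := hv D|move=> z; exact: exponent_Hp].
- by move=> s s0 z; exact: exponent_id.
- by move=> s t u s0 st tu z; exact: exponent_comp.
- exact: exponent_compact_continuous.
Qed.

End ComplexExponent.

(** * Iterated derivatives on the open half-line *)

Section SmoothOnPositives.
Variable R : realType.
Local Notation C := R[i].
Local Notation Re := complex.Re.
Implicit Types (f g : R -> R) (n : nat).

(** Derivatives are witnessed on (0,+oo) only, since nothing is known of the exponents at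
    nonpositive arguments; [smooth_derive1n] passes to the global [derive1n]. *)
Fixpoint smooth n f : Prop := if n is m.+1
  then exists f', (forall x : R, 0 < x -> is_derive x 1 f (f' x)) /\ smooth m f' else True.

Lemma near_pos_eq f g (x : R) : 0 < x -> (forall x : R, 0 < x -> f x = g x) -> \near x, f x = g x.
Proof. by move=> x0 fg; near=> y; apply: fg; near: y; exact: lt_nbhsr. Unshelve. all: by end_near. Qed.

Lemma smooth_pred n f : smooth n.+1 f -> smooth n f.
Proof.
by elim: n f => [//|n IH] f [f' [df sf]]; exists f'; split => //; exact: IH.
Qed.

Lemma smoothD n f g : smooth n f -> smooth n g -> smooth n (fun x => f x + g x).
Proof.
elim: n f g => [//|n IH] f g [f' [df sf]] [g' [dg sg]].
exists (fun x => f' x + g' x); split; last exact: IH.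
by move=> x x0; apply: is_deriveD; [exact: df|exact: dg].
Qed.

Lemma smoothN n f : smooth n f -> smooth n (fun x => - f x).
Proof.
elim: n f => [//|n IH] f [f' [df sf]]; exists (fun x => - f' x); split; last exact: IH.
by move=> x x0; apply: is_deriveN; exact: df.
Qed.

Lemma smoothM n f g : smooth n f -> smooth n g -> smooth n (fun x => f x * g x).
Proof.
elim: n f g => [//|n IH] f g /[dup] /smooth_pred cf [f' [df sf]] /[dup] /smooth_pred cg [g' [dg sg]].
exists (fun x => f x * g' x + g x * f' x); split; last by apply: smoothD; exact: IH.
move=> x x0; have h1 := df x x0; have h2 := dg x x0.
by apply: is_derive_eq; rewrite /GRing.scale /=; ring.
Qed.

Lemma smoothV n f : (forall x : R, 0 < x -> f x != 0) -> smooth n f -> smooth n (fun x => (f x)^-1).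
Proof.
move=> f0; elim: n => [//|n IH] /[dup] /smooth_pred cf [f' [df sf]].
exists (fun x => - ((f x)^-1 * (f x)^-1 * f' x)); split; last first.
  by apply: smoothN; apply: smoothM => //; apply: smoothM; exact: IH.
move=> x x0; have h1 := df x x0; have h0 := f0 x x0.
have := is_deriveV h0 h1; rewrite /GRing.scale /=.
by rewrite (_ : - f x ^- 2 * f' x = - ((f x)^-1 * (f x)^-1 * f' x))// mulNr -exprVn expr2.
Qed.

Lemma derive1n_ext n f g : (forall x : R, 0 < x -> f x = g x) ->
  forall x : R, 0 < x -> derive1n n f x = derive1n n g x.
Proof.
move=> fg; elim: n => [//|n IH] x x0.
rewrite !derive1nS !derive1E; by apply: near_eq_derive; exact: near_pos_eq.
Qed.

Lemma smooth_derive1n n f (x : R) : smooth n.+1 f -> 0 < x ->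
  is_derive x 1 (derive1n n f) (derive1n n.+1 f x).
Proof.
move=> sf x0; apply: DeriveDef; last by rewrite derive1nS derive1E.
elim: n f sf => [|n IH] f [f' [df sf]]; first by have [] := df x x0.
have d1 y : 0 < y -> f' y = derive1 f y.
  by move=> y0; rewrite derive1E; have [_ ->] := df y y0.
have [] := @near_eq_is_derive _ _ _ (derive1n n f') (derive1n n.+1 f) x 1 ('D_1 (derive1n n f') x).
- apply: near_pos_eq => // y y0; rewrite derive1Sn; exact: derive1n_ext.
- by apply: DeriveDef => //; exact: IH.
by [].
Qed.

Lemma cderiv_real_line (F : C -> C) (x : R) l : cderiv F x%:C%C l ->
  is_derive x 1 (fun x : R => Re (F x%:C%C)) (Re l).
Proof.
move=> H.
have lim : (h^-1 *: (Re (F (h *: (1 : R) + x)%:C%C) - Re (F x%:C%C))) @[h --> 0^'] --> Re l.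
  apply/cvgrPdist_le => e e0; have [d d0 {}H] := H e e0.
  exists d => // h /=; rewrite sub0r normrN => hd h0.
  have := H h%:C%C; rewrite cn_real => /(_ (ltW hd)).
  rewrite /GRing.scale /= mulr1 -rmorphD /= [x + h]addrC => Hh.
  have : `|Re (F (h + x)%:C%C) - Re (F x%:C%C) - Re l * h| <= e * `|h|.
    apply: le_trans Hh; rewrite /cn !RIE /= mulr0 subr0 lerDl//.
  set D := Re (F (h + x)%:C%C) - Re (F x%:C%C) => HD.
  have -> : Re l - h^-1 * D = - (h^-1 * (D - Re l * h)) by field.
  by rewrite normrN normrM normfV ler_pdivrMl ?normr_gt0// [`|h| * e]mulrC.
apply: DeriveDef; first by apply/cvg_ex; exists (Re l).
exact: cvg_lim lim.
Qed.

End SmoothOnPositives.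

(** * Iterated differences *)

Section IteratedDifferences.
Variable R : realType.
Local Notation Sp := (@Sp R).
Local Notation prob := (probability (\bar R) R).
Implicit Types (f g : R -> R) (n : nat) (h : R).

(** The induction hypothesis is applied to the differences of the G j, which again form a chain of
    derivatives; one mean value step per order remains. *)
Lemma iter_fun_dif_MVT n (G : nat -> R -> R) h theta :
  (forall j (x : R), 0 < x -> is_derive x 1 (G j) (G j.+1 x)) -> 0 < h -> 0 < theta ->
  exists2 xi, theta <= xi <= theta + n%:R * h &
    iter n (fun_dif h) (G 0) theta = (- h) ^+ n * G n xi.
Proof.
move=> dG h0 th0; elim: n G dG => [|n IH] G dG.
  by exists theta; rewrite ?mul0r ?addr0 ?lexx// expr0 mul1r.
have [|xi /andP[x1 x2]] := IH (fun j => fun_dif h (G j)).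
  by move=> j x x0; apply: is_derive_fun_dif; apply: dG => //; rewrite addr_gt0.
rewrite iterSr => ->.
have xi0 : 0 < xi by exact: lt_le_trans x1.
have xh : xi <= xi + h by rewrite lerDl ltW.
have dz z : z \in `]xi, xi + h[ -> is_derive z 1 (G n) (G n.+1 z).
  by rewrite in_itv /= => /andP[xz _]; apply: dG; exact: lt_trans xz.
have [|c] := MVT_segment xh dz.
  apply: derivable_within_continuous => z; rewrite in_itv /= => /andP[xz _].
  by have := dG n z (lt_le_trans xi0 xz) => /@ex_derive.
rewrite in_itv /= => /andP[c1 c2] e; exists c.
  by rewrite (le_trans x1)//= -natr1 mulrDl mul1r addrA (le_trans c2)// lerD2r.
rewrite /fun_dif -opprB e exprSr addrAC subrr add0r; ring.
Qed.

Lemma iter_fun_dif_lap (mu : prob) n h theta : 0 < h -> 0 <= theta ->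
  iter n (fun_dif h) (lap mu) theta = \int[mu]_(y in Sp) (lapf theta y * (1 - lapf h y) ^+ n).
Proof.
move=> h0; have mS := measurable_Sp R.
have b1 : bmf Sp (fun y => 1 - lapf h y) by apply: bmfB; [exact: bmf_cst|apply: bmf_lapf; exact: ltW].
have bn m : bmf Sp (fun y => (1 - lapf h y) ^+ m).
  elim: m => [|m IHm]; first exact: bmf_cst.
  by under eq_fun do rewrite exprS; exact: bmfM.
elim: n theta => [|n IH] theta t0.
  by apply: eq_Rintegral => y _; rewrite expr0 mulr1.
have t1 : 0 <= theta + h by rewrite addr_ge0// ltW.
rewrite iterS /fun_dif !IH// -bintB//; try by apply: bmfM => //; exact: bmf_lapf.
apply: eq_Rintegral => y _.
have -> : lapf (theta + h) y = lapf theta y * lapf h y.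
  by case: y => [r| |] /=; rewrite ?mulr0// -expRD; congr expR; ring.
by rewrite exprS; ring.
Qed.

Lemma iter_fun_dif_lap_ge0 (mu : prob) n h theta : on_Sp mu -> 0 < h -> 0 <= theta ->
  0 <= iter n (fun_dif h) (lap mu) theta.
Proof.
move=> hmu h0 t0; rewrite iter_fun_dif_lap//.
apply: Rintegral_ge0 => y Sy; rewrite mulr_ge0 ?lapf_ge0// exprn_ge0// subr_ge0.
by rewrite lapf_le1// ltW.
Qed.

Lemma iter_fun_dif_affine n (f g : R -> R) (a b h theta : R) :
  (forall x, theta <= x -> g x = a + b * f x) -> 0 < h ->
  iter n.+1 (fun_dif h) g theta = b * iter n.+1 (fun_dif h) f theta.
Proof.
move=> fg h0; elim: n theta fg => [|n IH] theta fg.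
  by rewrite /= /fun_dif !fg// ?lerDl 1?ltW//; ring.
rewrite iterS {1}/fun_dif !IH ?mulrBr// => x hx; apply: fg => //.
by apply: le_trans hx; rewrite lerDl ltW.
Qed.

Lemma iter_fun_dif_cvg n (g : nat -> R -> R) f h theta : 0 < h -> 0 < theta ->
  (forall x : R, 0 < x -> g m x @[m --> \oo] --> f x) ->
  iter n (fun_dif h) (g m) theta @[m --> \oo] --> iter n (fun_dif h) f theta.
Proof.
move=> h0 t0 H; elim: n theta t0 => [|n IH] theta t0; first exact: H.
by apply: cvgB; apply: IH => //; rewrite addr_gt0.
Qed.

Lemma cvg_sub1_expR (a : R) : 0 <= a ->
  m.+1%:R * (1 - expR (- m.+1%:R^-1 * a)) @[m --> \oo] --> a.
Proof.
move=> a0; apply/cvgrPdist_le => e e0.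
pose K := a ^+ 2 * expR a; have K0 : 0 <= K by rewrite mulr_ge0 ?sqr_ge0 ?expR_ge0.
have [N hN] : exists N : nat, K / e <= N%:R.
  by exists (Num.bound (K / e)); apply: ltW; apply: archi_boundP; rewrite divr_ge0// ltW.
exists N => // m /= Nm.
have m0 : 0 < m.+1%:R :> R by [].
set q := m.+1%:R^-1; have q0 : 0 < q by rewrite invr_gt0.
have q1 : q <= 1 by rewrite invf_le1// ler1n.
have mq : m.+1%:R * q = 1 by rewrite mulfV ?gt_eqF.
have -> : a - m.+1%:R * (1 - expR (- q * a)) = m.+1%:R * (expR (- q * a) - 1 - - q * a).
  have aE : a = m.+1%:R * q * a by rewrite mq mul1r.
  by rewrite {1}aE; ring.
rewrite normrM (ger0_norm (ltW m0)).
have H := norm_expR_sub1a (- q * a).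
have H1 : (- q * a) ^+ 2 * expR `|- q * a| <= q * (q * K).
  rewrite mulNr sqrrN normrN ger0_norm ?mulr_ge0 ?(ltW q0)//.
  rewrite (_ : q * (q * K) = (q * a) ^+ 2 * expR a); last by rewrite /K; ring.
  by rewrite ler_wpM2l ?sqr_ge0// ler_expR ler_piMl.
apply: (@le_trans _ _ (m.+1%:R * (q * (q * K)))).
  by rewrite ler_pM2l//; exact: le_trans H H1.
rewrite mulrA mq mul1r /q mulrC ler_pdivrMr// mulrC -ler_pdivrMr//.
by apply: (le_trans hN); rewrite ler_nat (leq_trans Nm).
Qed.

End IteratedDifferences.

(** * The Bernstein property of the exponents *)

Section BernsteinExponent.
Variable R : realType.
Local Notation Sp := (@Sp R).
Local Notation prob := (probability (\bar R) R).
Local Notation C := R[i].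
Local Notation Re := complex.Re.
Variable k : R -> R -> \bar R -> prob.
Variable v : R -> R -> C -> C.
Hypothesis hk : BP_kernel_family k.
Hypothesis hv : forall s t, Delta s t -> holomorphic_on_H (v s t) /\ laplace_rel (k s t) (v s t).
Local Notation V := (real_exponent v).

Definition lap_moment (mu : prob) j (theta : R) : R := Re (cint mu (cl j theta%:C%C)).

Lemma is_derive_lap_moment mu j (theta : R) : on_Sp mu -> 0 < theta ->
  is_derive theta 1 (lap_moment mu j) (- lap_moment mu j.+1 theta).
Proof.
move=> hmu t0; have h : 0 < Re theta%:C%C by [].
by have := cderiv_real_line (cderiv_cint_cl j hmu h); rewrite cReN; exact.
Qed.

Lemma smooth_lap_moment mu j n : on_Sp mu -> smooth n (lap_moment mu j).
Proof.
move=> hmu; elim: n j => [//|n IH] j; exists (fun x => - lap_moment mu j.+1 x); split.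
  by move=> x x0; exact: is_derive_lap_moment.
exact: smoothN.
Qed.

Variables (s t : R).
Hypothesis D : Delta s t.
Let mu := k s t 1%:E.

Let Sp_fin (x : R) : 0 <= x -> Sp x%:E.
Proof. by rewrite /Defs.Sp /= lee_fin. Qed.

Let hmu : on_Sp mu := BP_on_Sp hk D (Sp_fin ler01).

Lemma smooth_real_exponent n : smooth n (V s t).
Proof.
have E x : 0 < x -> lap_moment mu 0 x = expR (- V s t x).
  by move=> x0; rewrite /lap_moment cint_cl_real/= (lap_kernel hv D ltr01 x0) mulN1r.
(* The derivative of minus the logarithm of the transform is a quotient of Laplace moments, so all
   higher orders follow from the rules for products and inverses. *)
apply: smooth_pred; exists (fun x => lap_moment mu 1 x * (lap_moment mu 0 x)^-1); split; last first.
  apply: smoothM; first exact: smooth_lap_moment.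
  by apply: smoothV; [move=> x x0; rewrite E// gt_eqF ?expR_gt0|exact: smooth_lap_moment].
move=> x x0.
apply: (@near_eq_is_derive _ _ _ (fun x => - ln (lap_moment mu 0 x))).
  by apply: near_pos_eq => // y y0; rewrite E// expRK opprK.
have p0 : 0 < lap_moment mu 0 x by rewrite E// expR_gt0.
have := @is_derive1_comp R (@ln R) (lap_moment mu 0) x _ _ (is_derive1_ln p0) (is_derive_lap_moment 0 hmu x0).
by move=> /is_deriveN; rewrite mulrN opprK mulrC; exact.
Qed.

Lemma real_exponent_dif_le0 n (h theta : R) : 0 < h -> 0 < theta ->
  iter n.+1 (fun_dif h) (V s t) theta <= 0.
Proof.
move=> h0 t0.
pose g (m : nat) (x : R) := m.+1%:R * (1 - expR (- m.+1%:R^-1 * V s t x)).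
have cg : iter n.+1 (fun_dif h) (g m) theta @[m --> \oo] --> iter n.+1 (fun_dif h) (V s t) theta.
  apply: iter_fun_dif_cvg => // x x0; apply: cvg_sub1_expR.
  by apply: ltW; exact: (real_exponent_gt0 hk hv).
rewrite -(cvg_lim _ cg)//; apply: limr_le; first by apply/cvg_ex; eexists; exact: cg.
near=> m; have q0 : 0 < m.+1%:R^-1 :> R by rewrite invr_gt0.
rewrite (@iter_fun_dif_affine _ _ (lap (k s t (m.+1%:R^-1)%:E)) _ m.+1%:R (- m.+1%:R))//.
  rewrite mulNr oppr_le0 mulr_ge0//; apply: iter_fun_dif_lap_ge0 => //; last exact: ltW.
  by apply: (BP_on_Sp hk D); apply: Sp_fin; exact: ltW.
move=> x hx; rewrite (lap_kernel hv D)//; last exact: lt_le_trans hx.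
by rewrite /g; ring.
Unshelve. all: by end_near. Qed.

Lemma Bernstein_real_exponent : Bernstein (V s t).
Proof.
have dV n (x : R) : 0 < x -> is_derive x 1 (derive1n n (V s t)) (derive1n n.+1 (V s t) x).
  by move=> x0; apply: smooth_derive1n => //; exact: smooth_real_exponent.
split; [|split].
- by move=> n x x0; have [] := dV n x x0.
- by move=> x x0; apply: ltW; exact: (real_exponent_gt0 hk hv).
move=> n x x0; set F := derive1n n.+1 (V s t).
(* From differences to derivatives: a wrong sign at x persists on a ball of radius d. With (n + 1) h
   = d / 2 the mean value point lies in it, and the difference of order n + 1 inherits the wrong
   sign. *)
rewrite leNgt; apply/negP => Fx.
have cF : {for x, continuous (fun y => (-1) ^+ n * F y)}.
  apply: cvgM; first exact: cvg_cst.
  by apply: differentiable_continuous; apply/derivable1_diffP; have [] := dV n.+1 x x0.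
have Hx := cvgr_lt _ cF _ Fx; have [d /= d0 Hd] := (nbhs_ballP _ _).1 (Hx _).
pose h := d / (2 * n.+1%:R); have n0 : 0 < n.+1%:R :> R by [].
have h0 : 0 < h by rewrite divr_gt0// mulr_gt0.
have [xi /andP[x1 x2] E] := @iter_fun_dif_MVT R n.+1 (fun j => derive1n j (V s t)) h x dV h0 x0.
have := real_exponent_dif_le0 n h0 x0; move: E => /= ->.
have : ball x d xi.
  have nh : n.+1%:R * h = d / 2 by rewrite /h; field; rewrite nat1r gt_eqF.
  rewrite nh in x2; rewrite /ball /= ler0_norm ?subr_le0// opprB; lra.
move=> /Hd /= Hxi.
rewrite exprNn exprS -mulrA mulN1r mulNr oppr_le0 mulrCA pmulr_rge0 ?exprn_gt0//.
by rewrite leNgt Hxi.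
Qed.

Lemma exponent_inBF : inBF (v s t).
Proof.
have V1 := real_exponent_gt0 hk hv D ltr01.
split; first by have [H _] := exponent_evolution hk hv; exact: H.
exists (V s t); split; first exact: Bernstein_real_exponent.
split; first by exists 1; split => //; rewrite gt_eqF.
by move=> x x0; exact: (real_exponentE hv D).
Qed.

End BernsteinExponent.

Theorem mainTheorem1 (R : realType) :
  (* (1) *)
  (forall (k : R -> R -> \bar R -> probability (\bar R) R)
          (v : R -> R -> R[i] -> R[i]),
     BP_kernel_family k ->
     (* v_{s,t} is the Laplace exponent of k_{s,t}, extended holomorphically to H *)
     (forall s t, Delta s t -> holomorphic_on_H (v s t) /\ laplace_rel (k s t) (v s t)) ->
     top_rev_evol_family_H v /\ (forall s t, Delta s t -> inBF (v s t)))
  /\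
  (* (2) *)
  (forall v : R -> R -> R[i] -> R[i],
     top_rev_evol_family_H v -> (forall s t, Delta s t -> inBF (v s t)) ->
     (exists k : R -> R -> \bar R -> probability (\bar R) R,
        BP_kernel_family k /\ (forall s t, Delta s t -> laplace_rel (k s t) (v s t)))
     /\
     (forall k1 k2 : R -> R -> \bar R -> probability (\bar R) R,
        BP_kernel_family k1 -> (forall s t, Delta s t -> laplace_rel (k1 s t) (v s t)) ->
        BP_kernel_family k2 -> (forall s t, Delta s t -> laplace_rel (k2 s t) (v s t)) ->
        forall s t x (B : set (\bar R)), Delta s t -> Sp x -> measurable B ->
          k1 s t x B = k2 s t x B)).
Proof.
split=> [k v hk hv|v hv hBF].
  by split; [exact: (exponent_evolution hk hv)|move=> s t D; exact: (exponent_inBF hk hv D)].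
split; first exact: branching_kernels_exist.
by move=> k1 k2; exact: branching_kernels_unique.
Qed.
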